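(* For a finite automaton $A$ over $\Sigma=\Sigma_l\uplus\Sigma_h$ such that $A\backslash\Sigma_h$ is deterministic, the SNNI controller synthesis problem (given $A$ and a set $\Sigma_c\subseteq\Sigma$ of controllable actions, decide whether there exists a controller $C$ such that $C(A)$ is SNNI and, if so, compute one) is PSPACE-complete.
   Context: A finite automaton is $A=(Q,q_0,\Sigma^\varepsilon,E)$ with finite states $Q$, initial $q_0$, finite alphabet $\Sigma$, $\Sigma^\varepsilon=\Sigma\cup\{\varepsilon\}$, edges $E\subseteq Q\times\Sigma^\varepsilon\times Q$; it is deterministic if any two edges with the same source and the same label have the same target. Its language $\mathcal{L}(A)\subseteq\Sigma^*$ is the set of labels ($\varepsilon$ erased) of finite paths from $q_0$ (time is not taken into account). For $L\subseteq\Sigma$, $A/L$ relabels by $\varepsilon$ every edge labelled in $L$, and $A\backslash L$ deletes those edges. A system is SNNI iff $\mathcal{L}(\cdot\backslash\Sigma_h)=\mathcal{L}(\cdot/\Sigma_h)$. Let $\Sigma_u=\Sigma\setminus\Sigma_c$. A controller maps each run $\rho$ of $A$ to a subset $C(\rho)\subseteq\Sigma_c$ (possibly empty); $C(A)$ is the system whose runs are defined inductively: the empty run is a run, and an extension $\rho\xrightarrow{e}q'$ (a run of $A$) of a run $\rho$ of $C(A)$ is a run of $C(A)$ iff $e\in\Sigma_u$ or $e\in\Sigma_c\cap C(\rho)$. *)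

(* Defs.v *)
From mathcomp Require Import all_boot.

Set Implicit Arguments.
Unset Strict Implicit.
Unset Printing Implicit Defensive.

(** * Deterministic multi-tape Turing machines over bit strings *)

Inductive move := MoveL | Stay | MoveR.

(* A tape cell is blank ([None]), a bit, or a symbol of the auxiliary
   alphabet [aux]. *)
Definition cell (aux : finType) : finType := option (bool + aux)%type.

Record TM := MkTM {
  ntapes : nat; (* the machine has [ntapes.+1] tapes *)
  aux : finType;
  state : finType;
  start : state;
  halt : pred state;
  accept : pred state;
  delta : state -> {ffun 'I_ntapes.+1 -> cell aux} ->
            state * ('I_ntapes.+1 -> cell aux * move)
}.

(* A two-way infinite tape: [l] is the part to the left of the head, nearest
   cell first; [r] starts with the scanned cell.  Cells beyond [l] and [r] are
   blank.  The machine writes at each step, so [l] and [r] only grow by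
   visiting new cells. *)
Definition tape (G : finType) : Type := (seq (cell G) * seq (cell G))%type.

Definition tape_read (G : finType) (tp : tape G) : cell G := head None tp.2.

Definition tape_write (G : finType) (x : cell G) (tp : tape G) : tape G :=
  (tp.1, x :: behead tp.2).

Definition tape_move (G : finType) (d : move) (tp : tape G) : tape G :=
  match d with
  | MoveL => (behead tp.1, head None tp.1 :: tp.2)
  | Stay => tp
  | MoveR => (head None tp.2 :: tp.1, behead tp.2)
  end.

Definition config (M : TM) : Type :=
  (state M * {ffun 'I_(ntapes M).+1 -> tape (aux M)})%type.

Definition initial (M : TM) (w : seq bool) : config M :=
  (start M,
   [ffun i => ([::], if i == ord0 then [seq Some (inl b) | b <- w] else [::])]).

Definition step (M : TM) (c : config M) : config M :=
  if halt c.1 then c else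
  let: (q, act) := delta c.1 [ffun i => tape_read (c.2 i)] in
  (q, [ffun i => tape_move (act i).2 (tape_write (act i).1 (c.2 i))]).

Definition config_at (M : TM) (w : seq bool) (t : nat) : config M :=
  iter t (@step M) (initial M w).

Definition space (M : TM) (c : config M) : nat :=
  \sum_(i < (ntapes M).+1) (size (c.2 i).1 + size (c.2 i).2).

Fixpoint leading_bits (G : finType) (r : seq (cell G)) : seq bool :=
  if r is Some (inl b) :: r' then b :: leading_bits r' else [::].

(* The output is the maximal bit string starting at the head of tape 0. *)
Definition output (M : TM) (c : config M) : seq bool :=
  leading_bits (c.2 ord0).2.

(** * Polynomial time, polynomial space *)

Definition language : Type := seq bool -> Prop.

Definition pspace_decider (M : TM) (L : language) : Prop :=
  exists c d : nat, forall w : seq bool,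
    (forall t, space (config_at M w t) <= c * size w ^ d + c) /\
    (exists2 t, halt (config_at M w t).1
              & L w <-> accept (config_at M w t).1).

Definition in_PSPACE (L : language) : Prop := exists M, pspace_decider M L.

(* [L] is the set of inputs that have a solution, [R w v] says that [v] is a
   solution for [w]. *)
Definition PSPACE_search (L : language) (R : seq bool -> seq bool -> Prop) :
    Prop :=
  exists2 M, pspace_decider M L
    & forall w t, L w -> halt (config_at M w t).1 ->
        R w (output (config_at M w t)).

Definition polytime_computable (f : seq bool -> seq bool) : Prop :=
  exists (M : TM) (c d : nat), forall w : seq bool,
    exists t, [/\ t <= c * size w ^ d + c, halt (config_at M w t).1
                & output (config_at M w t) = f w].

Definition polytime_reducible (L1 L2 : language) : Prop :=
  exists2 f, polytime_computable f & forall w, L1 w <-> L2 (f w).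

Definition PSPACE_hard (L : language) : Prop :=
  forall L', in_PSPACE L' -> polytime_reducible L' L.

Definition PSPACE_complete (L : language) : Prop :=
  in_PSPACE L /\ PSPACE_hard L.

(** * Finite automata, control and non-interference *)

(* The label [None] is the silent label epsilon. *)
Record automaton (Q S : finType) := Automaton {
  init : Q;
  edges : {set Q * option S * Q}
}.

Definition deterministic (Q S : finType) (A : automaton Q S) : Prop :=
  forall q a q1 q2, (q, a, q1) \in edges A -> (q, a, q2) \in edges A -> q1 = q2.

Definition label_in (S : finType) (L : {set S}) (a : option S) : bool :=
  if a is Some e then e \in L else false.

Definition del_edges (Q S : finType) (A : automaton Q S) (L : {set S}) :
    automaton Q S :=
  Automaton (init A) [set e in edges A | ~~ label_in L e.1.2].

(* The sequence of pairs (label, target state) of a path. *)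
Definition steps (Q S : finType) : Type := seq (option S * Q).

Fixpoint walk (Q S : finType) (A : automaton Q S) (q : Q) (r : steps Q S) :
    bool :=
  if r is (a, q') :: r' then ((q, a, q') \in edges A) && walk A q' r' else true.

Definition is_run (Q S : finType) (A : automaton Q S) (r : steps Q S) : bool :=
  walk A (init A) r.

(* A controlled automaton is in general not a finite automaton: a system is
   given by its set of runs, and [\], [/] and the language are defined on
   runs. *)
Definition system (Q S : finType) : Type := steps Q S -> Prop.

Definition restrict (Q S : finType) (X : system Q S) (L : {set S}) :
    system Q S :=
  fun r => X r /\ all (fun s => ~~ label_in L s.1) r.

Definition hide_step (Q S : finType) (L : {set S}) (s : option S * Q) :
    option S * Q :=
  (if label_in L s.1 then None else s.1, s.2).

Definition hide (Q S : finType) (X : system Q S) (L : {set S}) : system Q S :=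
  fun r => exists2 r0, X r0 & r = map (hide_step L) r0.

Definition trace (Q S : finType) (r : steps Q S) : seq S := pmap fst r.

Definition lang (Q S : finType) (X : system Q S) (w : seq S) : Prop :=
  exists2 r, X r & w = trace r.

Definition SNNI (Q S : finType) (Sh : {set S}) (X : system Q S) : Prop :=
  forall w, lang (restrict X Sh) w <-> lang (hide X Sh) w.

(* Only the values on runs of the automaton matter. *)
Definition is_controller (Q S : finType) (A : automaton Q S) (Sc : {set S})
    (C : steps Q S -> {set S}) : Prop :=
  forall r, is_run A r -> C r \subset Sc.

(* Controllers act on [Sc] only: silent steps, like the actions outside [Sc],
   cannot be prevented. *)
Definition enabled (Q S : finType) (Sc : {set S}) (C : steps Q S -> {set S})
    (r : steps Q S) (a : option S) : Prop :=
  if a is Some e then e \in ~: Sc \/ e \in Sc :&: C r else True.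

Inductive controlled (Q S : finType) (A : automaton Q S) (Sc : {set S})
    (C : steps Q S -> {set S}) : system Q S :=
| controlled_nil : controlled A Sc C [::]
| controlled_rcons r a q' :
    controlled A Sc C r -> is_run A (rcons r (a, q')) -> enabled Sc C r a ->
    controlled A Sc C (rcons r (a, q')).

Definition SNNI_controller (Q S : finType) (A : automaton Q S)
    (Sh Sc : {set S}) (C : steps Q S -> {set S}) : Prop :=
  is_controller A Sc C /\ SNNI Sh (controlled A Sc C).

(** * Instances and finite-state controllers as bit strings *)

Record instance := Instance {
  nstates : nat;
  nletters : nat;
  istart : 'I_nstates;
  ihigh : {set 'I_nletters};
  icontrol : {set 'I_nletters};
  iedges : seq ('I_nstates * option 'I_nletters * 'I_nstates)
}.

Definition iaut (I : instance) : automaton 'I_(nstates I) 'I_(nletters I) :=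
  Automaton (istart I) [set e in iedges I].

(* Numbers are written in unary, with end marker [false]. *)
Definition enc_nat (n : nat) : seq bool := rcons (nseq n true) false.

Definition enc_set (m : nat) (X : {set 'I_m}) : seq bool :=
  [seq a \in X | a <- enum 'I_m].

Definition enc_label (m : nat) (a : option 'I_m) : seq bool :=
  enc_nat (if a is Some e then e.+1 else 0).

Definition enc_edge (n m : nat) (e : 'I_n * option 'I_m * 'I_n) : seq bool :=
  enc_nat e.1.1 ++ enc_label e.1.2 ++ enc_nat e.2.

(* In the list of edges, [true] announces an edge and [false] ends the list. *)
Definition enc_instance (I : instance) : seq bool :=
  enc_nat (nstates I) ++ enc_nat (nletters I) ++ enc_nat (istart I) ++
  enc_set (ihigh I) ++ enc_set (icontrol I) ++
  rcons (flatten [seq true :: enc_edge e | e <- iedges I]) false.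

(* A controller with finite memory: the memory is updated at each step of the
   run, and the memory reached determines the set of allowed actions. *)
Record fsc (n m : nat) := Fsc {
  nmem : nat;
  mem0 : 'I_nmem;
  mem_next : 'I_nmem -> option 'I_m -> 'I_n -> 'I_nmem;
  mem_out : 'I_nmem -> {set 'I_m}
}.

Definition fsc_fun (n m : nat) (K : fsc n m) (r : steps 'I_n 'I_m) :
    {set 'I_m} :=
  mem_out (foldl (fun x s => mem_next x s.1 s.2) (mem0 K) r).

Definition enc_fsc (n m : nat) (K : fsc n m) : seq bool :=
  enc_nat (nmem K) ++ enc_nat (mem0 K) ++
  flatten [seq enc_set (mem_out x) | x <- enum 'I_(nmem K)] ++
  flatten [seq flatten
    [seq flatten [seq enc_nat (mem_next x a q) | q <- enum 'I_n]
      | a <- None :: [seq Some e | e <- enum 'I_m]]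
    | x <- enum 'I_(nmem K)].

(** * The synthesis problem *)

Definition low_deterministic (I : instance) : Prop :=
  deterministic (del_edges (iaut I) (ihigh I)).

Definition SNNI_controllable : language := fun w =>
  exists I, [/\ w = enc_instance I, low_deterministic I
    & exists C, SNNI_controller (iaut I) (ihigh I) (icontrol I) C].

Definition SNNI_synthesis (w v : seq bool) : Prop :=
  exists (I : instance) (K : fsc (nstates I) (nletters I)),
    [/\ w = enc_instance I, low_deterministic I, v = enc_fsc K
      & SNNI_controller (iaut I) (ihigh I) (icontrol I) (fsc_fun K)].

(* Main.v *)
(** If some controller makes the system SNNI, then so does the controller that
    allows no controllable action: the letters of a low run that matches a given
    trace occur in that trace, hence are uncontrollable when those of the trace
    are.  So the problem is the inclusion of [A'/Sh] in [A'\Sh], where [A'] is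
    [A] without its controllable edges, and a one-state controller is a solution.

    Membership.  The inclusion fails iff a bad vertex is reachable from a start
    vertex in a graph of exponential size, whose vertices are a set of states of
    [A'/Sh] and a superset of the states of [A'\Sh] reached on the same word.  By
    the recursion of Savitch this is a quantified boolean formula with
    polynomially many variables, whose kernel is a first-order formula over the
    word that consists of the values of the variables and of the instance.  A
    machine evaluates it by depth-first search.

    Hardness.  The letters of a word are the observations (state, scanned cells)
    of a machine of polynomial space.  A low run checks that the word is not the
    history of a rejecting computation: it either follows the control state, or
    guesses one cell of one tape and follows its content and its distance from
    the head.  A high action leads to a state that allows all low words.  *)
From HB Require Import structures.
Require Import Defs.
From mathcomp Require Import all_boot zify.
From Stdlib Require Import FunctionalExtensionality Classical ClassicalEpsilon.

Set Implicit Arguments.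
Unset Strict Implicit.
Unset Printing Implicit Defensive.

(** * Stack programs and their compilation to Turing machines *)

(** The bounds concern concrete machines, so programs are kept simple. For membership the whole
    decision sits in one fixed formula: the machine writes a quantifier prefix and evaluates it, and
    the recursion of Savitch becomes a statement about the meaning of formulas. Instances are in
    unary, so every state or label of an edge is a position of the word and quantifiers over
    positions reach it. With supersets of the low states every condition on an edge is an
    implication, and no exact set is computed.

    For hardness the obstacle is that the low part must be deterministic, the silent label included,
    while a cell has to be guessed. Every path counts, so the guess is one deterministic chain of
    silent edges through all tapes and distances: the place where a run leaves the chain is the
    guess. Distances are measured from the head, so that the scanned cells named by a letter are
    checked in one fixed block, and the range of distances is wide enough that a cell scanned at
    some time stays in it up to that time. *)

Section StackPrograms.
Variable G : finType.
Local Notation sym := (bool + G)%type.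

Definition store := nat -> seq sym.

Definition upd (s : store) (x : nat) (v : seq sym) : store :=
  fun y => if y == x then v else s y.

Inductive prog :=
| Skip
| Push of nat & nat & (option sym -> sym)
| Pop of nat
| Seq of prog & prog
| If of nat & pred (option sym) & prog & prog
| While of nat & pred (option sym) & prog.

(* [Push y x g] pushes on [y] the image by [g] of the top of [x].  [exec bnd p
   s s' t]: [p] leads from [s] to [s'] in [t] machine steps, and the height of
   a stack satisfies [bnd] whenever it has grown. *)
Inductive exec (bnd : pred nat) : prog -> store -> store -> nat -> Prop :=
| ESkip s : exec bnd Skip s s 1
| EPush y x g s : bnd (size (s y)).+1 ->
    exec bnd (Push y x g) s (upd s y (g (ohead (s x)) :: s y)) 2
| EPop x s : exec bnd (Pop x) s (upd s x (behead (s x))) 1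
| ESeq p q s1 s2 s3 t1 t2 : exec bnd p s1 s2 t1 -> exec bnd q s2 s3 t2 ->
    exec bnd (Seq p q) s1 s3 (t1 + t2)
| EIfT x (P : pred _) p q s s' t : P (ohead (s x)) -> exec bnd p s s' t ->
    exec bnd (If x P p q) s s' t.+1
| EIfF x (P : pred _) p q s s' t : ~~ P (ohead (s x)) -> exec bnd q s s' t ->
    exec bnd (If x P p q) s s' t.+1
| EWhileF x (P : pred _) p s : ~~ P (ohead (s x)) -> exec bnd (While x P p) s s 1
| EWhileT x (P : pred _) p s1 s2 s3 t1 t2 : P (ohead (s1 x)) -> exec bnd p s1 s2 t1 ->
    exec bnd (While x P p) s2 s3 t2 ->
    exec bnd (While x P p) s1 s3 (t1 + t2).+1.

(** The control states of the compiled program. [Push] takes two steps because a machine writes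
    before it moves: the head first moves left while the symbol to be written is kept in the state.
    In [If] and [While], [None] is the state that performs the test. *)
Fixpoint st (p : prog) : finType :=
  match p with
  | Skip | Pop _ => unit
  | Push _ _ _ => option sym
  | Seq p q => (st p + st q)%type
  | If _ _ p q => option (st p + st q)%type
  | While _ _ p => option (st p)
  end.

Fixpoint entry (p : prog) : st p :=
  match p with
  | Skip | Pop _ => tt
  | Push _ _ _ => None
  | Seq p q => inl (entry p)
  | If _ _ p q => None
  | While _ _ p => None
  end.

Definition keep (rd : nat -> cell G) : nat -> cell G * move :=
  fun i => (rd i, Stay).

Definition act_at (rd : nat -> cell G) (y : nat) (a : cell G * move) :
    nat -> cell G * move :=
  fun i => if i == y then a else (rd i, Stay).

(* The next state, [None] on exit, and the actions on the tapes. *)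
Fixpoint tr (p : prog) :
    st p -> (nat -> cell G) -> option (st p) * (nat -> cell G * move) :=
  match p return st p -> _ -> option (st p) * _ with
  | Skip => fun _ rd => (None, keep rd)
  | Push y x g => fun a rd =>
      if a is Some b then (None, act_at rd y (Some b, Stay))
      else (Some (Some (g (rd x))), act_at rd y (rd y, MoveL))
  | Pop x => fun _ rd =>
      (None, if rd x is Some _ then act_at rd x (None, MoveR) else keep rd)
  | Seq p q => fun a rd =>
      match a with
      | inl a => let: (o, f) := tr a rd in
          (Some (if o is Some b then inl b else inr (entry q)), f)
      | inr a => let: (o, f) := tr a rd in (omap inr o, f)
      end
  | If x P p q => fun a rd =>
      match a with
      | None => (Some (Some (if P (rd x) then inl (entry p)
                             else inr (entry q))), keep rd)
      | Some (inl a) => let: (o, f) := tr a rd in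
          (omap (fun b => Some (inl b)) o, f)
      | Some (inr a) => let: (o, f) := tr a rd in
          (omap (fun b => Some (inr b)) o, f)
      end
  | While x P p => fun a rd =>
      match a with
      | None => (if P (rd x) then Some (Some (entry p)) else None, keep rd)
      | Some a => let: (o, f) := tr a rd in (Some o, f)
      end
  end.

(* [vok k p]: [p] only uses the stacks [0], ..., [k]. *)
Fixpoint vok (k : nat) (p : prog) : bool :=
  match p with
  | Skip => true
  | Push y x _ => (y <= k) && (x <= k)
  | Pop x => x <= k
  | Seq p q => vok k p && vok k q
  | If x _ p q => [&& x <= k, vok k p & vok k q]
  | While x _ p => (x <= k) && vok k p
  end.

Definition machine (k r : nat) (p : prog) : TM :=
  @MkTM k G (st p + option bool)%type (inl (entry p))
    (fun q => if q is inr (Some _) then true else false)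
    (fun q => q == inr (Some true))
    (fun q rd => let rd' := fun i => rd (inord i) in
       match q with
       | inl a => let: (o, f) := tr a rd' in
           (if o is Some b then inl b else inr None, fun i : 'I_k.+1 => f i)
       | inr None => (inr (Some (rd' r != None)), fun i => (rd i, Stay))
       | inr (Some _) => (q, fun i => (rd i, Stay))
       end).

(** * Simulation of a stack program by its machine *)

Section Simulation.
Variables (bnd : pred nat) (k r : nat) (p0 : prog).
Let M := machine k r p0.
Local Notation tapes := {ffun 'I_k.+1 -> tape G}.

(** The head stands on the top of the stack. The [j] blanks to its left were vacated by pops, so
    [j + size l] is the largest height reached so far, and this is the quantity to be bounded. The
    blank below the stack ([i = 1]) appears when an empty tape is rewritten. *)
Definition reptp (tp : tape G) (l : seq sym) : Prop :=
  exists j i, [/\ tp = (nseq j None, map Some l ++ nseq i None), i <= 1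
                & bnd (j + size l)].

Definition rep (T : tapes) (s : store) : Prop :=
  forall i : 'I_k.+1, reptp (T i) (s i).

Definition small (T : tapes) : Prop :=
  forall i, exists2 z, bnd z & size (T i).1 + size (T i).2 <= z.+1.

Lemma rep_small T s : rep T s -> small T.
Proof.
move=> H i; case: (H i) => j [n [-> ln b]]; exists (j + size (s i)) => //=.
by rewrite size_cat !size_nseq size_map; lia.
Qed.

Lemma reptp_read tp l : reptp tp l -> tape_read tp = ohead l.
Proof. by case=> j [i [-> li _]]; case: l => //=; case: i li. Qed.

Lemma reptp_keep tp l :
  reptp tp l -> reptp (tape_move Stay (tape_write (tape_read tp) tp)) l.
Proof.
move=> H; rewrite (reptp_read H); case: H => j [i [-> li b]].
case: l b => [|a l] b /=; last by exists j, i.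
by exists j, 1; split=> //; case: i li => [|[]].
Qed.

Lemma rep_read T s x : rep T s -> x <= k ->
  [ffun i => tape_read (T i)] (inord x) = ohead (s x).
Proof. by move=> H lx; rewrite ffunE (reptp_read (H _)) inordK. Qed.

Definition sweep (T : tapes) (f : nat -> cell G * move) : tapes :=
  [ffun i : 'I_k.+1 => tape_move (f i).2 (tape_write (f i).1 (T i))].

Lemma sweepE T f i :
  sweep T f i = tape_move (f i).2 (tape_write (f i).1 (T i)).
Proof. by rewrite ffunE. Qed.

Local Notation rd T := (fun i => [ffun j => tape_read (T j)] (inord i)).

Lemma rep_keep T s : rep T s -> rep (sweep T (keep (rd T))) s.
Proof.
by move=> H i; rewrite !ffunE /= ffunE inord_val; apply: reptp_keep.
Qed.

Lemma rep_act T s y a v : rep T s -> y <= k ->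
  reptp (tape_move a.2 (tape_write a.1 (T (inord y)))) v ->
  rep (sweep T (act_at (rd T) y a)) (upd s y v).
Proof.
move=> H ly Hv i; rewrite ffunE /act_at /upd.
case: (nat_of_ord i =P y) => [e|ne]; last first.
  by rewrite /= ffunE inord_val; apply: reptp_keep.
by have -> : i = inord y by apply: val_inj; rewrite /= inordK.
Qed.

Section Embedding.
Variables (p : prog) (io : st p -> state M) (e : state M).
(** The states of a subprogram sit inside those of the whole machine through [io], and its exit is
    the state [e]. Stating the simulation for every such embedding lets the induction on executions
    pass to subprograms. *)
Definition embeds : Prop :=
  (forall a, ~~ halt (io a)) /\
  (forall a rd, delta (io a) rd =
     let: (o, f) := tr a (fun i => rd (inord i)) in
     (if o is Some b then io b else e, fun i : 'I_k.+1 => f i)).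
End Embedding.

Lemma embeds_step p (io : st p -> state M) e a T : embeds io e ->
  step ((io a, T) : config M) =
  let: (o, f) := tr a (rd T) in
  (if o is Some b then io b else e, sweep T f).
Proof.
case=> nh Hd; rewrite /step; rewrite ifN; last exact: nh.
rewrite -[(io a, T).1]/(io a) Hd -[(io a, T).2]/T; case: (tr _ _) => o f.
by congr pair; apply/ffunP=> i; rewrite !ffunE.
Qed.

Definition runs (c : config M) (t : nat) (c' : config M) : Prop :=
  iter t (@step M) c = c' /\ forall t', t' <= t -> small (iter t' (@step M) c).2.

Lemma runs_cat c1 c2 c3 t1 t2 :
  runs c1 t1 c2 -> runs c2 t2 c3 -> runs c1 (t1 + t2) c3.
Proof.
move=> [e1 h1] [e2 h2]; split=> [|t'].
  by rewrite addnC iterD e1.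
have [/h1//|lt le] := leqP t' t1.
by rewrite -(subnK (ltnW lt)) iterD e1; apply: h2; lia.
Qed.

Lemma runs1 (c c' : config M) : small c.2 -> small c'.2 -> step c = c' -> runs c 1 c'.
Proof. by move=> h h' e; split=> [|[|[|]]] //= _; rewrite e. Qed.

Lemma exec_sim p s s' t : exec bnd p s s' t ->
  forall (io : st p -> state M) e T, embeds io e -> vok k p -> rep T s ->
  exists2 T', rep T' s' & runs (io (entry p), T) t (e, T').
Proof.
elim=> {p s s' t}.
- move=> s io e T E _ H; exists (sweep T (keep (rd T))); first exact: rep_keep.
  apply: runs1; [exact: rep_small H | exact: rep_small (rep_keep H)|].
  by rewrite (embeds_step _ _ E).
- move=> y x g s b io e T E /andP[ly lx] H.
  set T1 := sweep T (act_at (rd T) y (rd T y, MoveL)).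
  set a := g (ohead (s x)).
  have E1 : step ((io None, T) : config M) = (io (Some a), T1).
    by rewrite (embeds_step _ _ E) /= -/T1 (rep_read H lx).
  set T2 := sweep T1 (act_at (rd T1) y (Some a, Stay)).
  have E2 : step ((io (Some a), T1) : config M) = (e, T2).
    by rewrite (embeds_step _ _ E).
  have Hy := H (inord y); rewrite inordK // in Hy.
  have TT : forall i : 'I_k.+1, (i : nat) != y -> reptp (T1 i) (s i).
    move=> i ne; rewrite /T1 sweepE /act_at (negPf ne) /= ffunE inord_val.
    exact: reptp_keep.
  (* Between the two steps of a push, a blank is scanned on top of stack [y], and the tape
     represents no stack; its shape and its size are followed by hand. *)
  have T1y : exists j i, [/\ T1 (inord y) =
      (nseq j None, None :: map Some (s y) ++ nseq i None), i <= 1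
      & bnd (j + (size (s y)).+1)].
    rewrite /T1 sweepE /act_at inordK // eqxx /fst /snd ffunE.
    rewrite -[tape_write _ _]/(tape_move Stay (tape_write _ _)).
    case: (reptp_keep Hy) => j [i [-> li bj]].
    case: j bj => [|j] bj; first by exists 0, i.
    by exists j, i; split=> //; rewrite addnS.
  have R2 : rep T2 (upd s y (a :: s y)).
    move=> i; rewrite /T2 sweepE /act_at /upd; case: eqP => [ei|/eqP ne].
      have -> : i = inord y by apply: val_inj; rewrite /= inordK.
      case: T1y => j [n [-> ln bj]]; exists j, n; split=> //=.
    by rewrite /= ffunE inord_val; apply: reptp_keep; apply: TT.
  have S1 : small T1.
    move=> i; case: (nat_of_ord i =P y) => [ei|/eqP ne].
      have -> : i = inord y by apply: val_inj; rewrite /= inordK.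
      case: T1y => j [n [-> ln bj]]; exists (j + (size (s y)).+1) => //=.
      by rewrite size_cat !size_nseq size_map; lia.
    case: (TT i ne) => j [n [-> ln bj]]; exists (j + size (s i)) => //=.
    by rewrite size_cat !size_nseq size_map; lia.
  exists T2 => //; apply: (@runs_cat _ (io (Some a), T1) _ 1 1).
    by apply: runs1 => //; apply: rep_small H.
  by apply: runs1 => //; apply: rep_small R2.
- move=> x s io e T E lx H.
  have Hx := H (inord x); rewrite inordK // in Hx.
  set f := if rd T x is Some _ then act_at (rd T) x (None, MoveR) else
             keep (rd T).
  have R : rep (sweep T f) (upd s x (behead (s x))).
    rewrite /f (rep_read H lx); case es: (s x) => [|a l] /=.
      have -> : upd s x [::] = s.
        by apply: functional_extensionality => y; rewrite /upd; case: eqP => // ->; rewrite es.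
      exact: rep_keep.
    apply: rep_act => //; rewrite es in Hx; case: Hx => j [i [-> li bj]] /=.
    by exists j.+1, i; split=> //; rewrite addSnnS.
  exists (sweep T f) => //.
  apply: runs1; [exact: rep_small H | exact: rep_small R|].
  by rewrite (embeds_step _ _ E).
- move=> p q s1 s2 s3 t1 t2 _ IH1 _ IH2 io e T [nh E] /andP[kp kq] H.
  have [|T1 H1 r1] := IH1 (fun a => io (inl a)) (io (inr (entry q))) T _ kp H.
    by split=> // a rd0; rewrite E /=; case: (tr _ _) => [[]].
  have [|T2 H2 r2] := IH2 (fun a => io (inr a)) e T1 _ kq H1.
    by split=> // a rd0; rewrite E /=; case: (tr _ _) => [[]].
  by exists T2 => //; apply: runs_cat r1 r2.
- move=> x P p q s s' t Px _ IH io e T [nh E] /and3P[kx kp kq] H.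
  have [|T1 H1 r1] :=
    IH (fun a => io (Some (inl a))) e _ _ kp (rep_keep H).
    by split=> // a rd0; rewrite E /=; case: (tr _ _) => [[]].
  exists T1 => //; refine (@runs_cat _ _ _ 1 t _ r1).
  apply: runs1; [exact: rep_small H | exact: rep_small (rep_keep H)|].
  by rewrite (embeds_step _ _ (conj nh E)) /= (rep_read H kx) Px.
- move=> x P p q s s' t Px _ IH io e T [nh E] /and3P[kx kp kq] H.
  have [|T1 H1 r1] :=
    IH (fun a => io (Some (inr a))) e _ _ kq (rep_keep H).
    by split=> // a rd0; rewrite E /=; case: (tr _ _) => [[]].
  exists T1 => //; refine (@runs_cat _ _ _ 1 t _ r1).
  apply: runs1; [exact: rep_small H | exact: rep_small (rep_keep H)|].
  by rewrite (embeds_step _ _ (conj nh E)) /= (rep_read H kx) (negPf Px).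
- move=> x P p s Px io e T E /andP[kx kp] H.
  exists (sweep T (keep (rd T))); first exact: rep_keep.
  apply: runs1; [exact: rep_small H | exact: rep_small (rep_keep H)|].
  by rewrite (embeds_step _ _ E) /= (rep_read H kx) (negPf Px).
- move=> x P p s1 s2 s3 t1 t2 Px _ IH1 _ IH2 io e T [nh E] kk H.
  have /andP[kx kp] := kk.
  have [|T1 H1 r1] := IH1 (fun a => io (Some a)) (io None) _ _ kp (rep_keep H).
    by split=> // a rd0; rewrite E /=; case: (tr _ _) => [[]].
  have [T2 H2 r2] := IH2 io e T1 (conj nh E) kk H1.
  exists T2 => //; refine (@runs_cat _ _ _ 1 (t1 + t2) _ (runs_cat r1 r2)).
  apply: runs1; [exact: rep_small H | exact: rep_small (rep_keep H)|].
  by rewrite (embeds_step _ _ (conj nh E)) /= (rep_read H kx) Px.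
Qed.

Definition input_store (w : seq bool) : store :=
  fun x => if x == 0 then map inl w else [::].

Lemma machine_run w s' t : bnd 0 -> bnd (size w) -> r <= k -> vok k p0 ->
  exec bnd p0 (input_store w) s' t ->
  exists2 T', rep T' s'
    & runs (initial M w) t.+1 (inr (Some (s' r != [::])), T').
Proof.
move=> b0 bw lr kp Ex.
have H0 : rep (initial M w).2 (input_store w).
  move=> i; rewrite ffunE /input_store; exists 0, 0.
  have -> : (i == ord0) = (nat_of_ord i == 0) by [].
  case: eqP => _; split=> //=; first by rewrite cats0 -map_comp.
  by rewrite size_map.
have [|T H R] := exec_sim Ex (io := inl) (e := inr None) _ kp H0; first by split.
exists (sweep T (keep (rd T))); first exact: rep_keep.
set c' := (X in runs _ _ X).
suff : runs (initial M w) (t + 1) c' by rewrite addn1.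
apply: runs_cat R _; apply: runs1.
- exact: rep_small H.
- exact: rep_small (rep_keep H).
rewrite /step /= (rep_read H lr); congr (_, _); first by case: (s' r).
by apply/ffunP=> i; rewrite !ffunE /= ffunE inord_val.
Qed.

End Simulation.

Lemma halted_iter (M : TM) (c : config M) t :
  halt c.1 -> iter t (@step M) c = c.
Proof. by move=> h; elim: t => //= t ->; rewrite /step h. Qed.

Lemma halted_unique (M : TM) w t1 t2 : halt (config_at M w t1).1 ->
  halt (config_at M w t2).1 -> config_at M w t1 = config_at M w t2.
Proof.
wlog le : t1 t2 / t1 <= t2 => [W|] h1 h2.
  by case/orP: (leq_total t1 t2) => le; [apply: W | symmetry; apply: W].
by rewrite /config_at -(subnK le) iterD (halted_iter _ h1).
Qed.

Lemma leading_bits_rep (v : seq bool) i :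
  leading_bits (map Some (map inl v : seq sym) ++ nseq i None) = v.
Proof. by elim: v => [|b v /= ->] //; case: i. Qed.

End StackPrograms.

Arguments Skip {G}.
Arguments Pop {G}.
Arguments input_store {G}.

(** * Polynomial bounds and evaluation of first-order formulas *)

Definition poly (f : nat -> nat) : Prop :=
  exists c d, forall n, f n <= c * n ^ d + c.

Lemma leq_expnS n d e : d <= e -> n ^ d <= n ^ e + 1.
Proof.
case: n => [|n] le; first by case: d {le} => [|d]; rewrite ?expn0 ?leq_addl // exp0n.
by rewrite (leq_trans (leq_pexp2l _ le)) ?leq_addr.
Qed.

Lemma poly_leq f g : (forall n, f n <= g n) -> poly g -> poly f.
Proof. by move=> le [c [d H]]; exists c, d => n; apply: leq_trans (H n). Qed.

Lemma poly_const k : poly (fun=> k).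
Proof. by exists k, 0 => n; rewrite leq_addl. Qed.

Lemma poly_id : poly id.
Proof. by exists 1, 1 => n; rewrite mul1n expn1 leq_addr. Qed.

Lemma poly_add f g : poly f -> poly g -> poly (fun n => f n + g n).
Proof.
move=> [c [d Hf]] [c' [d' Hg]]; exists (2 * (c + c')), (d + d') => n.
have := Hf n; have := Hg n.
have := leq_expnS n (leq_addr d' d); have := leq_expnS n (leq_addl d d').
move: (n ^ d) (n ^ d') (n ^ (d + d')) => a b z; nia.
Qed.

Lemma poly_mul f g : poly f -> poly g -> poly (fun n => f n * g n).
Proof.
move=> [c [d Hf]] [c' [d' Hg]]; exists (3 * (c * c')), (d + d') => n.
have := leq_mul (Hf n) (Hg n).
have := leq_expnS n (leq_addr d' d); have := leq_expnS n (leq_addl d d').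
rewrite expnD; move: (n ^ d) (n ^ d') => a b.
move: (f n * g n) => x; move: (c) (c') => k k' *.
have : (k * a + k) * (k' * b + k') = k * k' * ((a + 1) * (b + 1)) by lia.
have : (a + 1) * (b + 1) <= 3 * (a * b) + 3 by nia.
move: (k * k') => kk; nia.
Qed.

Lemma poly_exp f d : poly f -> poly (fun n => f n ^ d).
Proof.
move=> Hf; elim: d => [|d IH]; first exact: poly_const.
by apply: poly_leq (poly_mul Hf IH) => n; rewrite expnS.
Qed.

(** * Complexity of compiled programs and elementary stack operations *)

Section Machines.
Variable G : finType.
Local Notation sym := (bool + G)%type.

Lemma pspace_machine (k r : nat) (p : prog G) (L : language)
    (R : seq bool -> seq bool -> Prop) (B : nat -> nat) :
  poly B -> (forall n, n <= B n) -> r <= k -> vok k p ->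
  (forall w, exists s' t, [/\ exec (fun z => z <= B (size w)) p (input_store w) s' t,
      L w <-> s' r <> [::] & L w -> exists2 v, s' 0 = map inl v & R w v]) ->
  pspace_decider (machine k r p) L /\ PSPACE_search L R.
Proof.
move=> pB leB lr kp H; set M := machine k r p.
have H' w : exists2 t, halt (config_at M w t).1 &
    [/\ L w <-> accept (config_at M w t).1,
       forall t', space (config_at M w t') <= k.+1 * (B (size w)).+1
     & L w -> R w (output (config_at M w t))].
  have [s' [t [E Lw Rw]]] := H w.
  have [T rT [e sm]] :=
    machine_run (bnd := fun z => z <= B (size w)) (leq0n _) (leB _) lr kp E.
  exists t.+1; rewrite /config_at e //; split.
  - rewrite Lw /=; case: (s' r) => [|a l] /=; split=> //.
  - move=> t'.
    have S t2 : t2 <= t.+1 -> space (iter t2 (@step M) (initial M w)) <= k.+1 * (B (size w)).+1.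
      move=> /sm S; rewrite /space -[X in X * _]card_ord -sum_nat_const.
      by apply: leq_sum => i _; case: (S i) => z /= lez le; apply: leq_trans le _.
    have [/S//|lt] := leqP t' t.+1.
    rewrite -(subnK (ltnW lt)) iterD e halted_iter // -e; exact: S.
  - move=> /Rw [v ev Rv]; rewrite /output /=.
    have := rT ord0; case=> j [i [-> _ _]] /=.
    by rewrite ev leading_bits_rep.
have D : pspace_decider M L.
  have [c [d Hp]] := poly_mul (poly_const k.+1) (poly_add pB (poly_const 1)).
  exists c, d => w; have [t h [a sp o]] := H' w; split; last by exists t.
  by move=> t'; apply: leq_trans (sp t') _; apply: leq_trans (Hp _); rewrite addn1.
split=> //; exists M => // w t Lw h.
have [t1 h1 [_ _ o]] := H' w; rewrite (halted_unique h h1); exact: o.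
Qed.

Lemma polytime_machine (k : nat) (p : prog G) (f : seq bool -> seq bool)
    (T : nat -> nat) :
  poly T -> vok k p ->
  (forall w, exists s' t, [/\ exec predT p (input_store w) s' t,
      s' 0 = map inl (f w) & t <= T (size w)]) ->
  polytime_computable f.
Proof.
move=> pT kp H; have [c [d Hp]] := poly_add pT (poly_const 1).
exists (machine k 0 p), c, d => w; have [s' [t [E ev le]]] := H w.
have [T' rT [e _]] := machine_run (r := 0) isT isT (leq0n _) kp E.
exists t.+1; split.
- by apply: leq_trans (Hp _); rewrite addn1.
- by rewrite /config_at e.
rewrite /config_at e /output /=.
have := rT ord0; case=> j [i [-> _ _]] /=.
by rewrite ev leading_bits_rep.
Qed.

Definition one : sym := inl true.
Definition pushc (y : nat) (a : sym) : prog G := Push y y (fun=> a).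
Definition mv (x y : nat) (f : sym -> sym) : prog G :=
  Seq (Push y x (fun o => if o is Some a then f a else one)) (Pop x).
Definition nonempty : pred (option sym) := isSome.
Definition mvall x y f := While x nonempty (mv x y f).
Definition clear x : prog G := While x nonempty (Pop x).
Definition seqs (ps : seq (prog G)) : prog G := foldr (@Seq G) Skip ps.
(** Stack 3 is the Boolean register: empty means false, one symbol means true. *)
Definition setR (b : bool) : prog G :=
  Seq (Pop 3) (if b then pushc 3 one else Skip).
Definition flag (b : bool) : seq sym := if b then [:: one] else [::].

Lemma updE (s : store G) x v y : upd s x v y = if y == x then v else s y.
Proof. by []. Qed.

Lemma upd_id (s : store G) x : upd s x (s x) = s.
Proof. by apply: functional_extensionality => y; rewrite /upd; case: eqP => // ->. Qed.

Lemma upd_eq (s : store G) x v : s x = v -> upd s x v = s.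
Proof. by move <-; apply: upd_id. Qed.

Lemma upd_upd (s : store G) x u v : upd (upd s x u) x v = upd s x v.
Proof. by apply: functional_extensionality => y; rewrite /upd; case: eqP. Qed.

Lemma updC (s : store G) x y u v : x != y ->
  upd (upd s x u) y v = upd (upd s y v) x u.
Proof.
move=> ne; apply: functional_extensionality => z; rewrite /upd.
by case: (z =P x) => [->|//]; rewrite (negPf ne).
Qed.

Lemma exec_eq bnd (p : prog G) s s1 s2 t1 t2 :
  exec bnd p s s1 t1 -> s1 = s2 -> t1 = t2 -> exec bnd p s s2 t2.
Proof. by move=> E <- <-. Qed.

Lemma exec_mv (bnd : pred nat) x y f (s : store G) a l : x != y -> s x = a :: l ->
  bnd (size (s y)).+1 ->
  exec bnd (mv x y f) s (upd (upd s x l) y (f a :: s y)) 3.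
Proof.
move=> ne e b; apply: exec_eq (ESeq (EPush _ _ b) (EPop _ _ _)) _ _ => //.
by rewrite e /= updE (negPf ne) e /= updC // eq_sym.
Qed.

Lemma exec_mvall (bnd : pred nat) x y f (s : store G) : x != y ->
  (forall z, z <= size (s x) + size (s y) -> bnd z) ->
  exec bnd (mvall x y f) s (upd (upd s x [::]) y (catrev (map f (s x)) (s y)))
    (4 * size (s x)).+1.
Proof.
move=> ne; move e : (s x) => l; elim: l s e => [|a l IH] s e b.
  rewrite [upd s x _]upd_eq // upd_eq //; apply: EWhileF; by rewrite e.
apply: exec_eq.
  apply: EWhileT; first by rewrite e.
    apply: (exec_mv _ ne e); apply: b; rewrite /= addSn; lia.
  apply: IH; first by rewrite !updE eqxx (negPf ne).
  by move=> z; rewrite updE eqxx /= => le; apply: b; rewrite /=; lia.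
- by rewrite updE eqxx /= (updC _ _ _ ne) upd_upd updC 1?eq_sym // upd_upd updC // eq_sym.
- by rewrite /=; lia.
Qed.

Lemma exec_clear (bnd : pred nat) x (s : store G) :
  exec bnd (clear x) s (upd s x [::]) (2 * size (s x)).+1.
Proof.
move e : (s x) => l; elim: l s e => [|a l IH] s e.
  rewrite upd_eq //; apply: EWhileF; by rewrite e.
apply: exec_eq.
  apply: EWhileT; first by rewrite e.
    exact: EPop.
  by apply: IH; rewrite updE eqxx e.
- by rewrite upd_upd.
- by rewrite /=; lia.
Qed.

Lemma exec_pushc (bnd : pred nat) y a (s : store G) : bnd (size (s y)).+1 ->
  exec bnd (pushc y a) s (upd s y (a :: s y)) 2.
Proof. exact: EPush. Qed.

(** * Evaluation of first-order formulas in bounded space *)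

Section Bounded.
Variable B : nat.

Definition ex (p : prog G) s s' := exists t, exec (fun z => z <= B) p s s' t.

Lemma ex_eq p s s1 s2 : ex p s s1 -> s1 = s2 -> ex p s s2.
Proof. by move=> E <-. Qed.

Lemma ex_skip s : ex Skip s s.
Proof. by exists 1; constructor. Qed.

Lemma ex_seq p q s1 s2 s3 : ex p s1 s2 -> ex q s2 s3 -> ex (Seq p q) s1 s3.
Proof. by move=> [t1 E1] [t2 E2]; exists (t1 + t2); apply: ESeq E1 E2. Qed.

Lemma ex_if x (P : pred _) p q s s' : ex (if P (ohead (s x)) then p else q) s s' ->
  ex (If x P p q) s s'.
Proof.
by case: ifP => Px [t E]; exists t.+1; [apply: EIfT | apply: EIfF; rewrite ?Px].
Qed.

Lemma ex_while0 x (P : pred _) p s : ~~ P (ohead (s x)) -> ex (While x P p) s s.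
Proof. by exists 1; constructor. Qed.

Lemma ex_while1 x (P : pred _) p s1 s2 s3 : P (ohead (s1 x)) -> ex p s1 s2 ->
  ex (While x P p) s2 s3 -> ex (While x P p) s1 s3.
Proof. by move=> Px [t1 E1] [t2 E2]; eexists; apply: EWhileT E1 E2. Qed.

Lemma ex_push y x g (s : store G) : size (s y) < B ->
  ex (Push y x g) s (upd s y (g (ohead (s x)) :: s y)).
Proof. by exists 2; constructor. Qed.

Lemma ex_pushc y a (s : store G) : size (s y) < B -> ex (pushc y a) s (upd s y (a :: s y)).
Proof. exact: ex_push. Qed.

Lemma ex_pop x s : ex (Pop x) s (upd s x (behead (s x))).
Proof. by exists 1; constructor. Qed.

Lemma ex_mv x y f (s : store G) a l : x != y -> s x = a :: l -> size (s y) < B ->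
  ex (mv x y f) s (upd (upd s x l) y (f a :: s y)).
Proof. by move=> ne e lt; exists 3; apply: exec_mv. Qed.

Lemma ex_mvall x y f (s : store G) : x != y -> size (s x) + size (s y) <= B ->
  ex (mvall x y f) s (upd (upd s x [::]) y (catrev (map f (s x)) (s y))).
Proof.
by move=> ne le; eexists; apply: exec_mvall => // z; move/leq_trans; apply.
Qed.

Lemma ex_clear x s : ex (clear x) s (upd s x [::]).
Proof. by eexists; apply: exec_clear. Qed.

Lemma ex_setR b (s : store G) : size (s 3) <= 1 -> 0 < B -> ex (setR b) s (upd s 3 (flag b)).
Proof.
move=> le lB; apply: ex_seq; first exact: ex_pop.
have e : behead (s 3) = [::] by case: (s 3) le => [|? []].
case: b => /=; rewrite e.
  by apply: ex_eq; [apply: ex_pushc; rewrite updE /= | rewrite upd_upd updE].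
exact: ex_skip.
Qed.

(* The term [(k, xs)] is the sum of [k] and of the variables [xs]. *)
Definition term : Type := (nat * seq nat)%type.

Inductive form :=
| Sym of pred (option sym) & term
| Lt of term & term
| Not of form
| And of form & form
| Ex of nat & form.

Definition tval (v : nat -> nat) (t : term) : nat := t.1 + sumn (map v t.2).

Definition updn (v : nat -> nat) i k : nat -> nat :=
  fun j => if j == i then k else v j.

Fixpoint sat (D : seq sym) (v : nat -> nat) (F : form) : bool :=
  match F with
  | Sym P t => P (onth D (tval v t))
  | Lt t1 t2 => tval v t1 < tval v t2
  | Not F => ~~ sat D v F
  | And F1 F2 => sat D v F1 && sat D v F2
  | Ex i F => has (fun k => sat D (updn v i k) F) (iota 0 (size D))
  end.

(** Stack [cv i] holds the value of variable [i] in unary, stack [fv i] the number of witnesses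
    found so far by a quantifier on [i]. The stacks below 8 are registers. *)
Definition cv i := 8 + 2 * i.
Definition fv i := 9 + 2 * i.

(** Reading a unary stack destroys it, so the value is moved to stack 7 and put back while it is
    added to [y]. *)
Definition addv i y : prog G :=
  Seq (mvall (cv i) 7 id)
      (While 7 nonempty (Seq (pushc (cv i) one) (Seq (pushc y one) (Pop 7)))).

Definition load y (t : term) : prog G :=
  seqs (nseq t.1 (pushc y one) ++ map (addv^~ y) t.2).

Definition ev_sym P t : prog G :=
  seqs [:: load 5 t;
           While 5 nonempty (Seq (Pop 5) (If 1 nonempty (mv 1 2 id) Skip));
           If 1 P (setR true) (setR false);
           mvall 2 1 id].

(** The loop of a quantifier on [i] lasts as long as position [i] holds a symbol, which is exactly
    the range of the quantifier; the failing test leaves stack 3 empty, ready for the verdict.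
    Witnesses are counted on [fv i] because stack 3 is overwritten in every turn. *)
Fixpoint ev (F : form) : prog G :=
  match F with
  | Sym P t => ev_sym P t
  | Lt t1 t2 =>
      seqs [:: load 5 t1; load 6 t2;
               While 5 nonempty (Seq (Pop 5) (Pop 6));
               If 6 nonempty (setR true) (setR false); clear 6]
  | Not F => Seq (ev F) (If 3 nonempty (Pop 3) (pushc 3 one))
  | And F1 F2 => Seq (ev F1) (If 3 nonempty (ev F2) Skip)
  | Ex i F =>
      seqs [:: ev_sym nonempty (0, [:: i]);
        While 3 nonempty
          (seqs [:: ev F; If 3 nonempty (pushc (fv i) one) Skip;
                    pushc (cv i) one; ev_sym nonempty (0, [:: i])]);
        If (fv i) nonempty (pushc 3 one) Skip;
        clear (fv i); clear (cv i)]
  end.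

Fixpoint fits (L : nat) (F : form) : bool :=
  match F with
  | Sym _ t => t.1 + size t.2 * L <= B
  | Lt t1 t2 => (t1.1 + size t1.2 * L <= B) && (t2.1 + size t2.2 * L <= B)
  | Not F => fits L F
  | And F1 F2 => fits L F1 && fits L F2
  | Ex _ F => fits L F
  end.

(* No variable is bound again within its scope. *)
Fixpoint wff (bs : seq nat) (F : form) : bool :=
  match F with
  | Sym _ _ | Lt _ _ => true
  | Not F => wff bs F
  | And F1 F2 => wff bs F1 && wff bs F2
  | Ex i F => (i \notin bs) && wff (i :: bs) F
  end.

Definition einv (D : seq sym) (v : nat -> nat) (s : store G) : Prop :=
  [/\ s 1 = D, s 2 = [::], [/\ s 5 = [::], s 6 = [::] & s 7 = [::]],
      size (s 3) <= 1 & forall i, s (cv i) = nseq (v i) one /\ v i <= size D].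

Lemma ex_seqs_nil s : ex (seqs [::]) s s.
Proof. exact: ex_skip. Qed.

Lemma ex_seqs_cons p ps s1 s2 s3 :
  ex p s1 s2 -> ex (seqs ps) s2 s3 -> ex (seqs (p :: ps)) s1 s3.
Proof. exact: ex_seq. Qed.

Lemma ex_seqs_cat ps qs s1 s2 s3 :
  ex (seqs ps) s1 s2 -> ex (seqs qs) s2 s3 -> ex (seqs (ps ++ qs)) s1 s3.
Proof.
move=> [t E] H; elim: ps s1 t E => [|p ps IH] s1 t E.
  by inversion E; subst.
inversion E as [| | |? ? ? s4 ? t1 t2 E1 E2| | | |]; subst.
by apply: (ex_seqs_cons (s2 := s4)); [exists t1 | apply: IH E2].
Qed.

Lemma catrev_nseq a b : catrev (nseq a one) (nseq b one) = nseq (a + b) one.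
Proof. by elim: a b => //= a IH b; rewrite -[_ :: _]/(nseq b.+1 _) IH addnS. Qed.

Lemma ex_addv i y a b s : y < 7 -> s (cv i) = nseq a one -> s 7 = [::] ->
  s y = nseq b one -> a + b <= B -> ex (addv i y) s (upd s y (nseq (a + b) one)).
Proof.
move=> ly e e7 ey le; have ne : cv i != 7 by rewrite /cv; lia.
have ny : y != cv i by rewrite /cv; lia.
have ny7 : y != 7 by lia.
apply: ex_seq; first by apply: ex_mvall => //; rewrite e e7 size_nseq /=; lia.
rewrite e map_id_in // e7 -[[::]]/(nseq 0 one) catrev_nseq addn0.
suff H m : m <= a -> forall s', s' 7 = nseq m one -> s' (cv i) = nseq (a - m) one ->
    s' y = nseq (a - m + b) one ->
    ex (While 7 nonempty (Seq (pushc (cv i) one) (Seq (pushc y one) (Pop 7)))) s'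
       (upd (upd (upd s' 7 [::]) (cv i) (nseq a one)) y (nseq (a + b) one)).
  apply: ex_eq.
    apply: (H a) => //; rewrite ?subnn !updE ?eqxx //.
    by rewrite (negPf ny7) (negPf ny).
  apply: functional_extensionality => z; rewrite !updE.
  case: eqP => // _; case: eqP => [->|ncv]; first by [].
  by case: eqP => [->|].
elim: m => [|m IH] lm s' h7 hc hy.
  rewrite subn0 in hc hy.
  apply: ex_eq; first by apply: ex_while0; rewrite h7.
  by rewrite [upd s' 7 _]upd_eq // [upd s' (cv i) _]upd_eq // upd_eq.
have e1 : a - m = (a - m.+1).+1 by lia.
apply: ex_eq.
  apply: ex_while1; first by rewrite h7.
    apply: ex_seq; first by apply: ex_pushc; rewrite hc size_nseq; lia.
    apply: ex_seq; first by apply: ex_pushc; rewrite updE (negPf ny) hy size_nseq; lia.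
    exact: ex_pop.
  apply: IH; first lia.
  - by rewrite !updE eqxx (eq_sym 7 y) (negPf ny7) (eq_sym 7) (negPf ne) h7.
  - by rewrite !updE (negPf ne) (eq_sym _ y) (negPf ny) eqxx hc e1.
  - by rewrite !updE (negPf ny7) eqxx (negPf ny) hy e1.
apply: functional_extensionality => z; rewrite !updE.
by case: (z =P y) => // _; case: (z =P cv i) => // _; case: (z =P 7).
Qed.

Lemma ex_load y t v (D : seq sym) (s : store G) : y = 5 \/ y = 6 ->
  (forall i, s (cv i) = nseq (v i) one /\ v i <= size D) -> s y = [::] ->
  s 7 = [::] -> t.1 + size t.2 * size D <= B ->
  ex (load y t) s (upd s y (nseq (tval v t) one)).
Proof.
move=> ly evars ey e7; case: t => k xs /= le.
have l7 : y < 7 by lia.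
have H1 : ex (seqs (nseq k (pushc y one))) s (upd s y (nseq k one)).
  rewrite -[k in nseq k one]addn0; have := erefl (s y).
  rewrite {2}ey -[[::]]/(nseq 0 one).
  have : k + 0 <= B by lia.
  elim: k {le} 0 (s) => [|k IH] b s' /= le es; first by rewrite upd_eq //; apply: ex_skip.
  apply: ex_eq.
    apply: ex_seq; first by apply: ex_pushc; rewrite es size_nseq; lia.
    apply: (IH b.+1); first lia.
    by rewrite updE eqxx es.
  by rewrite upd_upd addnS.
rewrite /load; apply: ex_seqs_cat; first exact: H1.
suff H ys b : b + size ys * size D <= B -> ex (seqs (map (addv^~ y) ys))
    (upd s y (nseq b one)) (upd s y (nseq (sumn (map v ys) + b) one)).
  by apply: ex_eq; [exact: H le | rewrite /tval addnC].
elim: ys b => [|i ys IH] b /= le'; first by apply: ex_skip.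
have [ei li] := evars i; have ny : y != cv i by rewrite /cv; lia.
apply: ex_eq.
  apply: ex_seq; last by apply: (IH (v i + b)); lia.
  apply: ex_eq; first apply: (@ex_addv i y (v i) b) => //.
  - by rewrite updE eq_sym (negPf ny).
  - by rewrite updE ifN //; lia.
  - by rewrite updE eqxx.
  - lia.
  - by rewrite upd_upd.
by congr upd; congr nseq; lia.
Qed.

Lemma einv_R D v s b : einv D v s -> einv D v (upd s 3 (flag b)).
Proof.
by move=> [e1 e2 [e5 e6 e7] e3 ev]; split=> //; rewrite ?updE //=; case: b.
Qed.

Lemma catrev_rev_nil (T : Type) (l r : seq T) : catrev (rev l) r = l ++ r.
Proof. by rewrite catrevE revK. Qed.

Lemma ex_ev_sym P t v D s : einv D v s -> 0 < B -> size D <= B ->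
  t.1 + size t.2 * size D <= B ->
  ex (ev_sym P t) s (upd s 3 (flag (P (onth D (tval v t))))).
Proof.
move=> I lB lD le; have [e1 e2 [e5 e6 e7] e3 evars] := I.
apply: ex_seqs_cons; first by apply: ex_load evars _ _ le => //; left.
set a := tval v t.
apply: (@ex_seqs_cons _ _ _ (upd (upd s 2 (rev (take a D))) 1 (drop a D))).
  have : forall s', s' 5 = nseq a one -> size (s' 1) + size (s' 2) <= B ->
    ex (While 5 nonempty (Seq (Pop 5) (If 1 nonempty (mv 1 2 id) Skip))) s'
      (upd (upd (upd s' 5 [::]) 2 (catrev (take a (s' 1)) (s' 2))) 1 (drop a (s' 1))).
    elim: (a) => [|b IH] s' h5 hle.
      rewrite /= drop0 take0; apply: ex_eq; first by apply: ex_while0; rewrite h5.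
      by rewrite [upd s' 5 _]upd_eq // !upd_id.
    case h1 : (s' 1) => [|x l].
      apply: ex_eq.
        apply: ex_while1; first by rewrite h5.
          apply: ex_seq; first exact: ex_pop.
          by apply: ex_if; rewrite updE /= h1 /=; apply: ex_skip.
        by apply: IH; rewrite !updE /= ?h5.
      by rewrite /= !updE /= h1 /= upd_upd.
    apply: ex_eq.
      apply: ex_while1; first by rewrite h5.
        apply: ex_seq; first exact: ex_pop.
        apply: ex_if; rewrite updE /= h1 /=.
        apply: (@ex_mv 1 2 id _ x l) => //.
        by rewrite updE /=; rewrite h1 /= in hle; lia.
      by apply: IH; rewrite !updE /= ?h5 //; rewrite h1 /= in hle; lia.
    rewrite /= !updE /=; apply: functional_extensionality => z; rewrite !updE.
    by case: (z =P 1) => // _; case: (z =P 2) => // _; case: (z =P 5).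
  move/(_ (upd s 5 (nseq a one))) => H; apply: ex_eq.
    by apply: H; rewrite !updE /= ?e1 ?e2 //= addn0.
  rewrite !updE /= e1 e2; apply: functional_extensionality => z; rewrite !updE.
  by case: (z =P 1) => // _; case: (z =P 2) => // _; case: (z =P 5) => // ->; rewrite e5.
have eo : ohead (drop a D) = onth D a.
  by elim: (a) D {I e1 evars lD le} => [|b IH] [|x D] //=; rewrite -IH.
apply: (@ex_seqs_cons _ _ _ (upd (upd (upd s 2 (rev (take a D))) 1 (drop a D)) 3 (flag (P (onth D a))))).
  by apply: ex_if; rewrite updE /= eo; case: ifP => _; apply: ex_setR.
apply: ex_seqs_cons; last exact: ex_seqs_nil.
apply: ex_eq.
  apply: ex_mvall => //; rewrite !updE /= size_rev -size_cat.
  by rewrite cat_take_drop.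
rewrite !updE /= map_id catrev_rev_nil cat_take_drop.
apply: functional_extensionality => z; rewrite !updE.
case: (z =P 1) => [->|_] /=; first by rewrite e1.
by case: (z =P 2) => [->|_] /=; first by rewrite e2.
Qed.

(** Outside its scope a variable has value 0 and an empty witness stack. A quantifier relies on this
    when it starts to count, and restores it by clearing both of its stacks; this would ruin an
    enclosing quantifier on the same variable. *)
Lemma ex_ev F v D s bs : einv D v s -> (forall i, i \notin bs -> s (fv i) = [::]) -> 0 < B ->
  size D < B -> fits (size D) F -> wff bs F -> (forall i, i \notin bs -> v i = 0) ->
  ex (ev F) s (upd s 3 (flag (sat D v F))).
Proof.
elim: F v s bs => [P t|t1 t2|F IH|F1 IH1 F2 IH2|i F IH] v s bs I fe lB lD;
  rewrite /fits -/fits /wff -/wff.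
- by move=> le _ _; apply: ex_ev_sym => //; apply: ltnW.
- move=> /andP[l1 l2] _ _; have [e1 e2 [e5 e6 e7] e3 evars] := I.
  apply: ex_seqs_cons; first by apply: ex_load evars _ _ l1 => //; left.
  set a := tval v t1.
  apply: ex_seqs_cons.
    by apply: (@ex_load 6 t2 v D) => //; right.
  set b := tval v t2; rewrite /sat -/a -/b.
  apply: (@ex_seqs_cons _ _ _ (upd s 6 (nseq (b - a) one))).
    have : forall s', s' 5 = nseq a one -> s' 6 = nseq b one ->
      ex (While 5 nonempty (Seq (Pop 5) (Pop 6))) s'
        (upd (upd s' 5 [::]) 6 (nseq (b - a) one)).
      elim: (a) (b) => [|a' IH] b' s' h5 h6.
        apply: ex_eq; first by apply: ex_while0; rewrite h5.
        by rewrite [upd s' 5 _]upd_eq // subn0 upd_eq.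
      apply: ex_eq.
        apply: ex_while1; first by rewrite h5.
          by apply: ex_seq; exact: ex_pop.
        apply: (IH b'.-1); rewrite !updE /= ?h5 // h6.
        by case: (b').
      have -> : b'.-1 - a' = b' - a'.+1 by lia.
      rewrite !updE /= h6; apply: functional_extensionality => z; rewrite !updE.
      by case: (z =P 6) => // _; case: (z =P 5).
    move/(_ (upd (upd s 5 (nseq a one)) 6 (nseq b one))) => H; apply: ex_eq.
      by apply: H; rewrite !updE.
    apply: functional_extensionality => z; rewrite !updE.
    by case: (z =P 6) => // _; case: (z =P 5) => // ->; rewrite e5.
  apply: (@ex_seqs_cons _ _ _ (upd (upd s 6 (nseq (b - a) one)) 3 (flag (a < b)))).
    apply: ex_if; rewrite updE /=.
    have -> : nonempty (ohead (nseq (b - a) one)) = (a < b).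
      by rewrite -subn_gt0; case: (b - a).
    by case: ifP => _; apply: ex_setR.
  apply: ex_seqs_cons; last exact: ex_seqs_nil.
  apply: ex_eq; first exact: ex_clear.
  apply: functional_extensionality => z; rewrite !updE.
  by case: (z =P 6) => [->|_] //; case: (z =P 3).
- move=> ft wf vb; apply: ex_seq; first exact: IH ft wf vb.
  apply: ex_if; rewrite updE /= -/(flag _); case: (sat D v F) => /=.
    by apply: ex_eq; [exact: ex_pop | rewrite upd_upd updE].
  by apply: ex_eq; [apply: ex_pushc; rewrite updE | rewrite upd_upd updE].
- move=> /andP[f1 f2] /andP[w1 w2] vb.
  apply: ex_seq; first exact: IH1 f1 w1 vb.
  apply: ex_if; rewrite updE /=; case: (sat D v F1) => /=; last exact: ex_skip.
  apply: ex_eq; first exact: (IH2 v _ bs (einv_R true I) fe lB lD f2 w2 vb).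
  by rewrite upd_upd.
move=> ft /andP[nbs wf] vb; have [e1 e2 [e5 e6 e7] e3 evars] := I.
have v0 := vb _ nbs; set L := size D.
pose c j := count (fun k => sat D (updn v i k) F) (iota 0 j).
(* The store at the head of the loop when [i] has the value [j] and the register holds [r]: the
   [c j] witnesses below [j] have been counted. *)
pose S j r := upd (upd (upd s (cv i) (nseq j one)) (fv i) (nseq (c j) one)) 3 (flag r).
have cvE j k : (cv j == cv k) = (j == k) by rewrite /cv; lia.
have fvE j k : (fv j == fv k) = (j == k) by rewrite /fv; lia.
have cfE j k : (cv j == fv k) = false by rewrite /cv /fv; lia.
have fcE j k : (fv j == cv k) = false by rewrite /cv /fv; lia.
have c3 j : (cv j == 3) = false by rewrite /cv; lia.
have f3 j : (fv j == 3) = false by rewrite /fv; lia.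
have lc j : c j <= j by rewrite -[X in _ <= X](size_iota 0) count_size.
have cS j : c j.+1 = c j + sat D (updn v i j) F.
  by rewrite /c -[in LHS]addn1 iotaD count_cat /= addn0.
have tst j s' : einv D (updn v i j) s' ->
    ex (ev_sym nonempty (0, [:: i])) s' (upd s' 3 (flag (j < L))).
  move=> I'; apply: ex_eq.
    apply: (@ex_ev_sym _ _ (updn v i j) D) => //; first exact: ltnW.
    by rewrite /= mul1n; apply: ltnW.
  congr upd; congr flag.
  by rewrite /tval /= /updn eqxx addn0 /nonempty /L onthTE.
have SI j r : j <= L -> einv D (updn v i j) (S j r).
  move=> lj; apply: einv_R; split; rewrite ?updE //=.
  move=> k; rewrite !updE cfE cvE /updn.
  by case: (k =P i) => // _; apply: evars.
apply: (@ex_seqs_cons _ _ _ (S 0 (0 < L))).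
  apply: ex_eq.
    apply: (tst 0); have -> // : updn v i 0 = v.
    by apply: functional_extensionality => k; rewrite /updn; case: eqP => // ->.
  have ec : s (cv i) = [::] by have [-> _] := evars i; rewrite v0.
  by rewrite /S /c /= [upd s (cv i) _]upd_eq // [upd s (fv i) _]upd_eq // fe.
rewrite -/(ev F); apply: (@ex_seqs_cons _ _ _ (S L false)).
  suff H j m : j + m = L -> ex (While 3 nonempty
          (seqs [:: ev F; If 3 nonempty (pushc (fv i) one) Skip;
                    pushc (cv i) one; ev_sym nonempty (0, [:: i])])) (S j (j < L)) (S L false).
    exact: (H 0 L).
  elim: m j => [|m IHm] j ej.
    rewrite addn0 in ej; rewrite ej ltnn; apply: ex_while0.
    by rewrite /S updE.
  have lj : j < L by lia.
  rewrite lj; apply: ex_while1; first by rewrite /S updE.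
    apply: (ex_seqs_cons (s2 := S j (sat D (updn v i j) F))).
      apply: ex_eq; first apply: (IH (updn v i j) _ (i :: bs)) => //.
      - exact: SI (ltnW lj).
      - move=> k; rewrite inE negb_or => /andP[nk kb]; rewrite /S !updE f3 fvE (negPf nk).
        by rewrite fcE fe.
      - move=> k; rewrite inE negb_or => /andP[nk kb]; rewrite /updn (negPf nk).
        exact: vb.
      - by rewrite /S upd_upd.
    apply: (ex_seqs_cons (s2 := upd (S j (sat D (updn v i j) F)) (fv i) (nseq (c j.+1) one))).
      apply: ex_if; rewrite /S updE eqxx cS; case: (sat _ _ F) => /=.
        apply: ex_eq; first by apply: ex_pushc; rewrite !updE f3 eqxx size_nseq; have := lc j; lia.
        by rewrite !updE f3 eqxx addn1.
      by apply: ex_eq; [exact: ex_skip | rewrite addn0 [RHS]upd_eq // !updE f3 eqxx].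
    apply: (ex_seqs_cons (s2 := S j.+1 (sat D (updn v i j) F))).
      apply: ex_eq.
        apply: ex_pushc; rewrite /S !updE cfE c3 eqxx size_nseq; exact: ltn_trans lj lD.
      rewrite /S !updE cfE c3 eqxx; apply: functional_extensionality => z; rewrite !updE.
      by case: (z =P cv i) => [->|_]; rewrite ?c3 ?cfE //; case: (z =P fv i) => [->|_]; rewrite ?f3.
    apply: (ex_seqs_cons (s2 := S j.+1 (j.+1 < L))); last exact: ex_seqs_nil.
    apply: ex_eq; first by apply: tst; apply: SI.
    by rewrite /S upd_upd.
  by apply: IHm; lia.
apply: (ex_seqs_cons (s2 := S L (sat D v (Ex i F)))).
  apply: ex_if; rewrite /S !updE f3 eqxx /= has_count -/(c L).
  have -> : nonempty (ohead (nseq (c L) one)) = (0 < c L) by case: (c L).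
  case: ifP => _; last exact: ex_skip.
  by apply: ex_eq; [apply: ex_pushc; rewrite updE | rewrite upd_upd updE].
apply: ex_seqs_cons; first exact: ex_clear.
apply: ex_seqs_cons; first exact: ex_clear.
apply: ex_eq; first exact: ex_seqs_nil.
rewrite /S; apply: functional_extensionality => z; rewrite !updE.
case: (z =P cv i) => [->|_]; first by rewrite c3; have [-> _] := evars i; rewrite v0.
by case: (z =P fv i) => [->|_]; rewrite ?f3 ?(fe _ nbs).
Qed.

End Bounded.
End Machines.

Arguments clear {G}.

(** * Evaluation of quantified formulas in polynomial space *)

Section Quantifiers.
Variable tagT : finType.

(* A symbol carries a quantifier ([Some true] existential, [Some false]
   universal, [None] for a bit that is given), a tag and a bit. *)
Definition qsym : finType := (option bool * tagT * bool)%type.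
Local Notation sym := (bool + qsym)%type.

Definition reset (a : sym) : sym :=
  if a is inr (Some q, t, _) then inr (Some q, t, false) else a.
Definition flip (a : sym) : sym :=
  if a is inr (q, t, _) then inr (q, t, true) else a.
(** Whether the second value of a bit remains to be tried after the result [r]: an existential bit
    after false, a universal one after true, hence the comparison of the quantifier with the
    result. *)
Definition branch (r : bool) (o : option sym) : bool :=
  if o is Some (inr (Some q, _, false)) then q != r else false.

Variable K : form qsym.

(** Symbols pass from the front of [pend] to the front of [don], so the kernel reads the innermost
    choices first. The second value of a bit is tried only if the first does not settle the
    quantifier, as in the machine. *)
Fixpoint qval (pend : seq sym) (don : seq sym) : bool :=
  if pend is a :: pend' then
    let r := qval pend' (a :: don) in
    if branch r (Some a) then qval pend' (flip a :: don) else r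
  else sat don (fun=> 0) K.

Definition desc : sym := inl true.
Definition asc : sym := inl false.
Definition isdesc (o : option sym) : bool := o == Some desc.

Definition set_mode (m : sym) : prog qsym := Seq (Pop 4) (pushc 4 m).
Definition backtrack r : prog qsym :=
  If 1 (branch r) (Seq (mv 1 2 flip) (set_mode desc)) (mv 1 2 reset).

(* Depth-first evaluation of the quantifier prefix: stack 1 holds the bits
   chosen so far, stack 2 the pending symbols, stack 3 the last value. *)
Definition dfs_body : prog qsym :=
  If 4 isdesc
    (If 2 (@nonempty _) (mv 2 1 id) (Seq (ev K) (set_mode asc)))
    (If 1 (@nonempty _)
       (If 3 (@nonempty _) (backtrack true) (backtrack false))
       (Pop 4)).
Definition dfs : prog qsym := While 4 (@nonempty _) dfs_body.

Definition St (W D P R Z : seq sym) : store qsym := fun x =>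
  match x with 0 => W | 1 => D | 2 => P | 3 => R | 4 => Z | _ => [::] end.

Section Run.
Variables (B L : nat) (W : seq sym).
Hypotheses (LB : L.+1 < B) (KB : fits B L K) (Kw : wff [::] K).

(** Progress of the loop in backward form: whatever it achieves from [s2] it achieves from [s1].
    Turns are composed without being counted. *)
Definition wreach (s1 s2 : store qsym) : Prop :=
  forall s3, ex B dfs s2 s3 -> ex B dfs s1 s3.

Lemma wreach_step s1 s2 : nonempty (ohead (s1 4)) -> ex B dfs_body s1 s2 ->
  wreach s1 s2.
Proof. by move=> n E s3; apply: ex_while1. Qed.

Ltac stq := apply: functional_extensionality;
  do 5 (case=> [|]; first by []); move=> ?; by [].

Lemma set_modeP m W' D P R Z : size Z = 1 ->
  ex B (set_mode m) (St W' D P R Z) (St W' D P R [:: m]).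
Proof.
move=> e; apply: ex_eq.
  apply: ex_seq; first exact: ex_pop.
  by apply: ex_pushc; rewrite updE /=; case: Z e => [|? []] //= _; lia.
by case: Z e => [|? []] //= _; stq.
Qed.

(** The search below the choices [don] comes back with [pend] unchanged, because every bit taken is
    reset on the way up. This is what allows the same subtree to be searched again after a flip. *)
Lemma dfsP pend don R : size pend + size don = L ->
  all (fun a => reset a == a) pend -> size R <= 1 ->
  wreach (St W don pend R [:: desc])
         (St W don pend (flag _ (qval pend don)) [:: asc]).
Proof.
elim: pend don R => [|a pend IH] don R eL ap lR.
  apply: wreach_step => //; apply: ex_if => /=; apply: ex_if => /=.
  apply: (ex_seq (s2 := St W don [::] (flag _ (sat don (fun=> 0) K)) [:: desc]));
    last exact: set_modeP.
  have eL' : size don = L by [].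
  apply: ex_eq.
    by apply: (@ex_ev _ _ K (fun=> 0) don _ [::]) => //; rewrite ?eL' //; lia.
  by stq.
have /= /andP[ra ap'] := ap; rewrite /= addSn in eL.
have down a' R' : size R' <= 1 ->
    wreach (St W don (a' :: pend) R' [:: desc]) (St W (a' :: don) pend R' [:: desc]).
  move=> lR'; apply: wreach_step => //; apply: ex_if => /=; apply: ex_if => /=.
  apply: ex_eq; first by apply: (@ex_mv _ B 2 1 id _ a' pend) => //=; lia.
  by stq.
have up a' r : reset a' = a -> ~~ branch r (Some a') ->
    wreach (St W (a' :: don) pend (flag _ r) [:: asc])
           (St W don (a :: pend) (flag _ r) [:: asc]).
  move=> ra' nb; apply: wreach_step => //; apply: ex_if => /=; apply: ex_if => /=.
  have E : ex B (mv 1 2 reset) (St W (a' :: don) pend (flag _ r) [:: asc])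
           (St W don (a :: pend) (flag _ r) [:: asc]).
    apply: ex_eq; first by apply: (@ex_mv _ B 1 2 reset _ a' don) => //=; lia.
    by rewrite ra'; stq.
  by apply: ex_if => /=; case: r nb E => /= nb E; apply: ex_if => /=; rewrite (negPf nb).
have lf r : size (flag qsym r) <= 1 by case: r.
move=> s3 E; apply: (down a R lR); apply: (IH) => //; first by rewrite /= addnS.
have /= := E; set r := qval pend (a :: don); case: ifP => br E'; last first.
  by apply: (up a r) => //; [apply/eqP | exact: negbT br].
apply: (wreach_step (s2 := St W don (flip a :: pend) (flag _ r) [:: desc])) => //.
  apply: ex_if => /=; apply: ex_if => /=.
  have F : ex B (Seq (mv 1 2 flip) (set_mode desc))
     (St W (a :: don) pend (flag _ r) [:: asc])
     (St W don (flip a :: pend) (flag _ r) [:: desc]).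
    apply: ex_seq; last exact: (@set_modeP _ _ _ _ _ [:: asc]).
    apply: ex_eq; first by apply: (@ex_mv _ B 1 2 flip _ a don) => //=; lia.
    by stq.
  by apply: ex_if => /=; case: (r) br F => /= br F; apply: ex_if => /=; rewrite br.
apply: (down (flip a) _ (lf r)); apply: IH => //; first by rewrite /= addnS.
apply: (up (flip a)) => //.
- by move/eqP: ra; case: (a) br => [|[[[q|] t] b]] //=; case: b.
- by case: (a) br => [|[[[q|] t] b]].
Qed.

Lemma dfs_run pend : size pend = L -> all (fun a => reset a == a) pend ->
  ex B dfs (St W [::] pend [::] [:: desc])
           (St W [::] pend (flag _ (qval pend [::])) [::]).
Proof.
move=> eL ap; apply: dfsP => //; first by rewrite addn0.
apply: ex_while1 => //.
  apply: ex_if => /=; apply: ex_if => /=; exact: ex_pop.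
apply: ex_eq; first exact: ex_while0.
by stq.
Qed.

End Run.

(** The bit chosen first ends up deepest in [don], that is, last in [bs]; hence the induction takes
    [bs] apart from the right. *)
Lemma qval_all t j pend don : qval (nseq j (inr (Some false, t, false)) ++ pend) don <->
  forall bs : seq bool, size bs = j ->
    qval pend (map (fun b => inr (Some false, t, b)) bs ++ don).
Proof.
elim: j don => [|j IH] don.
  by split=> [h [|]//|h]; apply: (h [::]).
rewrite /=; split.
- move=> H bs; case/lastP: bs => // bs b; rewrite size_rcons => -[e].
  rewrite map_rcons cat_rcons.
  move: H; case: (boolP (qval _ _)) => //= /IH H1 /IH H2.
  by case: b; [apply: H2 | apply: H1].
- move=> H; have H' b : qval (nseq j (inr (Some false, t, false)) ++ pend)
                            (inr (Some false, t, b) :: don).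
    apply/IH => bs e; have := H (rcons bs b).
    by rewrite size_rcons e map_rcons cat_rcons; apply.
  by rewrite (H' false) /= (H' true).
Qed.

Lemma qval_ex t pend don : qval (inr (Some true, t, false) :: pend) don =
  qval pend (inr (Some true, t, false) :: don)
  || qval pend (inr (Some true, t, true) :: don).
Proof. by rewrite /=; case: (qval _ _). Qed.

Lemma qval_fixed fs pend don : all (fun a => ~~ branch true (Some a) && ~~ branch false (Some a)) fs ->
  qval (fs ++ pend) don = qval pend (catrev fs don).
Proof.
elim: fs don => //= a fs IH don /andP[/andP[n1 n2] af].
rewrite IH // -/(branch _ (Some a)) ifN //.
by case: (qval _ _).
Qed.

(** Meant for inputs that encode no instance: their error symbol carries no quantifier, so it lies
    in every word on which the kernel is evaluated. *)
Lemma qval_false pend don :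
  (forall x, sat (x ++ don) (fun=> 0) K = false) -> qval pend don = false.
Proof.
elim: pend don => [|a pend IH] don H /=; first exact: (H [::]).
have E b : qval pend (b :: don) = false.
  by apply: IH => x; rewrite -cat_rcons; apply: H.
by rewrite !E; case: ifP.
Qed.

End Quantifiers.

(** * The empty controller *)

(* Instances with untyped numbers; the label [0] is silent, the label [a.+1] is
   the letter [a]. *)
Record raw := Raw {
  rn : nat; rm : nat; rs : nat;
  rH : seq bool; rC : seq bool;
  rE : seq (nat * nat * nat)
}.

Definition enc_redge (e : nat * nat * nat) : seq bool :=
  true :: enc_nat e.1.1 ++ enc_nat e.1.2 ++ enc_nat e.2.

Definition enc_raw (J : raw) : seq bool :=
  enc_nat (rn J) ++ enc_nat (rm J) ++ enc_nat (rs J) ++ rH J ++ rC J ++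
  rcons (flatten (map enc_redge (rE J))) false.

Definition sized (J : raw) : bool := (size (rH J) == rm J) && (size (rC J) == rm J).

Definition edge_ok (n m : nat) (e : nat * nat * nat) : bool :=
  [&& e.1.1 < n, e.1.2 <= m & e.2 < n].

Definition wf_raw (J : raw) : bool :=
  [&& sized J, rs J < rn J & all (edge_ok (rn J) (rm J)) (rE J)].

Definition high (J : raw) (a : nat) : bool := nth false (false :: rH J) a.
Definition ctrl (J : raw) (a : nat) : bool := nth false (false :: rC J) a.

Definition lowdet (J : raw) : Prop := forall x a y y',
  (x, a, y) \in rE J -> (x, a, y') \in rE J -> ~~ high J a -> y = y'.

Definition silent (J : raw) (a : nat) : bool := (a == 0) || high J a.

(* [hreach J w q]: with all controllable actions disabled and the high actions
   hidden, [q] is reached on the word [w]; [lreach] forbids the high actions. *)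
Inductive hreach (J : raw) : seq nat -> nat -> Prop :=
| hreach0 : hreach J [::] (rs J)
| hreachS w q a q' : hreach J w q -> (q, a, q') \in rE J -> ~~ ctrl J a ->
    hreach J (if silent J a then w else rcons w a) q'.

Inductive lreach (J : raw) : seq nat -> nat -> Prop :=
| lreach0 : lreach J [::] (rs J)
| lreachS w q a q' : lreach J w q -> (q, a, q') \in rE J -> ~~ ctrl J a ->
    ~~ high J a -> lreach J (if a == 0 then w else rcons w a) q'.

Definition incl (J : raw) : Prop :=
  forall w q, hreach J w q -> exists q', lreach J w q'.

(** The code of the controller with a single memory state that allows nothing: the number 1, the
    initial state 0, [m] letters that are absent, and [m.+1 * n] transitions to memory state 0, each
    of them one bit [false]. *)
Definition unctrl_string (n m : nat) : seq bool :=
  [:: true; false; false] ++ nseq (m + m.+1 * n) false.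

Lemma enc_nat_inj n n' u u' :
  enc_nat n ++ u = enc_nat n' ++ u' -> n = n' /\ u = u'.
Proof.
rewrite /enc_nat; elim: n n' => [|n IH] [|n'] //=; first by case.
by case=> /IH [-> ->].
Qed.

Lemma enc_redges_inj E E' :
  rcons (flatten (map enc_redge E)) false = rcons (flatten (map enc_redge E')) false ->
  E = E'.
Proof.
elim: E E' => [|[[x a] y] E IH] [|[[x' a'] y'] E'] //=.
rewrite !rcons_cat -!catA => -[] /enc_nat_inj [-> /enc_nat_inj [-> /enc_nat_inj [->]]].
by move/IH ->.
Qed.

(** The bits for the high and for the controllable letters have no end marker; [sized] makes their
    length readable from the number of letters. *)
Lemma enc_raw_inj J J' : sized J -> sized J' -> enc_raw J = enc_raw J' -> J = J'.
Proof.
case: J J' => n m s H C E [n' m' s' H' C' E'].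
rewrite /sized /enc_raw /= => /andP[/eqP sH /eqP sC] /andP[/eqP sH' /eqP sC'].
move/enc_nat_inj => [-> /enc_nat_inj [em /enc_nat_inj [-> /eqP]]].
rewrite eqseq_cat ?sH ?sH' ?em // => /andP[/eqP -> /eqP/eqP].
rewrite eqseq_cat ?sC ?sC' ?em // => /andP[/eqP -> /eqP].
by move/enc_redges_inj ->.
Qed.

Definition lab (m : nat) (a : option 'I_m) : nat := if a is Some e then e.+1 else 0.

Definition raw_of (I : instance) : raw :=
  Raw (nstates I) (nletters I) (istart I) (enc_set (ihigh I)) (enc_set (icontrol I))
      [seq (val e.1.1, lab e.1.2, val e.2) | e <- iedges I].

Lemma enc_raw_of I : enc_instance I = enc_raw (raw_of I).
Proof. by rewrite /enc_instance /enc_raw /= -map_comp. Qed.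

Lemma size_enc_set m (X : {set 'I_m}) : size (enc_set X) = m.
Proof. by rewrite size_map size_enum_ord. Qed.

Lemma wf_raw_of I : wf_raw (raw_of I).
Proof.
rewrite /wf_raw /sized /= !size_enc_set !eqxx ltn_ord /= all_map.
apply/allP => -[[x a] y] _; rewrite /edge_ok /= !ltn_ord andbT /=.
by case: a => [e|] //=; apply: ltn_ord.
Qed.

Lemma raw_of_onto J : wf_raw J -> exists I, raw_of I = J.
Proof.
case: J => n m s H C E; rewrite /wf_raw /sized /=.
move=> /and3P[/andP[/eqP sH /eqP sC] ls aE].
pose i0 := Ordinal ls.
pose lb a : option 'I_m := if a is a'.+1 then insub a' else None.
exists (@Instance n m i0 [set a : 'I_m | nth false H a] [set a : 'I_m | nth false C a]
   [seq (insubd i0 e.1.1, lb e.1.2, insubd i0 e.2) | e <- E]).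
rewrite /raw_of /=; congr Raw.
- apply: (@eq_from_nth _ false); rewrite size_enc_set ?sH // => i li.
  rewrite /enc_set (nth_map (Ordinal li)) ?size_enum_ord // inE.
  by rewrite nth_enum_ord.
- apply: (@eq_from_nth _ false); rewrite size_enc_set ?sC // => i li.
  rewrite /enc_set (nth_map (Ordinal li)) ?size_enum_ord // inE.
  by rewrite nth_enum_ord.
- rewrite -map_comp -[RHS]map_id; apply/eq_in_map => -[[x a] y] /(allP aE).
  rewrite /edge_ok /= => /and3P[lx la ly]; rewrite !val_insubd lx ly.
  case: a la => [|a] //= la; by rewrite /lb insubT.
Qed.

(** * Runs without controllable actions *)

Section Control.
Variable I : instance.
Let A := iaut I.
Let J := raw_of I.

Lemma edge_raw q a q' :
  ((q, a, q') \in edges A) = ((val q, lab a, val q') \in rE J).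
Proof.
rewrite inE; apply/idP/mapP => [e|[[[p b] p'] e]]; first by exists (q, a, q').
move=> /= [/val_inj -> eb /val_inj ->].
by have -> : a = b by case: a b eb {e} => [a|] [b|] //= [/val_inj ->].
Qed.

Lemma label_high a : label_in (ihigh I) a = high J (lab a).
Proof.
case: a => [e|] //=; rewrite /high /= /enc_set (nth_map e) ?size_enum_ord ?ltn_ord //.
by rewrite nth_ord_enum.
Qed.

Lemma label_ctrl a : label_in (icontrol I) a = ctrl J (lab a).
Proof.
case: a => [e|] //=; rewrite /ctrl /= /enc_set (nth_map e) ?size_enum_ord ?ltn_ord //.
by rewrite nth_ord_enum.
Qed.

Lemma lowdet_raw : low_deterministic I <-> lowdet J.
Proof.
split=> H.
- move=> x a y y' /mapP[[[q b] q1] e1 [-> -> ->]] /mapP[[[p c] q2] e2 [ex ea ->]] nh.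
  rewrite /= in ex ea nh *; move/val_inj: ex => ex; subst p.
  have eb : b = c by case: b c ea {e1 e2 nh} => [b|] [c|] //= [/val_inj ->].
  subst c; congr val; apply: (H q b).
    by rewrite !inE /= e1 label_high.
  by rewrite !inE /= e2 label_high.
- move=> q a q1 q2; rewrite !inE /= => /andP[e1 nh] /andP[e2 _]; apply: val_inj.
  apply: (H (val q) (lab a)).
  + by rewrite -edge_raw inE.
  + by rewrite -edge_raw inE.
  + by rewrite -label_high.
Qed.

Lemma walk_rcons (Q S : finType) (X : automaton Q S) q r s :
  walk X q (rcons r s) = walk X q r && ((last q (map snd r), s.1, s.2) \in edges X).
Proof.
elim: r q => [|[a q'] r IH] q /=; first by case: s => a q'; rewrite /= andbT.
by rewrite IH andbA.
Qed.

Let Sc := icontrol I.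
Let Sh := ihigh I.
Let free (r : steps 'I_(nstates I) 'I_(nletters I)) :=
  all (fun s => ~~ label_in Sc s.1) r.
Let X0 := controlled A Sc (fun=> set0).

Lemma controlled_run C r : controlled A Sc C r -> is_run A r.
Proof. by case. Qed.

Lemma controlled_free C r : is_run A r -> free r -> controlled A Sc C r.
Proof.
elim/last_ind: r => [|r [a q] IH]; first by constructor.
rewrite /free all_rcons => R /andP[na fr]; constructor => //.
  by apply: IH => //; move: R; rewrite /is_run walk_rcons => /andP[].
by case: a na {R} => //= e ne; left; rewrite inE.
Qed.

Lemma uncontrolledP r : X0 r <-> is_run A r /\ free r.
Proof.
split=> [H|[h f]]; last exact: controlled_free.
split; first exact: controlled_run H.
rewrite /free; elim: H => // {}r a q' _ IH _ en; rewrite all_rcons IH andbT.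
by case: a en => //= e; rewrite !inE andbF => -[].
Qed.

Lemma trace_hide_sub (r : steps 'I_(nstates I) 'I_(nletters I)) e : e \in trace (map (hide_step Sh) r : steps _ _) -> e \in trace r.
Proof.
elim: r => //= -[a q] r IH /=; rewrite /hide_step /=.
case: a => [b|] //=; rewrite /oapp /=.
case: ifP => _ /=; last by rewrite !inE => /orP[->|/IH ->]; rewrite ?orbT.
by move/IH => ?; rewrite inE orbC; apply/orP; left.
Qed.

Lemma free_trace r : free r = all (fun e => e \notin Sc) (trace r).
Proof. by elim: r => //= -[[e|] q] r /= ->. Qed.

Lemma restrict_hide (X : system 'I_(nstates I) 'I_(nletters I)) r : restrict X Sh r -> Defs.hide X Sh r.
Proof.
move=> [Xr ar]; exists r => //; elim: r ar {Xr} => //= -[a q] r IH /andP[na /IH e].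
by rewrite -{1}e /hide_step /= (negPf na).
Qed.

Lemma empty_controller C : SNNI_controller A Sh Sc C ->
  SNNI_controller A Sh Sc (fun=> set0).
Proof.
case=> _ H; split=> [r _|w]; first exact: sub0set.
split=> [[r Xr ->]|[r [r0 X0r ->] ->]].
  by exists r => //; apply: restrict_hide.
have [run fr] := (uncontrolledP r0).1 X0r.
(* A run without controllable letters exists under every controller, so the property of the given
   one applies to its trace. *)
have [] := (H (trace (map (hide_step Sh) r0))).2.
  exists (map (hide_step Sh) r0) => //; exists r0 => //; exact: controlled_free.
move=> r1 [X1 a1] e1; exists r1 => //; split=> //.
apply/uncontrolledP; split; first exact: controlled_run X1.
rewrite free_trace -e1; apply/allP => e /trace_hide_sub e0.
by move: fr; rewrite free_trace => /allP; apply.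
Qed.

Definition lastst (r : steps 'I_(nstates I) 'I_(nletters I)) : 'I_(nstates I) :=
  last (istart I) (map snd r).

Lemma trace_rcons (Q S : finType) (r : steps Q S) a q :
  trace (rcons r (a, q)) = if a is Some e then rcons (trace r) e else trace r.
Proof.
rewrite /trace -cats1 pmap_cat /=; case: a => [e|] /=; first by rewrite cats1.
by rewrite cats0.
Qed.

Lemma run_rcons r a q :
  is_run A (rcons r (a, q)) = is_run A r && ((lastst r, a, q) \in edges A).
Proof. by rewrite /is_run walk_rcons. Qed.

Lemma raw_edge x a y : (x, a, y) \in rE J ->
  exists q b q', [/\ x = val q, a = lab b, y = val q' & (q, b, q') \in edges A].
Proof.
by move=> /mapP[[[q b] q'] e [-> -> ->]]; exists q, b, q'; rewrite inE.
Qed.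

Definition word_of (r : steps 'I_(nstates I) 'I_(nletters I)) : seq nat :=
  [seq (val e).+1 | e <- trace r].

Lemma hreachP w q : hreach J w q <-> exists r,
  [/\ is_run A r, free r, val (lastst r) = q & w = word_of (map (hide_step Sh) r)].
Proof.
split=> [|[r [run fr <- ->]]].
- elim=> [|{}w {}q a q' _ [r [run fr lr ->]] ed nc].
    by exists [::].
  have [p [b [p' [ep eb eq' e]]]] := raw_edge ed.
  exists (rcons r (b, p')); split.
  + by rewrite run_rcons run; have -> : lastst r = p by apply: val_inj; rewrite lr.
  + by rewrite /free all_rcons /= label_ctrl -eb nc.
  + by rewrite /lastst map_rcons last_rcons.
  + rewrite map_rcons /hide_step /= /word_of trace_rcons label_high -eb /silent.
    case: b eb {e} => [e|] -> //=; by case: ifP => // _; rewrite map_rcons.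
- elim/last_ind: r run fr => [|r [b p'] IH]; first by constructor.
  rewrite run_rcons /free all_rcons => /andP[run e] /andP[nb fr].
  have := @hreachS J _ _ (lab b) p' (IH run fr).
  rewrite -edge_raw e -label_ctrl nb => /(_ isT isT).
  rewrite /lastst !map_rcons last_rcons /word_of /hide_step /= trace_rcons.
  rewrite label_high /silent; case: b {e nb} => [e|] //=.
  by case: ifP => // _; rewrite map_rcons.
Qed.

Lemma lreachP w q : lreach J w q <-> exists r,
  [/\ is_run A r, free r, all (fun s => ~~ label_in Sh s.1) r,
      val (lastst r) = q & w = word_of r].
Proof.
split=> [|[r [run fr lo <- ->]]].
- elim=> [|{}w {}q a q' _ [r [run fr lo lr ->]] ed nc nh].
    by exists [::].
  have [p [b [p' [ep eb eq' e]]]] := raw_edge ed.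
  exists (rcons r (b, p')); split.
  + by rewrite run_rcons run; have -> : lastst r = p by apply: val_inj; rewrite lr.
  + by rewrite /free all_rcons /= label_ctrl -eb nc.
  + by rewrite all_rcons /= label_high -eb nh.
  + by rewrite /lastst map_rcons last_rcons.
  + rewrite /word_of trace_rcons.
    by case: b eb {e} => [e|] -> //=; rewrite map_rcons.
- elim/last_ind: r run fr lo => [|r [b p'] IH]; first by constructor.
  rewrite run_rcons /free !all_rcons => /andP[run e] /andP[nb fr] /andP[nh lo].
  have := @lreachS J _ _ (lab b) p' (IH run fr lo).
  rewrite -edge_raw e -label_ctrl nb -label_high nh => /(_ isT isT isT).
  rewrite /lastst !map_rcons last_rcons /word_of trace_rcons.
  by case: b {e nb nh} => [e|] //=; rewrite map_rcons.
Qed.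

Lemma empty_controllerP : SNNI_controller A Sh Sc (fun=> set0) <-> incl J.
Proof.
split=> [[_ H] w q /hreachP [r [run fr _ ->]]|H].
- have [] := (H (trace (map (hide_step Sh) r))).2.
    exists (map (hide_step Sh) r) => //; exists r => //; exact/uncontrolledP.
  move=> r1 [/uncontrolledP [run1 f1] a1] e1; exists (val (lastst r1)).
  by apply/lreachP; exists r1; split=> //; rewrite /word_of e1.
split=> [r _|w]; first exact: sub0set.
split=> [[r Xr ->]|[r [r0 /uncontrolledP [run fr] ->] ->]].
  by exists r => //; apply: restrict_hide.
have [|q] := H (word_of (map (hide_step Sh) r0)) (val (lastst r0)).
  by apply/hreachP; exists r0.
case/lreachP => r1 [run1 f1 a1 _ e1]; exists r1; first by split=> //; apply/uncontrolledP.
by move: e1; rewrite /word_of; apply: inj_map => x y [/val_inj].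
Qed.

Lemma controller_incl : (exists C, SNNI_controller A Sh Sc C) <-> incl J.
Proof.
split=> [[C /empty_controller/empty_controllerP]|H] //.
by exists (fun=> set0); apply/empty_controllerP.
Qed.

Lemma unctrl_fsc : exists K : fsc (nstates I) (nletters I),
  enc_fsc K = unctrl_string (nstates I) (nletters I) /\ fsc_fun K = fun=> set0.
Proof.
exists (@Fsc _ _ 1 ord0 (fun _ _ _ => ord0) (fun=> set0)); split=> //.
have E T k n (s : seq T) : size s = k -> flatten [seq nseq n false | _ <- s] = nseq (k * n) false.
  by move <-; elim: s => //= x s ->; rewrite mulSn nseqD.
have e1 : enum 'I_1 = [:: ord0] by apply: (inj_map val_inj); rewrite val_enum_ord.
rewrite /enc_fsc /unctrl_string /= e1 /= !cats0 nseqD; congr [:: _, _, _ & _].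
congr cat.
  apply: (@eq_from_nth _ false); rewrite size_enc_set ?size_nseq // => i li.
  by rewrite /enc_set (nth_map (Ordinal li)) ?size_enum_ord // inE nth_nseq li.
rewrite -[flatten _ ++ flatten _]/(flatten [seq flatten [seq enc_nat 0 | _ <- enum 'I_(nstates I)]
  | _ <- None :: [seq Some e | e <- enum 'I_(nletters I)]]).
rewrite [flatten [seq enc_nat 0 | _ <- _]](E _ (nstates I) 1) ?size_enum_ord // muln1.
by rewrite (E _ (nletters I).+1) //= size_map size_enum_ord.
Qed.

End Control.

Lemma controllable_raw w : SNNI_controllable w <->
  exists J, [/\ wf_raw J, w = enc_raw J, lowdet J & incl J].
Proof.
split=> [[I [-> ld /controller_incl cI]]|[J [wf -> ld iJ]]].
  by exists (raw_of I); rewrite wf_raw_of enc_raw_of; split=> //; apply/lowdet_raw.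
have [I eI] := raw_of_onto wf; exists I; rewrite enc_raw_of eI; split=> //.
  by apply/lowdet_raw; rewrite eI.
by apply/controller_incl; rewrite eI.
Qed.

Lemma controllable_enc J : wf_raw J ->
  SNNI_controllable (enc_raw J) <-> lowdet J /\ incl J.
Proof.
move=> wf; rewrite controllable_raw; split=> [[J' [wf' e ld iJ]]|[ld iJ]].
  by rewrite (enc_raw_inj _ _ e) //; [case/and3P: wf | case/and3P: wf'].
by exists J.
Qed.

Lemma synthesis_raw J : wf_raw J -> lowdet J -> incl J ->
  SNNI_synthesis (enc_raw J) (unctrl_string (rn J) (rm J)).
Proof.
move=> wf ld iJ; have [I eI] := raw_of_onto wf.
have [K [eK fK]] := unctrl_fsc I; exists I, K; rewrite -eI; split.
- by rewrite enc_raw_of.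
- by apply/lowdet_raw; rewrite eI.
- by rewrite eK.
- by rewrite fK; apply/empty_controllerP; rewrite eI.
Qed.

(** * Parsing an instance *)

(* [Cl], [Bu], [Bv] open a block of cells [Ce]; [KN], [KM], [KI], [KH] are
   markers placed before the fields of the instance; the other tags tell to
   which field of the instance a bit belongs. *)
Inductive tag := Cl | Ce | Bu | Bv | KN | KM | KI | KH
  | N_ | M_ | I_ | H_ | C_ | R_ | X_ | A_ | Y_ | End_ | Err_.

Definition tags := [:: Cl; Ce; Bu; Bv; KN; KM; KI; KH;
  N_; M_; I_; H_; C_; R_; X_; A_; Y_; End_; Err_].

Definition tag_code (t : tag) : 'I_19 :=
  inord match t with
  | Cl => 0 | Ce => 1 | Bu => 2 | Bv => 3 | KN => 4 | KM => 5 | KI => 6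
  | KH => 7 | N_ => 8 | M_ => 9 | I_ => 10 | H_ => 11 | C_ => 12 | R_ => 13
  | X_ => 14 | A_ => 15 | Y_ => 16 | End_ => 17 | Err_ => 18 end.
Definition tag_decode (i : 'I_19) : tag := nth Cl tags i.
Lemma tag_codeK : cancel tag_code tag_decode.
Proof. by rewrite /tag_decode; case; rewrite /= inordK. Qed.

HB.instance Definition _ := Equality.copy tag (can_type tag_codeK).
HB.instance Definition _ := Choice.copy tag (can_type tag_codeK).
HB.instance Definition _ := Countable.copy tag (can_type tag_codeK).
HB.instance Definition _ := Finite.copy tag (can_type tag_codeK).

Definition eqtag (t u : tag) : bool :=
  match t, u with
  | Cl, Cl | Ce, Ce | Bu, Bu | Bv, Bv | KN, KN | KM, KM | KI, KI | KH, KH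
  | N_, N_ | M_, M_ | I_, I_ | H_, H_ | C_, C_ | R_, R_ | X_, X_ | A_, A_
  | Y_, Y_ | End_, End_ | Err_, Err_ => true
  | _, _ => false
  end.

Local Notation Q := (qsym tag).
Local Notation sym := (bool + Q)%type.

Definition fx (t : tag) (b : bool) : sym := inr (None, t, b).
Definition cell0 : sym := inr (Some false, Ce, false).
Definition level0 : sym := inr (Some true, Cl, false).

Definition is_tag (t : tag) (b : bool) (o : option sym) : bool :=
  if o is Some (inr (_, u, c)) then eqtag t u && (b == c) else false.
Definition has_tag (t : tag) (o : option sym) : bool :=
  if o is Some (inr (_, u, _)) then eqtag t u else false.

Definition tnum (t : tag) (n : nat) : seq sym := rcons (nseq n (fx t true)) (fx t false).

Definition tag_edge (e : nat * nat * nat) : seq sym :=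
  fx R_ true :: tnum X_ e.1.1 ++ tnum A_ e.1.2 ++ tnum Y_ e.2.

Definition tag_head (J : raw) : seq sym :=
  fx KN false :: tnum N_ (rn J) ++ fx KM false :: tnum M_ (rm J) ++
  fx KI false :: tnum I_ (rs J) ++ fx KH false ::
  map (fx H_) (rH J) ++ map (fx C_) (rC J) ++ flatten (map tag_edge (rE J)).

Lemma tag_headE J : tag_head J =
  fx KN false :: tnum N_ (rn J) ++ fx KM false :: tnum M_ (rm J) ++
  fx KI false :: tnum I_ (rs J) ++ fx KH false ::
  map (fx H_) (rH J) ++ map (fx C_) (rC J) ++ flatten (map tag_edge (rE J)).
Proof. by []. Qed.

Opaque tag_head.

Definition tag_raw (J : raw) : seq sym := tag_head J ++ [:: fx End_ false].

(** The parser: [pt] names the field being read, [ph] and [pc] are the numbers of high bits and of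
    control bits still expected, [pout] is the output in reverse. The state [H_] serves for both
    kinds of bits and for the start of an edge; the counters tell these apart. *)
Record pst := Pst { pt : tag; ph : nat; pc : nat; pout : seq sym }.

Definition pstep (x : pst) (b : bool) : pst :=
  let: Pst t h c o := x in
  match t with
  | N_ => if b then Pst N_ h c (fx N_ b :: o) else Pst M_ h c (fx KM false :: fx N_ b :: o)
  | M_ => if b then Pst M_ h.+1 c.+1 (fx M_ b :: o)
          else Pst I_ h c (fx KI false :: fx M_ b :: o)
  | I_ => if b then Pst I_ h c (fx I_ b :: o) else Pst H_ h c (fx KH false :: fx I_ b :: o)
  | H_ => if h is h'.+1 then Pst H_ h' c (fx H_ b :: o)
          else if c is c'.+1 then Pst H_ h c' (fx C_ b :: o)
          else if b then Pst X_ h c (fx R_ b :: o) else Pst End_ h c (fx End_ b :: o)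
  | X_ => Pst (if b then X_ else A_) h c (fx X_ b :: o)
  | A_ => Pst (if b then A_ else Y_) h c (fx A_ b :: o)
  | Y_ => Pst (if b then Y_ else H_) h c (fx Y_ b :: o)
  | _ => Pst Err_ h c (fx Err_ b :: o)
  end.

Definition pst0 : pst := Pst N_ 0 0 [:: fx KN false].
Definition parse (w : seq bool) : pst := foldl pstep pst0 w.

Definition tag_word (w : seq bool) : seq sym :=
  let x := parse w in
  rev (if eqtag (pt x) End_ then pout x else fx Err_ false :: pout x).

Definition untag (a : sym) : option bool :=
  if a is inr (_, t, b) then
    match t with KN | KM | KI | KH => None | _ => Some b end
  else None.

(** Tagging only adds markers, so the input is recovered from the output. Soundness of the parser
    therefore needs nothing but the shape of its output. *)
Lemma parse_untag w : pmap untag (rev (pout (parse w))) = w.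
Proof.
elim/last_ind: w => // w b; rewrite /parse foldl_rcons -/(parse w).
case: (parse w) => t h c o /= IH.
have E u : (untag (fx u b) = Some b) ->
  pmap untag (rev (fx u b :: o)) = rcons w b.
  by rewrite rev_cons -cats1 pmap_cat IH /= => ->; rewrite cats1.
have E2 u k : (untag (fx u b) = Some b) -> untag (fx k false) = None ->
  pmap untag (rev (fx k false :: fx u b :: o)) = rcons w b.
  move=> /E e ek; rewrite rev_cons -cats1 pmap_cat e.
  by case: k ek => //= _; rewrite cats0.
by case: t => /=; try (by apply: E); case: b E E2 => E E2;
   try (by apply: E); try (by apply: E2); case: h => [|h];
   try (by apply: E); case: c => [|c]; apply: E.
Qed.

Lemma untag_tnum t n : untag (fx t true) = Some true -> untag (fx t false) = Some false ->
  pmap untag (tnum t n) = enc_nat n.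
Proof.
move=> e1 e0; rewrite /tnum /enc_nat -?cats1 pmap_cat; congr cat; last by case: t e0 {e1}.
by elim: n => // n IH; case: t e1 e0 IH => //= _ _ ->.
Qed.

Lemma untag_raw J : pmap untag (tag_raw J) = enc_raw J.
Proof.
have M t (s : seq bool) : (forall b, untag (fx t b) = Some b) -> pmap untag (map (fx t) s) = s.
  by move=> e; elim: s => // b s IH; have := e b; case: t {e} IH => //= -> _.
rewrite /tag_raw !tag_headE /enc_raw -cats1 pmap_cat /= !pmap_cat /= !pmap_cat /= !pmap_cat /=.
rewrite !pmap_cat !untag_tnum // !M // -?catA; do 5 congr cat; congr cat.
elim: (rE J) => //= e E IH; rewrite pmap_cat IH; congr (_ :: _).
by rewrite !pmap_cat !untag_tnum.
Qed.

(* Shape of the output according to the state; the field being read is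
   incomplete. *)
Definition pinv (x : pst) : Prop :=
  let: Pst t h c o := x in
  match t with
  | N_ => exists n, [/\ h = 0, c = 0 & rev o = fx KN false :: nseq n (fx N_ true)]
  | M_ => exists n m, [/\ h = m, c = m &
      rev o = fx KN false :: tnum N_ n ++ fx KM false :: nseq m (fx M_ true)]
  | I_ => exists n m s, [/\ h = m, c = m & rev o = fx KN false :: tnum N_ n ++
      fx KM false :: tnum M_ m ++ fx KI false :: nseq s (fx I_ true)]
  | H_ => exists J, [/\ size (rH J) + h = rm J, size (rC J) + c = rm J,
      (0 < h -> rC J = [::] /\ rE J = [::]), (0 < c -> rE J = [::])
      & rev o = tag_head J]
  | X_ => exists J x, [/\ h = 0, c = 0, sized J &
      rev o = tag_head J ++ fx R_ true :: nseq x (fx X_ true)]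
  | A_ => exists J x a, [/\ h = 0, c = 0, sized J &
      rev o = tag_head J ++ fx R_ true :: tnum X_ x ++ nseq a (fx A_ true)]
  | Y_ => exists J x a y, [/\ h = 0, c = 0, sized J & rev o =
      tag_head J ++ fx R_ true :: tnum X_ x ++ tnum A_ a ++ nseq y (fx Y_ true)]
  | End_ => exists J, [/\ h = 0, c = 0, sized J & rev o = tag_raw J]
  | _ => True
  end.

Lemma nseqSr (T : Type) n (a : T) : nseq n.+1 a = nseq n a ++ [:: a].
Proof. by rewrite -[LHS]/(nseq (1 + n) a) addnC nseqD. Qed.

Lemma tnumE t n : tnum t n = nseq n (fx t true) ++ [:: fx t false].
Proof. by rewrite /tnum cats1. Qed.

Lemma pinv_step x b : pinv x -> pinv (pstep x b).
Proof.
case: x => t h c o; case: t => //=.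
- move=> [n [-> -> e]]; case: b => /=.
    by exists n.+1; rewrite rev_cons e -cats1 nseqSr.
  by exists n, 0; rewrite ?rev_cons e -?cats1 tnumE /= -?catA.
- move=> [n [m [-> -> e]]]; case: b => /=.
    by exists n, m.+1; rewrite rev_cons e -cats1 nseqSr /= -?catA.
  by exists n, m, 0; rewrite ?rev_cons e -?cats1 (tnumE M_) /= -?catA /= -?catA.
- move=> [n [m [s [-> -> e]]]]; case: b => /=.
    by exists n, m, s.+1; rewrite rev_cons e -cats1 nseqSr /= -?catA /= -?catA.
  exists (Raw n m s [::] [::] [::]); split=> //=.
  by rewrite ?rev_cons e -?cats1 !tag_headE /= (tnumE I_) /= -?catA /= -?catA /= -?catA.
- move=> [[n m s H C E] /= [eh ec h0 c0 e]]; case: h eh h0 => [|h] eh h0.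
    rewrite addn0 in eh; case: c ec c0 => [|c] ec c0.
      rewrite addn0 in ec; case: b => /=.
        exists (Raw n m s H C E), 0; rewrite /sized /= eh ec !eqxx; split=> //.
        by rewrite rev_cons e -cats1.
      exists (Raw n m s H C E); rewrite /sized /= eh ec !eqxx; split=> //.
      by rewrite rev_cons e -cats1.
    exists (Raw n m s H (rcons C b) E); rewrite /= size_rcons; split=> //; try lia.
      by move=> _; apply: c0.
    rewrite rev_cons e -cats1 !tag_headE /= c0 //= map_rcons -cats1.
    by rewrite !cats0 -?catA /= -?catA /= -?catA /= -?catA.
  have [eC eE] := h0 isT; rewrite eC in ec.
  exists (Raw n m s (rcons H b) [::] [::]); rewrite /= size_rcons; split=> //; try lia.
  rewrite rev_cons e -cats1 !tag_headE /= eC eE /= map_rcons -cats1.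
  by rewrite !cats0 -?catA /= -?catA /= -?catA /= -?catA.
- move=> [J [x [-> -> sJ e]]]; case: b => /=.
    by exists J, x.+1; rewrite rev_cons e -cats1 nseqSr -?catA /= -?catA.
  by exists J, x, 0; rewrite rev_cons e -cats1 tnumE -?catA /= -?catA /= -?catA.
- move=> [J [x [a [-> -> sJ e]]]]; case: b => /=.
    by exists J, x, a.+1; rewrite rev_cons e -cats1 nseqSr -?catA /= -?catA.
  by exists J, x, a, 0; rewrite rev_cons e -cats1 (tnumE A_) -?catA /= -?catA.
- move=> [J [x [a [y [-> -> sJ e]]]]]; case: b => /=.
    by exists J, x, a, y.+1; rewrite rev_cons e -cats1 nseqSr -?catA /= -?catA.
  case: J sJ e => n m s H C E /andP[/eqP /= sH /eqP /= sC] e.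
  exists (Raw n m s H C (rcons E (x, a, y))); rewrite /= !addn0; split=> //.
  rewrite rev_cons e -cats1 !tag_headE /= map_rcons flatten_rcons /tag_edge /=.
  by rewrite (tnumE Y_) -?catA /= -?catA /= -?catA /= -?catA /= -?catA.
Qed.

Lemma pinv_parse w : pinv (parse w).
Proof.
elim/last_ind: w => [|w b IH]; first by exists 0.
by rewrite /parse foldl_rcons; apply: pinv_step.
Qed.

Lemma tag_word_sound w : ~~ has (has_tag Err_ \o Some) (tag_word w) ->
  exists J, [/\ sized J, w = enc_raw J & tag_word w = tag_raw J].
Proof.
rewrite /tag_word; case: ifP => [e _|_]; last by rewrite has_rev.
have := pinv_parse w; have := parse_untag w; case: (parse w) e => -[] //= h c o _.
by move=> ew [J [_ _ sJ eo]]; exists J; rewrite -ew eo untag_raw.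
Qed.

Lemma parse_num t t' h c k n o :
  (forall h c o, pstep (Pst t h c o) true = Pst t h c (fx t true :: o)) ->
  (forall h c o, pstep (Pst t h c o) false = Pst t' h c (k ++ fx t false :: o)) ->
  foldl pstep (Pst t h c o) (enc_nat n) = Pst t' h c (k ++ rev (tnum t n) ++ o).
Proof.
move=> H1 H0; rewrite /enc_nat -cats1 foldl_cat.
have -> : foldl pstep (Pst t h c o) (nseq n true) = Pst t h c (nseq n (fx t true) ++ o).
  elim: n o => // n IH o.
  rewrite -[LHS]/(foldl pstep (pstep (Pst t h c o) true) (nseq n true)) H1 IH.
  congr Pst.
  by rewrite -[RHS]/(nseq n.+1 _ ++ o) nseqSr -catA.
by rewrite -[LHS]/(pstep _ false) H0 tnumE rev_cat /= rev_nseq.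
Qed.

Lemma tag_word_enc J : sized J -> tag_word (enc_raw J) = tag_raw J.
Proof.
case: J => n m s H C E /andP[/= /eqP sH /eqP sC].
suff E1 : parse (enc_raw (Raw n m s H C E)) = Pst End_ 0 0 (rev (tag_raw (Raw n m s H C E))).
  by rewrite /tag_word E1 /= revK.
rewrite /enc_raw /= /parse foldl_cat (@parse_num N_ M_ _ _ [:: fx KM false]) //.
rewrite foldl_cat.
have -> o : foldl pstep (Pst M_ 0 0 o) (enc_nat m) = Pst I_ m m (fx KI false :: rev (tnum M_ m) ++ o).
  rewrite /enc_nat -cats1 foldl_cat /=.
  have -> k : foldl pstep (Pst M_ k k o) (nseq m true) = Pst M_ (m + k) (m + k) (nseq m (fx M_ true) ++ o).
    elim: m {sH sC} k o => //= m IH k o; rewrite IH addnS; congr Pst.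
    by rewrite -[RHS]/(nseq m.+1 _ ++ o) nseqSr -catA.
  by rewrite addn0 tnumE rev_cat /= rev_nseq.
rewrite foldl_cat (@parse_num I_ H_ _ _ [:: fx KH false]) // foldl_cat.
have -> c o : foldl pstep (Pst H_ m c o) H = Pst H_ 0 c (rev (map (fx H_) H) ++ o).
  rewrite -sH; elim: H {sH} o => //= b H IH o.
  by rewrite IH /= rev_cons -cats1 -catA.
rewrite foldl_cat.
have -> o : foldl pstep (Pst H_ 0 m o) C = Pst H_ 0 0 (rev (map (fx C_) C) ++ o).
  rewrite -sC; elim: C {sC} o => //= b C IH o.
  by rewrite IH /= rev_cons -cats1 -catA.
rewrite -cats1 foldl_cat.
have -> o : foldl pstep (Pst H_ 0 0 o) (flatten (map enc_redge E)) =
    Pst H_ 0 0 (rev (flatten (map tag_edge E)) ++ o).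
  elim: E o => //= -[[x a] y] E IH o; rewrite !foldl_cat /=.
  rewrite (@parse_num X_ A_ _ _ [::]) // (@parse_num A_ Y_ _ _ [::]) //.
  rewrite (@parse_num Y_ H_ _ _ [::]) // IH; congr Pst.
  by rewrite /= ?rev_cons -cats1 ?rev_cat -?catA.
rewrite /= /tag_raw !tag_headE /=; congr Pst.
rewrite ?rev_cons -?cats1 ?rev_cat /= ?rev_cons -?cats1 ?rev_cat /= ?rev_cons -?cats1 ?rev_cat /= ?rev_cons.
by rewrite -?cats1 ?rev_cat /= -?catA /= -?catA /= -?catA.
Qed.

Lemma size_tag_word w : size (tag_word w) <= 2 * size w + 2.
Proof.
rewrite /tag_word size_rev.
have : size (pout (parse w)) <= 2 * size w + 1.
  elim/last_ind: w => // w b; rewrite /parse foldl_rcons -/(parse w) size_rcons.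
  case: (parse w) => t h c o /= IH.
  by case: t => /=; case: b => /=; try lia; case: h; case: c => //=; lia.
by case: ifP => _ /=; lia.
Qed.

Lemma fixed_tag_word w :
  all (fun a : sym => if a is inr (None, _, _) then true else false) (tag_word w).
Proof.
rewrite /tag_word all_rev.
have : all (fun a : sym => if a is inr (None, _, _) then true else false) (pout (parse w)).
  elim/last_ind: w => // w b; rewrite /parse foldl_rcons -/(parse w).
  case: (parse w) => t h c o /= IH.
  by case: t => /=; case: b => //=; case: h; case: c.
by case: ifP.
Qed.

(** * The decision procedure *)

Section DecisionProgram.
Local Notation one := (one Q).
Local Notation ne := (@nonempty Q).

Definition Sg (W D P R Z a b c : seq sym) : store Q := fun x =>
  match x with
  | 0 => W | 1 => D | 2 => P | 3 => R | 4 => Z | 5 => a | 6 => b | 7 => c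
  | _ => [::] end.

Definition emit (l : seq sym) : prog Q := seqs (map (pushc 2) l).
Definition goto (t : tag) : prog Q := set_mode (fx t false).
Definition in_state (t : tag) (p q : prog Q) := If 4 (has_tag t) p q.
Definition on_bit (p q : prog Q) : prog Q := If 0 (fun o => o == Some (inl true)) p q.
Definition read_num (t : tag) (l : seq sym) (u : tag) : prog Q :=
  on_bit (emit [:: fx t true]) (Seq (emit (fx t false :: l)) (goto u)).

Definition parse_body : prog Q :=
  Seq
   (in_state N_ (read_num N_ [:: fx KM false] M_)
   (in_state M_ (on_bit (seqs [:: emit [:: fx M_ true]; pushc 5 one; pushc 6 one])
                        (Seq (emit [:: fx M_ false; fx KI false]) (goto I_)))
   (in_state I_ (read_num I_ [:: fx KH false] H_)
   (in_state H_
     (If 5 ne (Seq (on_bit (emit [:: fx H_ true]) (emit [:: fx H_ false])) (Pop 5))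
     (If 6 ne (Seq (on_bit (emit [:: fx C_ true]) (emit [:: fx C_ false])) (Pop 6))
       (on_bit (Seq (emit [:: fx R_ true]) (goto X_))
               (Seq (emit [:: fx End_ false]) (goto End_)))))
   (in_state X_ (read_num X_ [::] A_)
   (in_state A_ (read_num A_ [::] Y_)
   (in_state Y_ (read_num Y_ [::] H_)
     (Seq (on_bit (emit [:: fx Err_ true]) (emit [:: fx Err_ false]))
          (goto Err_)))))))))
   (Pop 0).

(* Pushes on [y] as many copies of [a] as the height of stack 5. *)
Definition repeat5 (y : nat) (a : sym) : prog Q :=
  Seq (While 5 ne (seqs [:: pushc y a; pushc 7 one; Pop 5])) (mvall 7 5 id).

Definition push_block (a : sym) : prog Q := Seq (pushc 2 a) (repeat5 2 cell0).

(** Each input bit contributes two symbols to stack 5, the length of a block, and two to stack 6,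
    the number of levels. The prefix is consumed from the top of stack 2, so the innermost blocks
    are pushed first and the parser works above them. The header of a block is pushed before its
    cells: it is then consumed last and comes first in the word that the kernel reads. *)
Definition generate : prog Q :=
  seqs [:: mvall 0 1 id;
    While 1 ne (seqs [:: pushc 5 one; pushc 5 one; pushc 6 one; pushc 6 one; mv 1 0 id]);
    While 6 ne (Seq (Pop 6) (push_block level0));
    push_block (fx Bv false); push_block (fx Bu false); clear 5;
    pushc 2 (fx KN false); pushc 4 (fx N_ false);
    While 0 ne parse_body;
    If 4 (has_tag End_) Skip (pushc 2 (fx Err_ false));
    clear 5; clear 6; Pop 4].

(** The search has restored the prefix on stack 2, so the numbers of states and letters can be
    recounted there from their tagged unary codes. The output is pushed from its last bit to its
    first. *)
Definition write_controller : prog Q :=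
  seqs [:: While 2 ne
      (seqs [:: If 2 (is_tag N_ true) (pushc 5 one) Skip;
                If 2 (is_tag M_ true) (pushc 6 one) Skip; Pop 2]);
    While 6 ne (seqs [:: Pop 6; pushc 0 (inl false); repeat5 0 (inl false)]);
    repeat5 0 (inl false);
    pushc 0 (inl false); pushc 0 (inl false); pushc 0 (inl true)].

Definition decide (K : form Q) : prog Q :=
  seqs [:: generate; pushc 4 (desc _); dfs K; If 3 ne write_controller Skip].

Definition block0 (l : nat) (a : sym) : seq sym := nseq l cell0 ++ [:: a].

(* The quantifier prefix, outermost first. *)
Definition prefix (w : seq bool) : seq sym :=
  let l := 2 * size w in
  rev (tag_word w) ++ block0 l (fx Bu false) ++ block0 l (fx Bv false) ++
  flatten (nseq l (block0 l level0)).

Ltac stq8 := apply: functional_extensionality;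
  do 8 (case=> [|]; first by []); move=> ?; by [].

Ltac xrun := repeat first
  [ apply: ex_skip | apply: ex_pop | (apply: ex_pushc; simpl in *; lia)
  | apply: ex_seq | (apply: ex_if; rewrite /=) ].

Ltac slia := simpl in *; rewrite ?size_nseq; lia.

Section Bounds.
Variable B : nat.

Lemma parse_bodyP b W P t h c : size P + 3 <= B -> h < B -> c < B ->
  let x := pstep (Pst t h c P) b in
  ex B parse_body
    (Sg (inl b :: W) [::] P [::] [:: fx t false] (nseq h one) (nseq c one) [::])
    (Sg W [::] (pout x) [::] [:: fx (pt x) false] (nseq (ph x) one) (nseq (pc x) one) [::]).
Proof.
move=> lP lh lc; rewrite /parse_body /read_num /on_bit /in_state /goto /set_mode /emit.
have nh := size_nseq h one; have nc := size_nseq c one.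
case: t; case: b; rewrite /=; try (apply: ex_eq; [by xrun | by stq8]).
all: case: h lh nh => [|h] lh nh; rewrite /=; try (apply: ex_eq; [by xrun | by stq8]).
all: case: c lc nc => [|c] lc nc; rewrite /=; by apply: ex_eq; [by xrun | by stq8].
Qed.

Lemma parse_loopP w P t h c : size P + 2 * size w + 1 <= B -> h + size w <= B ->
  c + size w <= B ->
  let x := foldl pstep (Pst t h c P) w in
  ex B (While 0 ne parse_body)
    (Sg (map inl w) [::] P [::] [:: fx t false] (nseq h one) (nseq c one) [::])
    (Sg [::] [::] (pout x) [::] [:: fx (pt x) false] (nseq (ph x) one) (nseq (pc x) one) [::]).
Proof.
elim: w P t h c => [|b w IH] P t h c /= lP lh lc; first exact: ex_while0.
apply: ex_while1 => //; first by apply: parse_bodyP; slia.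
move: (IH (pout (pstep (Pst t h c P) b)) (pt (pstep (Pst t h c P) b))
  (ph (pstep (Pst t h c P) b)) (pc (pstep (Pst t h c P) b))).
have -> : Pst (pt (pstep (Pst t h c P) b)) (ph (pstep (Pst t h c P) b))
  (pc (pstep (Pst t h c P) b)) (pout (pstep (Pst t h c P) b)) = pstep (Pst t h c P) b.
  by case: (pstep _ _).
apply.
- by case: t; case: b; rewrite /=; try slia; case: h lh; case: c lc; rewrite /=; slia.
- by case: t; case: b; rewrite /=; try slia; case: h lh; case: c lc; rewrite /=; slia.
- by case: t; case: b; rewrite /=; try slia; case: h lh; case: c lc; rewrite /=; slia.
Qed.

Lemma repeat5P y a k s : y < 3 -> y != 1 -> s 5 = nseq k one -> s 7 = [::] ->
  size (s y) + k <= B -> ex B (repeat5 y a) s (upd s y (nseq k a ++ s y)).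
Proof.
move=> ly ny e5 e7 le.
apply: (@ex_seq _ _ _ _ _ (upd (upd (upd s 5 [::]) 7 (nseq k one)) y (nseq k a ++ s y))).
  suff H j i s' : s' 5 = nseq j one -> s' 7 = nseq i one -> i + j = k -> size (s' y) + j <= B ->
      ex B (While 5 ne (seqs [:: pushc y a; pushc 7 one; Pop 5])) s'
        (upd (upd (upd s' 5 [::]) 7 (nseq k one)) y (nseq j a ++ s' y)).
    by apply: (H k 0) => //; rewrite e7.
  elim: j i s' => [|j IH] i s' h5 h7 hk hy.
    apply: ex_eq; first by apply: ex_while0; rewrite h5.
    have -> : k = i by slia.
    by rewrite -h7 [upd s' 5 _]upd_eq // !upd_id.
  apply: ex_eq.
    apply: ex_while1; first by rewrite h5.
      apply: ex_seqs_cons; first by apply: ex_pushc; slia.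
      apply: ex_seqs_cons.
        apply: ex_pushc; rewrite updE ifN; last slia.
        by rewrite h7 size_nseq; slia.
      apply: ex_seqs_cons; last exact: ex_seqs_nil.
      exact: ex_pop.
    apply: (IH i.+1).
    - rewrite !updE /= ifN; last slia.
      by rewrite h5.
    - rewrite !updE /= ifN; last slia.
      by rewrite h7.
    - slia.
    - rewrite !updE ifN; last slia.
      rewrite ifN; last slia.
      rewrite eqxx /=; slia.
  apply: functional_extensionality => z; rewrite !updE.
  case: (z =P y) => [_|nz]; last by case: (z =P 7) => //; case: (z =P 5).
  rewrite ifN; last slia.
  rewrite ifN; last slia.
  by rewrite eqxx nseqSr -catA.
apply: ex_eq.
  apply: ex_mvall => //; rewrite !updE !ifN ?size_nseq /=; slia.
rewrite !updE /= !ifN; try slia.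
rewrite map_id /=; apply: functional_extensionality => z; rewrite !updE.
case: (z =P 5) => [->|n5].
  by rewrite ifN ?e5 -1?[[::]]/(nseq 0 one) ?catrev_nseq ?addn0 //; slia.
by case: (z =P 7) => [->|n7]; [rewrite ifN ?e7 //; slia | case: (z =P y)].
Qed.

(** The parser never looks at what it has written, so it may run on top of the blocks already
    pushed. *)
Lemma foldl_pstep_suffix w t h c o S :
  let x := foldl pstep (Pst t h c o) w in
  foldl pstep (Pst t h c (o ++ S)) w = Pst (pt x) (ph x) (pc x) (pout x ++ S).
Proof.
elim/last_ind: w => // w b; rewrite !foldl_rcons /= => ->.
case: (foldl _ _ _) => u h' c' o' /=; case: u => //=; case: b => //=.
  by case: h' => //=; case: c'.
by case: h' => //=; case: c'.
Qed.

Lemma push_blockP a k P R Z b W : size P + k.+1 <= B ->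
  ex B (push_block a) (Sg W [::] P R Z (nseq k one) b [::])
     (Sg W [::] (block0 k a ++ P) R Z (nseq k one) b [::]).
Proof.
move=> le; apply: ex_seq; first by apply: ex_pushc; slia.
apply: ex_eq; first by apply: (@repeat5P 2 cell0 k) => //=; slia.
by rewrite /block0 -catA; stq8.
Qed.

(** With [l = 2n] there are [l + 2] blocks, namely the levels and the two end vertices, of [l + 1]
    symbols each; the rest bounds the tagged input. *)
Definition plen (n : nat) : nat := (2 * n).+1 * (2 * n).+2 + 2 * n + 2.

Lemma size_prefix w : size (prefix w) <= plen (size w).
Proof.
set l := 2 * size w.
have sb a : size (block0 l a) = l.+1 by rewrite size_cat size_nseq addn1.
have slev j : size (flatten (nseq j (block0 l level0))) = j * l.+1.
  by elim: j => // j IH; rewrite /= size_cat IH sb mulSn.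
rewrite /prefix -/l size_cat size_rev size_cat sb size_cat sb slev /plen -/l.
by have := size_tag_word w; rewrite -/l; lia.
Qed.

Lemma generateP w : plen (size w) + 2 <= B ->
  ex B generate (input_store w) (Sg [::] [::] (prefix w) [::] [::] [::] [::] [::]).
Proof.
rewrite /plen; set l := 2 * size w; set u := map inl w : seq sym => lp.
have el : l = 2 * size w by [].
have lw : 2 * l + 2 <= B by nia.
have ll : l.+1 * l.+2 = l.+1 + (l.+1 + l * l.+1) by lia.
have su : size u = size w by rewrite size_map.
pose lev j := flatten (nseq j (block0 l level0)).
have sb a : size (block0 l a) = l.+1 by rewrite size_cat size_nseq addn1.
have slev j : size (lev j) = j * l.+1.
  by elim: j => // j IH; rewrite /lev /= size_cat -/(lev j) IH sb mulSn.
have sx : size (prefix w) = size (tag_word w) + (l.+1 + (l.+1 + l * l.+1)).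
  by rewrite /prefix -/l size_cat size_rev size_cat sb size_cat sb slev.
pose bl := block0 l (fx Bu false) ++ block0 l (fx Bv false) ++ lev l.
have sbl : size bl = l.+1 + (l.+1 + l * l.+1) by rewrite size_cat sb size_cat sb slev.
have two k : 2 * k.+1 = (2 * k).+2 by lia.
apply: (ex_seqs_cons (s2 := Sg [::] (rev u) [::] [::] [::] [::] [::] [::])).
  apply: ex_eq; first by apply: ex_mvall => //=; rewrite size_map; slia.
  by rewrite /= map_id catrevE cats0; stq8.
apply: (ex_seqs_cons (s2 := Sg u [::] [::] [::] [::] (nseq l one) (nseq l one) [::])).
  suff H v k W : k + size v = size w -> size W = k ->
      ex B (While 1 ne (seqs [:: pushc 5 one; pushc 5 one; pushc 6 one; pushc 6 one; mv 1 0 id]))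
      (Sg W v [::] [::] [::] (nseq (2 * k) one) (nseq (2 * k) one) [::])
      (Sg (catrev v W) [::] [::] [::] [::] (nseq l one) (nseq l one) [::]).
    apply: ex_eq; first by apply: (H (rev u) 0 [::]); rewrite ?size_rev.
    by rewrite catrevE revK cats0.
  elim: v k W => [|a v IH] k W /= ek eW.
    have -> : l = 2 * k by rewrite /l -ek addn0.
    exact: ex_while0.
  apply: ex_while1 => //; last by apply: (IH k.+1) => /=; slia.
  have lW : size W < B by rewrite eW; lia.
  apply: ex_eq.
    do 4 (apply: ex_seq; first by apply: ex_pushc; slia).
    apply: ex_seq; last exact: ex_skip.
    by apply: (@ex_mv _ B 1 0 id _ a v) => //; exact: lW.
  by rewrite two; stq8.
apply: (ex_seqs_cons (s2 := Sg u [::] (lev l) [::] [::] (nseq l one) [::] [::])).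
  suff H i j : i + j = l -> ex B (While 6 ne (Seq (Pop 6) (push_block level0)))
      (Sg u [::] (lev i) [::] [::] (nseq l one) (nseq j one) [::])
      (Sg u [::] (lev l) [::] [::] (nseq l one) [::] [::]).
    by apply: (H 0 l).
  elim: j i => [|j IH] i ei.
    have -> : i = l by lia.
    exact: ex_while0.
  apply: ex_while1 => //; last by apply: (IH i.+1); lia.
  apply: (ex_seq (s2 := Sg u [::] (lev i) [::] [::] (nseq l one) (nseq j one) [::])).
    by apply: ex_eq; [exact: ex_pop | stq8].
  apply: push_blockP; rewrite slev.
  have : i * l.+1 <= l * l.+1 by rewrite leq_mul2r; lia.
  lia.
apply: ex_seqs_cons; first by apply: push_blockP; rewrite slev; lia.
apply: ex_seqs_cons; first by apply: push_blockP; rewrite size_cat sb slev; lia.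
rewrite -/bl.
apply: (ex_seqs_cons (s2 := Sg u [::] bl [::] [::] [::] [::] [::])).
  by apply: ex_eq; [exact: ex_clear | stq8].
apply: (ex_seqs_cons (s2 := Sg u [::] (fx KN false :: bl) [::] [::] [::] [::] [::])).
  by apply: ex_eq; [apply: ex_pushc => /=; rewrite sbl; lia | stq8].
apply: (ex_seqs_cons (s2 := Sg u [::] (fx KN false :: bl) [::] [:: fx N_ false] [::] [::] [::])).
  by apply: ex_eq; [apply: ex_pushc => /=; lia | stq8].
apply: ex_seqs_cons.
  by apply: (@parse_loopP w (fx KN false :: bl) N_ 0 0) => /=; rewrite ?sbl -/l; lia.
rewrite -[fx KN false :: bl]/(pout pst0 ++ bl) -[Pst _ _ _ _]/(Pst N_ 0 0 (pout pst0 ++ bl)).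
rewrite foldl_pstep_suffix -[foldl _ _ _]/(parse w).
set x := parse w.
apply: (ex_seqs_cons (s2 := Sg [::] [::] (prefix w) [::] [:: fx (pt x) false] (nseq (ph x) one) (nseq (pc x) one) [::])).
  have ep : prefix w = (if eqtag (pt x) End_ then pout x else fx Err_ false :: pout x) ++ bl.
    by rewrite /prefix /tag_word revK.
  have E : has_tag End_ (Some (fx (pt x) false)) = eqtag (pt x) End_ by case: (pt x).
  have sx' := size_prefix w; rewrite ep in sx' *.
  apply: ex_if; rewrite -[ohead _]/(Some (fx (pt x) false)) E.
  move: sx'; case: (eqtag _ _) => sx'; first exact: ex_skip.
  apply: ex_eq; first apply: ex_pushc; last by stq8.
  by apply: leq_trans lp; apply: leq_trans (leq_addr 2 _).
apply: ex_seqs_cons; first exact: ex_clear.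
apply: ex_seqs_cons; first exact: ex_clear.
apply: ex_seqs_cons; first exact: ex_pop.
apply: ex_eq; first exact: ex_seqs_nil.
by stq8.
Qed.


Definition cnt (t : tag) (P : seq sym) : nat := count (is_tag t true \o Some) P.

Lemma write_controllerP P :
  (size P).+2 * (size P).+2 <= B ->
  ex B write_controller (Sg [::] [::] P [:: one] [::] [::] [::] [::])
    (Sg (map inl (unctrl_string (cnt N_ P) (cnt M_ P))) [::] [::] [:: one] [::]
        (nseq (cnt N_ P) one) [::] [::]).
Proof.
move=> lB; set n := cnt N_ P; set m := cnt M_ P.
have ln : n <= size P by exact: count_size.
have lm : m <= size P by exact: count_size.
have lz : m + m.+1 * n + 4 <= B.
  apply: leq_trans lB; apply: (@leq_trans (m.+2 * n.+2)); first lia.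
  by apply: leq_mul; lia.
apply: (ex_seqs_cons (s2 := Sg [::] [::] [::] [:: one] [::] (nseq n one) (nseq m one) [::])).
  suff H P' i j : i + cnt N_ P' = n -> j + cnt M_ P' = m ->
     ex B (While 2 ne
      (seqs [:: If 2 (is_tag N_ true) (pushc 5 one) Skip;
                If 2 (is_tag M_ true) (pushc 6 one) Skip; Pop 2]))
      (Sg [::] [::] P' [:: one] [::] (nseq i one) (nseq j one) [::])
      (Sg [::] [::] [::] [:: one] [::] (nseq n one) (nseq m one) [::]).
    exact: (H P 0 0).
  elim: P' i j => [|a P' IH] i j ei ej.
    rewrite /cnt /= in ei ej.
    have -> : i = n by lia.
    have -> : j = m by lia.
    exact: ex_while0.
  have ai : is_tag N_ true (Some a) + cnt N_ P' + i = n by rewrite -ei addnC.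
  have aj : is_tag M_ true (Some a) + cnt M_ P' + j = m by rewrite -ej addnC.
  apply: (ex_while1 (s2 := Sg [::] [::] P' [:: one] [::]
     (nseq (is_tag N_ true (Some a) + i) one) (nseq (is_tag M_ true (Some a) + j) one) [::])) => //;
    last by apply: IH; lia.
  apply: (ex_seqs_cons (s2 := Sg [::] [::] (a :: P') [:: one] [::]
     (nseq (is_tag N_ true (Some a) + i) one) (nseq j one) [::])).
    apply: ex_if; rewrite -[ohead _]/(Some a).
    case: (is_tag N_ true (Some a)) ai => ai; last exact: ex_skip.
    apply: ex_eq; first apply: ex_pushc; last by stq8.
    rewrite size_nseq; lia.
  apply: (ex_seqs_cons (s2 := Sg [::] [::] (a :: P') [:: one] [::]
     (nseq (is_tag N_ true (Some a) + i) one) (nseq (is_tag M_ true (Some a) + j) one) [::])).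
    apply: ex_if; rewrite -[ohead _]/(Some a).
    case: (is_tag M_ true (Some a)) aj => aj; last exact: ex_skip.
    apply: ex_eq; first apply: ex_pushc; last by stq8.
    rewrite size_nseq; lia.
  apply: ex_seqs_cons; last exact: ex_seqs_nil.
  by apply: ex_eq; [exact: ex_pop | stq8].
pose S k j := Sg (nseq k (inl false)) [::] [::] [:: one] [::] (nseq n one) (nseq j one) [::].
have rp k j : k + n <= B -> ex B (repeat5 0 (inl false)) (S k j) (S (n + k) j).
  move=> lk; apply: ex_eq; first by apply: (@repeat5P 0 _ n) => //=; rewrite size_nseq.
  by rewrite /= -nseqD; stq8.
apply: (ex_seqs_cons (s2 := S (m * n.+1) 0)).
  suff H i j : i + j = m -> ex B (While 6 ne (seqs [:: Pop 6; pushc 0 (inl false); repeat5 0 (inl false)]))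
     (S (i * n.+1) j) (S (m * n.+1) 0).
    exact: (H 0 m).
  elim: j i => [|j IH] i ei.
    have -> : i = m by lia.
    exact: ex_while0.
  have li : i.+1 * n.+1 <= m * n.+1 by rewrite leq_mul2r; lia.
  apply: ex_while1 => //; last by apply: (IH i.+1); lia.
  apply: (ex_seqs_cons (s2 := S (i * n.+1) j)).
    by apply: ex_eq; [exact: ex_pop | stq8].
  apply: (ex_seqs_cons (s2 := S (i * n.+1).+1 j)).
    by apply: ex_eq; [apply: ex_pushc; rewrite size_nseq; lia | stq8].
  apply: ex_seqs_cons; last exact: ex_seqs_nil.
  apply: ex_eq; first by apply: rp; lia.
  by congr S; lia.
apply: ex_seqs_cons; first by apply: rp; lia.
(* The bits [false] were written in [m] rounds of [n.+1] and a final one of [n]. *)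
have -> : n + m * n.+1 = m + m.+1 * n by lia.
set z := m + m.+1 * n.
apply: (ex_seqs_cons (s2 := S z.+1 0)).
  by apply: ex_eq; [apply: ex_pushc; rewrite size_nseq; lia | stq8].
apply: (ex_seqs_cons (s2 := S z.+2 0)).
  by apply: ex_eq; [apply: ex_pushc; rewrite size_nseq; lia | stq8].
apply: ex_seqs_cons; last exact: ex_seqs_nil.
apply: ex_eq; first by apply: ex_pushc; rewrite size_nseq; lia.
have -> : map inl (unctrl_string n m) = (inl true :: nseq z.+2 (inl false)) :> seq sym.
  by rewrite /unctrl_string /= map_nseq.
by stq8.
Qed.

Lemma decideP K w : let P := prefix w in let r := qval K P [::] in
  plen (size w) + 2 <= B -> (size P).+2 * (size P).+2 <= B -> fits B (size P) K ->
  wff [::] K ->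
  exists s', [/\ ex B (decide K) (input_store w) s', s' 3 = flag _ r &
    r -> s' 0 = map inl (unctrl_string (cnt N_ P) (cnt M_ P))].
Proof.
move=> P r lp lB ft wf.
have lP : (size P).+1 < B by apply: leq_trans lB; rewrite mulSn; lia.
have rs : all (fun a => reset a == a) P.
  have ab k a : reset a == a -> all (fun a => reset a == a) (block0 k a).
    by move=> ra; rewrite all_cat /= ra all_nseq eqxx orbT.
  rewrite /P /prefix all_cat all_rev; apply/andP; split.
    by apply: sub_all (fixed_tag_word w) => -[|[[[q|] t] b]] //=; rewrite eqxx.
  rewrite all_cat ab //= all_cat ab //=; move: (2 * size w) => l.
  by elim: {1}l => //= k IH; rewrite all_cat ab.
have E : ex B (seqs [:: generate; pushc 4 (desc _); dfs K]) (input_store w)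
    (Sg [::] [::] P (flag _ r) [::] [::] [::] [::]).
  apply: ex_seqs_cons; first exact: generateP.
  apply: (ex_seqs_cons (s2 := St [::] [::] P [::] [:: desc _])).
    apply: ex_eq; first by apply: ex_pushc; rewrite /=; lia.
    by stq8.
  apply: ex_seqs_cons; last exact: ex_seqs_nil.
  apply: ex_eq; first by apply: dfs_run lP ft wf _ _ _.
  by stq8.
have D s' : ex B (If 3 ne write_controller Skip) (Sg [::] [::] P (flag _ r) [::] [::] [::] [::]) s' ->
    ex B (decide K) (input_store w) s'.
  move=> E'; apply: (@ex_seqs_cat _ B [:: generate; pushc 4 (desc _); dfs K] [:: If 3 ne write_controller Skip] _ _ _ E).
  exact: ex_seqs_cons E' (ex_seqs_nil _ _).
move: D; case: r {E} => D.
  eexists; split; first (apply: D; apply: ex_if; exact: write_controllerP); by [].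
by eexists; split; first (apply: D; apply: ex_if; exact: ex_skip).
Qed.

End Bounds.

Fixpoint fcost (F : form Q) : nat :=
  match F with
  | Sym _ t => t.1 + size t.2
  | Lt t1 t2 => (t1.1 + size t1.2) + (t2.1 + size t2.2)
  | Not F => fcost F
  | And F1 F2 => fcost F1 + fcost F2
  | Ex _ F => fcost F
  end.

Lemma fits_fcost F L B : fcost F * L.+1 <= B -> fits B L F.
Proof.
elim: F => [P t|t1 t2|F IH|F1 IH1 F2 IH2|i F IH] //=.
- by nia.
- by move=> h; apply/andP; split; nia.
- by move=> h; apply/andP; split; [apply: IH1 | apply: IH2]; nia.
Qed.

Lemma poly_plen : poly plen.
Proof.
have h : poly (fun n => 2 * n) by apply: poly_mul (poly_const 2) poly_id.
have h1 k : poly (fun n => 2 * n + k) by apply: poly_add h (poly_const k).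
apply: poly_leq (poly_add (poly_add (poly_mul (h1 1) (h1 2)) h) (poly_const 2)) => n.
by rewrite /plen; lia.
Qed.

Lemma qbf_pspace (K : form Q) (k : nat) (L : language) (R : seq bool -> seq bool -> Prop) :
  2 < k -> wff [::] K -> vok k (decide K) ->
  (forall w, L w <-> qval K (prefix w) [::]) ->
  (forall w, L w -> R w (unctrl_string (cnt N_ (prefix w)) (cnt M_ (prefix w)))) ->
  in_PSPACE L /\ PSPACE_search L R.
Proof.
move=> k2 wf ok HL HR.
pose p2 n := plen n + 2.
have pp2 : poly p2 by apply: poly_add poly_plen (poly_const 2).
(* One summand for each use of space: the values of the terms of the kernel, the controller that is
   written, and the prefix. *)
pose B n := fcost K * p2 n + p2 n * p2 n + p2 n.
have pB : poly B.
  apply: poly_add (pp2); apply: poly_add; first exact: poly_mul (poly_const _) (pp2).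
  exact: poly_mul.
have [||D S] := @pspace_machine Q k 3 (decide K) L R B pB _ k2 ok.
- by move=> n; rewrite /B /p2 /plen; nia.
- move=> w; have lp := size_prefix w; have := @decideP (B (size w)) K w.
  case=> //.
  + by rewrite /B /p2; lia.
  + apply: (@leq_trans (p2 (size w) * p2 (size w))); first by rewrite /p2; apply: leq_mul; lia.
    by rewrite /B; lia.
  + apply: fits_fcost; apply: (@leq_trans (fcost K * p2 (size w))); last by rewrite /B; lia.
    by rewrite leq_mul2l /p2; apply/orP; right; lia.
  move=> s' [[t E] e3 e0]; exists s', t; split=> //.
    by rewrite HL e3; case: (qval _ _ _).
  by move=> Lw; exists (unctrl_string (cnt N_ (prefix w)) (cnt M_ (prefix w))); [apply: e0; apply/HL | apply: HR].
- by split=> //; exists (machine k 3 (decide K)).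
Qed.

End DecisionProgram.

(** * The kernel formula *)

Definition Or (F1 F2 : form Q) := Not (And (Not F1) (Not F2)).
Definition Imp (F1 F2 : form Q) := Not (And F1 (Not F2)).
Definition All i (F : form Q) := Not (Ex i (Not F)).
Definition Eqv i j : form Q :=
  And (Not (Lt _ (0, [:: i]) (0, [:: j]))) (Not (Lt _ (0, [:: j]) (0, [:: i]))).
Definition Zero i : form Q := Not (Lt _ (0, [::]) (0, [:: i])).

(* Variables 12 to 16 and 18 to 21 are reserved for the bound variables of the
   macros below. *)
Definition Blk c vs x t : form Q :=
  And (Sym (is_tag t false) (c, x :: vs))
      (All 12 (Imp (Lt _ (0, [:: 12]) (0, [:: x])) (Sym (is_tag t true) (c, 12 :: vs)))).
(** The constants 1, 2, 3 count the separators before a field of the edge at [p]: the symbol [R_],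
    then the end marks of the preceding unary numbers. *)
Definition Rec p x a y : form Q :=
  And (Sym (has_tag R_) (0, [:: p]))
  (And (Blk 1 [:: p] x X_) (And (Blk 2 [:: p; x] a A_) (Blk 3 [:: p; x; a] y Y_))).
(** Fields are addressed from their marker. States are counted from offset 1; labels from offset 0,
    so that the silent label 0 falls on the marker itself and the label [a.+1] on the symbol of
    letter [a]. *)
Definition After k P c i : form Q :=
  Ex 13 (And (Sym (has_tag k) (0, [:: 13])) (Sym P (c, [:: 13; i]))).
Definition InN i := After KN (is_tag N_ true) 1 i.
Definition LeM i := After KM (fun o => has_tag KM o || is_tag M_ true o) 0 i.
Definition IsS i := After KI (is_tag I_ false) 1 i.
Definition Hi i := After KH (is_tag H_ true) 0 i.
(** The control bits come after the high bits, as many as there are letters, so their address is the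
    marker [KH] plus the number of letters plus [i]. That number is found as the offset, in variable
    15, of the end mark of its unary code. The label 0 falls on a high bit or on the marker and
    never on a control bit. *)
Definition Ct i : form Q :=
  Ex 15 (And (After KM (is_tag M_ false) 1 15)
    (Ex 14 (And (Sym (has_tag KH) (0, [:: 14])) (Sym (is_tag C_ true) (0, [:: 14; 15; i]))))).
(** In the block at [r] the two bits of state [i] sit at cells [2 * i] and [(2 * i).+1]; since terms
    are sums, [i] is listed twice. [Tf] is for the states reached when high actions are hidden, [Sf]
    for the superset of the low ones. *)
Definition Tf r i : form Q := Sym (is_tag Ce true) (1, [:: r; i; i]).
Definition Sf r i : form Q := Sym (is_tag Ce true) (2, [:: r; i; i]).

Definition NoErr : form Q := Not (Ex 0 (Sym (has_tag Err_) (0, [:: 0]))).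
Definition StartOk := Ex 17 (And (IsS 17) (InN 17)).
Definition EdgesOk := All 0 (All 1 (All 2 (All 3
  (Imp (Rec 0 1 2 3) (And (InN 1) (And (LeM 2) (InN 3))))))).
Definition Det := All 0 (All 1 (All 2 (All 3 (All 4 (All 6
  (Imp (And (Rec 0 1 2 3) (And (Rec 4 1 2 6) (Not (Hi 2)))) (Eqv 3 6))))))).
Definition Closed r := All 18 (All 19 (All 20 (All 21
  (Imp (And (Rec 18 19 20 21) (And (Zero 20) (Sf r 19))) (Sf r 21))))).
Definition Start r := And (All 7 (Imp (And (InN 7) (Tf r 7)) (IsS 7)))
  (And (All 17 (Imp (IsS 17) (Sf r 17))) (Closed r)).
Definition Bad r := All 7 (Imp (InN 7) (Not (Sf r 7))).
Definition Steady u v := All 7 (Imp (InN 7)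
  (And (Imp (Tf v 7) (Tf u 7)) (Imp (Sf u 7) (Sf v 7)))).
Definition MoveTo u v := Ex 0 (Ex 1 (Ex 2 (Ex 3
  (And (Rec 0 1 2 3) (And (Not (Ct 2)) (And (Tf u 1)
  (And (All 7 (Imp (And (InN 7) (Tf v 7)) (Eqv 7 3)))
  (Or (And (Or (Zero 2) (Hi 2)) (All 7 (Imp (InN 7) (Imp (Sf u 7) (Sf v 7)))))
      (And (Not (Or (Zero 2) (Hi 2)))
        (And (All 4 (All 5 (All 6 (Imp (And (Rec 4 5 2 6) (Sf u 5)) (Sf v 6)))))
             (Closed v))))))))))).
Definition First P r : form Q := And (Sym P (0, [:: r]))
  (All 16 (Imp (Lt _ (0, [:: 16]) (0, [:: r])) (Not (Sym P (0, [:: 16]))))).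
Definition isU (o : option sym) := is_tag Cl true o || has_tag Bu o.
Definition isV (o : option sym) := is_tag Cl false o || has_tag Bv o.

(* The source and the target of the current leg of the Savitch recursion are
   the innermost midpoints that were chosen with bit [true], resp. [false]. *)
Definition BadPath : form Q := Ex 8 (Ex 9 (Ex 10 (Ex 11
  (And (First isU 8) (And (First isV 9)
  (And (Sym (has_tag Bu) (0, [:: 10])) (And (Sym (has_tag Bv) (0, [:: 11]))
  (And (Start 10) (And (Bad 11) (Or (Steady 8 9) (MoveTo 8 9))))))))))).

Definition Kern : form Q :=
  And NoErr (And StartOk (And EdgesOk (And Det (Not BadPath)))).

(** * Meaning of the formulas *)

Section Sat.
Variable D : seq sym.

Lemma satAnd v (F1 F2 : form Q) : sat D v (And F1 F2) <-> sat D v F1 /\ sat D v F2.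
Proof. by split=> [/andP|[? ?]] //; apply/andP. Qed.

Lemma satOr v F1 F2 : sat D v (Or F1 F2) <-> sat D v F1 \/ sat D v F2.
Proof.
rewrite /Or /=; case: (sat _ _ F1); case: (sat _ _ F2); split; by intuition.
Qed.

Lemma satNot v (F : form Q) : sat D v (Not F) <-> ~ sat D v F.
Proof. by split=> /negP. Qed.

Lemma satImp v F1 F2 : sat D v (Imp F1 F2) <-> (sat D v F1 -> sat D v F2).
Proof.
rewrite /Imp /=; case: (sat _ _ F1); case: (sat _ _ F2); by split=> // H; apply: H.
Qed.

Lemma satEx v i (F : form Q) :
  sat D v (Ex i F) <-> exists k, k < size D /\ sat D (updn v i k) F.
Proof.
split=> [/hasP[k]|[k [lk H]]]; first by rewrite mem_iota add0n => lk H; exists k.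
by apply/hasP; exists k; rewrite ?mem_iota.
Qed.

Lemma satAll v i F :
  sat D v (All i F) <-> forall k, k < size D -> sat D (updn v i k) F.
Proof.
rewrite satNot satEx; split=> [H k lk|H [k [lk]]].
  by apply: NNPP => nF; apply: H; exists k; split=> //; apply/satNot.
by move/satNot; apply; apply: H.
Qed.
End Sat.

Definition avoids (t : tag) (l : seq sym) : bool :=
  all (fun a => ~~ has_tag t (Some a)) l.

Lemma avoids_cat t l1 l2 : avoids t (l1 ++ l2) = avoids t l1 && avoids t l2.
Proof. exact: all_cat. Qed.

Lemma avoids_cons t a l : avoids t (a :: l) = ~~ has_tag t (Some a) && avoids t l.
Proof. by []. Qed.

Lemma avoids_tnum t u n : ~~ eqtag t u -> avoids t (tnum u n).
Proof. by move=> ne; rewrite /avoids all_rcons all_nseq /= ne orbT. Qed.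

Lemma avoids_map t u l : ~~ eqtag t u -> avoids t (map (fx u) l).
Proof. by move=> ne; elim: l => //= b l ->; rewrite ne. Qed.

Lemma avoids_edges t E : ~~ eqtag t R_ -> ~~ eqtag t X_ -> ~~ eqtag t A_ ->
  ~~ eqtag t Y_ -> avoids t (flatten (map tag_edge E)).
Proof.
move=> n1 n2 n3 n4; elim: E => // e E IH; rewrite avoids_cat IH andbT.
by rewrite /tag_edge avoids_cons !avoids_cat !avoids_tnum //= n1.
Qed.

Lemma avoids_onth t l i : avoids t l -> has_tag t (onth l i) = false.
Proof. by elim: l i => [|a l IH] [|i] //= /andP[/negPf h /IH]. Qed.

Lemma is_has t b o : is_tag t b o -> has_tag t o.
Proof. by case: o => [[|[[q u] c]]|] //= /andP[]. Qed.

Lemma avoids_is t b l i : avoids t l -> is_tag t b (onth l i) = false.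
Proof. by move=> av; apply/negP => /is_has; rewrite avoids_onth. Qed.

Lemma has_tag_size t (l : seq sym) i : has_tag t (onth l i) -> i < size l.
Proof. by rewrite -onthTE; case: (onth l i). Qed.

Lemma is_tag_size t b (l : seq sym) i : is_tag t b (onth l i) -> i < size l.
Proof. by move/is_has/has_tag_size. Qed.

Lemma onth_catr (l1 l2 : seq sym) i : onth (l1 ++ l2) (size l1 + i) = onth l2 i.
Proof. by rewrite onth_cat ltnNge leq_addr /= addKn. Qed.

Lemma eqtag_refl t : eqtag t t. Proof. by case: t. Qed.

Lemma tnum_true t n T i : avoids t T -> is_tag t true (onth (tnum t n ++ T) i) = (i < n).
Proof.
move=> av; rewrite tnumE; elim: n i => [|n IH] [|i] //=; rewrite ?eqtag_refl //.
exact: avoids_is.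
Qed.

Lemma tnum_false t n T i : avoids t T -> is_tag t false (onth (tnum t n ++ T) i) = (i == n).
Proof.
move=> av; rewrite tnumE; elim: n i => [|n IH] [|i] //=; rewrite ?eqtag_refl //.
exact: avoids_is.
Qed.

Lemma tnum_blk t n T x : (is_tag t false (onth (tnum t n ++ T) x) /\
  forall z, z < x -> is_tag t true (onth (tnum t n ++ T) z)) <-> x = n.
Proof.
rewrite tnumE; split=> [[]|->].
  elim: n x => [|n IH] [|x] //=; rewrite ?eqtag_refl //.
    by move=> _ /(_ 0 isT) /=; rewrite andbF.
  by move=> h H; congr S; apply: IH => // z lz; apply: (H z.+1).
split=> [|z]; first by elim: n => //=; rewrite eqtag_refl.
by elim: n z => [|n IH] [|z] //=; [rewrite eqtag_refl | apply: IH].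
Qed.

Lemma map_true t l T i : avoids t T -> is_tag t true (onth (map (fx t) l ++ T) i) = nth false l i.
Proof.
move=> av; elim: l i => [|b l IH] i /=; first by rewrite nth_nil avoids_is.
by case: i => [|i] //=; rewrite eqtag_refl; case: b.
Qed.

Lemma marker A T t b i : avoids t A -> avoids t T ->
  has_tag t (onth (A ++ fx t b :: T) i) <-> i = size A.
Proof.
move=> aA aT; split=> [|->]; last by rewrite -[size A]addn0 onth_catr /= eqtag_refl.
rewrite onth_cat; case: ltnP => [_|le]; first by rewrite avoids_onth.
case e : (i - size A) => [|j] /=; last by rewrite avoids_onth.
by move=> _; apply/eqP; rewrite eqn_leq le andbT -subn_eq0 e.
Qed.

Definition cellb (b : bool) : sym := inr (Some false, Ce, b).
Definition blk (a : sym) (bs : seq bool) : seq sym := a :: map cellb bs.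
Definition lvl (x : bool * seq bool) : seq sym := blk (inr (Some true, Cl, x.1)) x.2.

Lemma avoids_cells t bs : ~~ eqtag t Ce -> avoids t (map cellb bs).
Proof. by move=> ne; elim: bs => //= b bs ->; rewrite ne. Qed.

Lemma avoids_lvls t lv : ~~ eqtag t Ce -> ~~ eqtag t Cl ->
  avoids t (flatten (map lvl lv)).
Proof.
move=> n1 n2; elim: lv => // x lv IH; rewrite avoids_cat IH andbT.
by rewrite /lvl /blk avoids_cons avoids_cells //= n2.
Qed.

Lemma cells_bit bs T i : i < size bs ->
  is_tag Ce true (onth (map cellb bs ++ T) i) = nth false bs i.
Proof. by elim: bs i => [|[] bs IH] [|i] //= li; apply: IH. Qed.

(** A level with bit [true] stands for the second half of a path, whose source is the midpoint, one
    with bit [false] for the first half, whose target it is. Levels are listed innermost first, so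
    the first match is the current endpoint, and [u0] the original one. *)
Fixpoint getu (c : bool) (lv : seq (bool * seq bool)) (u0 : seq bool) : seq bool :=
  if lv is (c', b) :: lv' then if c' == c then b else getu c lv' u0 else u0.

Lemma rec_pos E A T p : avoids R_ A -> avoids R_ T ->
  has_tag R_ (onth (A ++ flatten (map tag_edge E) ++ T) p) ->
  exists E1 e E2, E = E1 ++ e :: E2 /\ p = size A + size (flatten (map tag_edge E1)).
Proof.
elim: E A p => [|e E IH] A p aA aT /=.
  by rewrite avoids_onth // avoids_cat aA.
rewrite onth_cat; case: ltnP => [_|le]; first by rewrite avoids_onth.
case ep : (p - size A) => [|q] /=.
  by move=> _; exists [::], e, E; split=> //=; rewrite -[LHS](subnKC le) ep.
rewrite -catA; case/IH => //.
  by rewrite !avoids_cat !avoids_tnum.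
move=> E1 [e' [E2 [-> eqq]]]; exists (e :: E1), e', E2; split=> //.
by rewrite -[LHS](subnKC le) ep eqq /= !size_cat.
Qed.

Definition vT (u : seq bool) (i : nat) : bool := nth false u (2 * i).
Definition vS (u : seq bool) (i : nat) : bool := nth false u (2 * i).+1.

(** * The graph explored by the recursion *)

Section Vertices.
Variable J : raw.
Definition vclosed (u : seq bool) : Prop :=
  forall x y, (x, 0, y) \in rE J -> vS u x -> vS u y.
Definition vstart (u : seq bool) : Prop :=
  [/\ forall i, i < rn J -> vT u i -> i = rs J, vS u (rs J) & vclosed u].
Definition vbad (u : seq bool) : Prop := forall i, i < rn J -> ~~ vS u i.
(** Standing still makes the relation reflexive, so that every path of at most [2 ^ k] edges also
    counts as one of exactly [2 ^ k]. *)
Definition vstay (u v : seq bool) : Prop :=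
  forall i, i < rn J -> (vT v i -> vT u i) /\ (vS u i -> vS v i).
(** The high side follows a single edge, so at most its target is kept. If the word grows by [a],
    the low set must absorb all [a]-successors and be closed under silent edges; otherwise it only
    has to persist. *)
Definition vmove (u v : seq bool) : Prop := exists x a y,
  [/\ (x, a, y) \in rE J, ~~ ctrl J a, vT u x, forall i, i < rn J -> vT v i -> i = y
    & if silent J a then forall i, i < rn J -> vS u i -> vS v i
      else (forall x' y', (x', a, y') \in rE J -> vS u x' -> vS v y') /\ vclosed v].
Definition vedge u v := vstay u v \/ vmove u v.
End Vertices.

(** The first symbol that satisfies [P] opens the block of the current endpoint: either a level with
    bit [c0], or the block [a0] behind all levels. The part [A0] between them covers the other end
    vertex, which precedes the source in the word. *)
Lemma getu_split (P : pred (option sym)) c0 lv z0 A0 a0 T0 :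
  (forall b, ~~ P (Some (cellb b))) ->
  (forall c, P (Some (inr (Some true, Cl, c))) = (c == c0)) ->
  all (fun b => ~~ P (Some b)) A0 -> P (Some a0) ->
  exists A a T, [/\ flatten (map lvl lv) ++ A0 ++ a0 :: map cellb z0 ++ T0 =
      A ++ a :: map cellb (getu c0 lv z0) ++ T,
    all (fun b => ~~ P (Some b)) A & P (Some a)].
Proof.
move=> nc hc aA pa; elim: lv => [|[c b] lv [A [a [T [e1 e2 e3]]]]].
  by exists A0, a0, T0.
rewrite -[flatten (map lvl (_ :: lv))]/(lvl (c, b) ++ flatten (map lvl lv)) -catA e1.
rewrite -[getu c0 (_ :: lv) z0]/(if c == c0 then b else getu c0 lv z0).
have := hc c; case: eqP => ec pc.
  exists [::], (inr (Some true, Cl, c)), (A ++ a :: map cellb (getu c0 lv z0) ++ T).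
  by split=> //; rewrite /lvl /blk /=.
exists (lvl (c, b) ++ A), a, T; split=> //; first by rewrite -catA.
rewrite all_cat e2 andbT /lvl /blk [all _ _]/= pc /=.
by rewrite all_map; apply/allP => x _; apply: nc.
Qed.

(** * The kernel on a complete assignment *)

Section Leaf.
Variables (J : raw) (lv : seq (bool * seq bool)) (u0 v0 : seq bool) (l : nat).
Hypotheses (sJ : sized J) (nl : rn J <= l).
Hypotheses (slv : forall x, x \in lv -> size x.2 = 2 * l)
  (su0 : size u0 = 2 * l) (sv0 : size v0 = 2 * l).

Definition base : seq sym := blk (fx Bv false) v0 ++ blk (fx Bu false) u0.
(** The word read by the kernel when all bits have been chosen: midpoints from the innermost
    outwards, then the two end vertices, then the instance. *)
Definition leaf : seq sym := flatten (map lvl lv) ++ base ++ tag_raw J.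
Let D := leaf.
Let pre := flatten (map lvl lv) ++ base.
Let E := rE J.

Let tE := flatten (map tag_edge E) ++ [:: fx End_ false].
Let tH := map (fx H_) (rH J) ++ map (fx C_) (rC J) ++ tE.
Let tI := tnum I_ (rs J) ++ fx KH false :: tH.
Let tM := tnum M_ (rm J) ++ fx KI false :: tI.
Let tN := tnum N_ (rn J) ++ fx KM false :: tM.

Lemma leafE : D = pre ++ fx KN false :: tN.
Proof.
rewrite /D /leaf /pre -catA; congr (_ ++ _ ++ _).
by rewrite /tag_raw tag_headE /tN /tM /tI /tH /tE /= -!catA /= -!catA /= -!catA /= -!catA.
Qed.

Ltac av := by rewrite /tN /tM /tI /tH /pre /base /blk
  ?(avoids_cat, avoids_cons) ?avoids_tnum ?avoids_map ?avoids_edges ?avoids_cells ?avoids_lvls.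

Lemma afterKN j : onth D (size pre + j) = onth (fx KN false :: tN) j.
Proof. by rewrite leafE onth_catr. Qed.

Let pM := pre ++ fx KN false :: tnum N_ (rn J).
Lemma DKM : D = pM ++ fx KM false :: tM.
Proof. by rewrite leafE /pM -catA. Qed.

Let pI := pM ++ fx KM false :: tnum M_ (rm J).
Lemma DKI : D = pI ++ fx KI false :: tI.
Proof. by rewrite DKM /pI -catA. Qed.

Let pH := pI ++ fx KI false :: tnum I_ (rs J).
Lemma DKH : D = pH ++ fx KH false :: tH.
Proof. by rewrite DKI /pH -catA. Qed.

Let pE := pH ++ fx KH false :: map (fx H_) (rH J) ++ map (fx C_) (rC J).
Lemma DE : D = pE ++ tE.
Proof. by rewrite DKH /pE -catA /= -catA. Qed.

Lemma sat_after k P c i v A b T : i != 13 -> D = A ++ fx k b :: T ->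
  avoids k A -> avoids k T ->
  sat D v (After k P c i) <-> P (onth (fx k b :: T) (c + v i)).
Proof.
move=> ni eD aA aT; rewrite satEx.
have e h : sat D (updn v 13 h) (And (Sym (has_tag k) (0, [:: 13])) (Sym P (c, [:: 13; i]))) <->
    h = size A /\ P (onth D (h + (c + v i))).
  rewrite satAnd /= /tval /= /updn /= (negPf ni) !addn0 add0n eD.
  by rewrite marker // addnCA.
split=> [[h [_ /e [-> h2]]]|H]; first by move: h2; rewrite eD onth_catr.
exists (size A); split; first by rewrite eD size_cat /=; lia.
by apply/e; split=> //; rewrite eD onth_catr.
Qed.

Lemma sat_InN v i : i != 13 -> sat D v (InN i) <-> v i < rn J.
Proof.
move=> ni; rewrite (sat_after _ _ _ ni leafE); try av.
by rewrite add1n /= tnum_true //; av.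
Qed.

Lemma sat_LeM v i : i != 13 -> sat D v (LeM i) <-> v i <= rm J.
Proof.
move=> ni; rewrite (sat_after _ _ _ ni DKM); try by rewrite /pM; av.
rewrite add0n; case: (v i) => [|k] /=; first by [].
rewrite tnum_true; last by av.
rewrite avoids_onth //; av.
Qed.

Lemma sat_IsS v i : i != 13 -> sat D v (IsS i) <-> v i = rs J.
Proof.
move=> ni; rewrite (sat_after _ _ _ ni DKI); try by rewrite /pI /pM; av.
by rewrite add1n /= tnum_false; [split=> /eqP | av].
Qed.

Lemma sat_Hi v i : i != 13 -> sat D v (Hi i) <-> high J (v i).
Proof.
move=> ni; rewrite (sat_after _ _ _ ni DKH); try by rewrite /pH /pI /pM; av.
rewrite add0n /high; case: (v i) => [|k] //=.
by rewrite map_true //; av.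
Qed.

Lemma sat_Ct v i : i != 13 -> i != 14 -> i != 15 -> sat D v (Ct i) <-> ctrl J (v i).
Proof.
move=> n3 n4 n5; rewrite satEx.
have e1 m : sat D (updn v 15 m) (After KM (is_tag M_ false) 1 15) <-> m = rm J.
  rewrite (sat_after _ _ _ _ DKM) //; try by rewrite /pM; av.
  by rewrite /updn /= tnum_false; [split=> /eqP | av].
have e2 m h : sat D (updn (updn v 15 m) 14 h) (And (Sym (has_tag KH) (0, [:: 14]))
    (Sym (is_tag C_ true) (0, [:: 14; 15; i]))) <->
    h = size pH /\ is_tag C_ true (onth D (h + (m + v i))).
  rewrite satAnd /= /tval /= /updn /= (negPf n4) (negPf n5) !addn0 !add0n DKH.
  by rewrite marker //; rewrite /pH /pI /pM; av.
have e3 : is_tag C_ true (onth D (size pH + (rm J + v i))) = ctrl J (v i).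
  have /andP[/eqP sH _] := sJ.
  rewrite DKH onth_catr /ctrl; case: (v i) => [|k].
    rewrite addn0; case em : (rm J) => [|m] //=; rewrite /tH onth_cat size_map sH em ltnSn.
    by rewrite avoids_is //; av.
  rewrite addnS /= /tH -sH -(size_map (fx H_)) onth_catr map_true //; av.
split=> [[m [_ /satAnd [/e1 -> /satEx [h [_ /e2 [-> ]]]]]]|H]; first by rewrite e3.
have lm : rm J < size D.
  rewrite DKM !size_cat /= /tM !size_cat /tnum !size_rcons !size_nseq; lia.
exists (rm J); split=> //; apply/satAnd; split; first exact/e1.
apply/satEx; exists (size pH); split; last by apply/e2; rewrite e3.
by rewrite DKH (size_cat pH) -[_.+1]addn1 leq_add2l.
Qed.

Definition recat p x a y : Prop := exists E1 E2,
  E = E1 ++ (x, a, y) :: E2 /\ p = size pE + size (flatten (map tag_edge E1)).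

Lemma sat_Blk c vs x t v A n T : x != 12 -> 12 \notin vs ->
  D = A ++ tnum t n ++ T -> c + sumn (map v vs) = size A ->
  sat D v (Blk c vs x t) <-> v x = n.
Proof.
move=> nx nvs eD eA; rewrite -(tnum_blk t n T) satAnd satAll.
have e1 : sat D v (Sym (is_tag t false) (c, x :: vs)) = is_tag t false (onth (tnum t n ++ T) (v x)).
  by rewrite /= /tval /= addnCA addnC eA eD onth_catr.
have e2 z : sat D (updn v 12 z) (Imp (Lt _ (0, [:: 12]) (0, [:: x])) (Sym (is_tag t true) (c, 12 :: vs))) <->
   (z < v x -> is_tag t true (onth (tnum t n ++ T) z)).
  rewrite satImp /= /tval /= /updn /= (negPf nx) !addn0 !add0n.
  have -> : map (fun j => if j == 12 then z else v j) vs = map v vs.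
    by apply/eq_in_map => j jvs; case: eqP => // ej; rewrite -ej jvs in nvs.
  by rewrite addnCA addnC eA eD onth_catr.
rewrite e1; split=> -[h1 h2]; split=> // z; last by move=> lz; apply/e2; apply: h2.
move=> lz; have := lz; apply/e2; apply: h2.
by rewrite eD size_cat; apply: leq_trans (leq_addl _ _); apply: ltn_trans lz (is_tag_size h1).
Qed.

Lemma sat_Rec v p x a y : p != 12 -> x != 12 -> a != 12 -> y != 12 ->
  sat D v (Rec p x a y) <-> recat (v p) (v x) (v a) (v y).
Proof.
move=> np nx na ny; rewrite satAnd.
(* At the position of a given edge each field is located by the values of the preceding ones, so
   [x], [a], [y] are determined one after the other. *)
have key E1 e E2 : E = E1 ++ e :: E2 -> v p = size pE + size (flatten (map tag_edge E1)) ->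
    sat D v (And (Blk 1 [:: p] x X_) (And (Blk 2 [:: p; x] a A_) (Blk 3 [:: p; x; a] y Y_))) <->
    (v x, v a, v y) = e.
  case: e => [[x' a'] y'] eE ep.
  pose A1 := pE ++ flatten (map tag_edge E1).
  have sA1 : size A1 = v p by rewrite size_cat ep.
  have eD : D = A1 ++ fx R_ true :: tnum X_ x' ++ tnum A_ a' ++ tnum Y_ y' ++
      (flatten (map tag_edge E2) ++ [:: fx End_ false]).
    by rewrite DE /tE eE map_cat flatten_cat /= /A1 -!catA /= -!catA.
  have eD1 : D = (A1 ++ [:: fx R_ true]) ++ tnum X_ x' ++ tnum A_ a' ++ tnum Y_ y' ++
      (flatten (map tag_edge E2) ++ [:: fx End_ false]) by rewrite eD -catA.
  have eD2 : D = ((A1 ++ [:: fx R_ true]) ++ tnum X_ x') ++ tnum A_ a' ++ tnum Y_ y' ++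
      (flatten (map tag_edge E2) ++ [:: fx End_ false]) by rewrite eD1 -!catA.
  have eD3 : D = (((A1 ++ [:: fx R_ true]) ++ tnum X_ x') ++ tnum A_ a') ++ tnum Y_ y' ++
      (flatten (map tag_edge E2) ++ [:: fx End_ false]) by rewrite eD1 -!catA.
  have st t n : size (tnum t n) = n.+1 by rewrite size_rcons size_nseq.
  have s1 : size (A1 ++ [:: fx R_ true]) = (v p).+1 by rewrite (size_cat A1) sA1 addn1.
  have s2 : size ((A1 ++ [:: fx R_ true]) ++ tnum X_ x') = (v p).+1 + x'.+1.
    by rewrite (size_cat (A1 ++ _)) s1 st.
  have s3 : size (((A1 ++ [:: fx R_ true]) ++ tnum X_ x') ++ tnum A_ a') =
      (v p).+1 + x'.+1 + a'.+1.
    by rewrite (size_cat ((A1 ++ _) ++ _)) s2 st.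
  rewrite (satAnd _ _ (Blk 1 _ _ _)) (satAnd _ _ (Blk 2 _ _ _)).
  have n1 : 12 \notin [:: p] by rewrite inE eq_sym np.
  rewrite (sat_Blk nx n1 eD1) //; last by rewrite s1 /= addn0 add1n.
  have n2 : 12 \notin [:: p; x] by rewrite !inE negb_or !(eq_sym 12) np nx.
  have n3 : 12 \notin [:: p; x; a] by rewrite !inE !negb_or !(eq_sym 12) np nx.
  have b2 (ex : v x = x') : sat D v (Blk 2 [:: p; x] a A_) <-> v a = a'.
    by apply: (sat_Blk na n2 eD2); rewrite s2 /= ex; lia.
  have b3 (ex : v x = x') (ea : v a = a') : sat D v (Blk 3 [:: p; x; a] y Y_) <-> v y = y'.
    by apply: (sat_Blk ny n3 eD3); rewrite s3 /= ex ea; lia.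
  split=> [[ex [/(b2 ex) ea /(b3 ex ea) ey]]|[ex ea ey]]; first by rewrite ex ea ey.
  by split=> //; split; [apply/(b2 ex) | apply/(b3 ex ea)].
have ap : avoids R_ pE by rewrite /pE /pH /pI /pM; av.
split=> [[h hb]|[E1 [E2 [eE ep]]]].
  rewrite /= /tval /= addn0 add0n DE /tE in h.
  have [E1 [e [E2 [eE ep]]]] := rec_pos ap (T := [:: fx End_ false]) isT h.
  by move/(key _ _ _ eE ep): hb => ee; exists E1, E2; rewrite ee.
split; last by apply/(key _ _ _ eE ep).
rewrite /= /tval /= addn0 add0n ep DE onth_catr /tE eE map_cat flatten_cat -catA.
by rewrite -[size _]addn0 onth_catr.
Qed.

Lemma recat_in p x a y : recat p x a y -> (x, a, y) \in E.
Proof. by case=> E1 [E2 [-> _]]; rewrite mem_cat inE eqxx orbT. Qed.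

(** All numbers are in unary, so the components of an edge are smaller than the length of the word.
    This is why quantifiers over positions can range over states and labels. *)
Lemma in_recat x a y : (x, a, y) \in E -> exists p,
  [/\ recat p x a y, p < size D, x < size D, a < size D & y < size D].
Proof.
move=> e; have [E1 [E2 eE]] : exists E1 E2, E = E1 ++ (x, a, y) :: E2.
  by exists (take (index (x, a, y) E) E), (drop (index (x, a, y) E).+1 E);
     rewrite -drop_index // ?cat_take_drop // -[in RHS](nth_index (x,a,y) e) -drop_nth ?index_mem ?cat_take_drop.
exists (size pE + size (flatten (map tag_edge E1))).
have : size D = size pE + size (flatten (map tag_edge E1)) +
   (size (tag_edge (x, a, y)) + size (flatten (map tag_edge E2)) + 1).
  rewrite DE (size_cat pE) /tE eE map_cat flatten_cat; move: (size pE) => sp.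
  rewrite -catA size_cat -!addnA; congr (_ + (_ + _)).
  rewrite -[flatten (map _ (_ :: _))]/(tag_edge (x, a, y) ++ flatten (map tag_edge E2)).
  by rewrite -catA (size_cat (tag_edge _)) (size_cat (flatten _)).
have -> : size (tag_edge (x, a, y)) = x + a + y + 4.
  by rewrite /= !size_cat !size_rcons !size_nseq; lia.
by split; try lia; exists E1, E2.
Qed.

Definition blockat (r : nat) (bs : seq bool) : Prop :=
  size bs = 2 * l /\ exists A a T, D = A ++ a :: map cellb bs ++ T /\ r = size A.

Lemma sat_Tf v r i bs : blockat (v r) bs -> v i < rn J ->
  sat D v (Tf r i) = vT bs (v i).
Proof.
move=> [sb [A [a [T [eD er]]]]] li.
rewrite -[LHS]/(is_tag Ce true (onth D (tval v (1, [:: r; i; i])))).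
have -> : tval v (1, [:: r; i; i]) = v r + (2 * v i).+1 by rewrite /tval /=; lia.
rewrite er eD onth_catr /vT; apply: cells_bit; lia.
Qed.

Lemma sat_Sf v r i bs : blockat (v r) bs -> v i < rn J ->
  sat D v (Sf r i) = vS bs (v i).
Proof.
move=> [sb [A [a [T [eD er]]]]] li.
rewrite -[LHS]/(is_tag Ce true (onth D (tval v (2, [:: r; i; i])))).
have -> : tval v (2, [:: r; i; i]) = v r + (2 * v i).+2 by rewrite /tval /=; lia.
have h : (2 * v i).+1 < size bs by lia.
by rewrite er eD onth_catr /vS -(cells_bit T h).
Qed.

Lemma sat_Eqv v i j : sat D v (Eqv i j) <-> v i = v j.
Proof. by rewrite /= /tval /= !addn0 !add0n; split; lia. Qed.

Lemma sat_Zero v i : sat D v (Zero i) <-> v i = 0.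
Proof. by rewrite /= /tval /= !addn0 !add0n; split; lia. Qed.

Lemma imp_Eqv v F i j : sat D v (Imp F (Eqv i j)) -> sat D v F -> v i = v j.
Proof. by move=> /satImp h /h /sat_Eqv. Qed.

Lemma imp_IsS v F i : i != 13 -> sat D v (Imp F (IsS i)) -> sat D v F -> v i = rs J.
Proof. by move=> ni /satImp h /h /sat_IsS; apply. Qed.

Lemma ltn_D i : i < rn J -> i < size D.
Proof.
move=> li; have : is_tag N_ true (onth D (size pre + i.+1)).
  by rewrite afterKN /= tnum_true //; av.
by move/is_tag_size; lia.
Qed.

Lemma sat_StartOk v : sat D v StartOk <-> rs J < rn J.
Proof.
rewrite satEx; split=> [[k [_ /satAnd [/sat_IsS ek /sat_InN lk]]]|ls].
  by have <- := ek isT; apply: lk.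
exists (rs J); split; first exact: ltn_D.
by apply/satAnd; split; [apply/sat_IsS | apply/sat_InN].
Qed.

Lemma sat_EdgesOk v : sat D v EdgesOk <-> all (edge_ok (rn J) (rm J)) E.
Proof.
split=> [/satAll H|H].
  apply/allP => -[[x a] y] /in_recat [p [rp lp lx la ly]].
  have /satAll/(_ x lx)/satAll/(_ a la)/satAll/(_ y ly)/satImp := H p lp.
  case/(_ _)/satAnd; first exact/sat_Rec.
  move=> /sat_InN h1 /satAnd [/sat_LeM h2 /sat_InN h3].
  by apply/and3P; split; [apply: h1 | apply: h2 | apply: h3].
apply/satAll => p _; apply/satAll => x _; apply/satAll => a _; apply/satAll => y _.
apply/satImp => /sat_Rec rp; have /recat_in/(allP H)/and3P[h1 h2 h3] := rp isT isT isT isT.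
by apply/satAnd; split; [apply/sat_InN | apply/satAnd; split; [apply/sat_LeM | apply/sat_InN]].
Qed.

Lemma sat_Det v : sat D v Det <-> lowdet J.
Proof.
split=> [/satAll H x a y y'|H].
  move=> /in_recat [p [rp lp lx la ly]] /in_recat [p' [rp' lp' _ _ ly']] nh.
  have /satAll/(_ x lx)/satAll/(_ a la)/satAll/(_ y ly)/satAll/(_ p' lp')/satAll/(_ y' ly')/imp_Eqv := H p lp.
  apply; apply/satAnd; split; first exact/sat_Rec.
  apply/satAnd; split; first exact/sat_Rec.
  by apply/satNot => /sat_Hi h; move/negP: nh; apply; apply: h.
apply/satAll => p _; apply/satAll => x _; apply/satAll => a _; apply/satAll => y _.
apply/satAll => p' _; apply/satAll => y' _.
apply/satImp => /satAnd [/sat_Rec r1 /satAnd [/sat_Rec r2 /satNot nh]]; apply/sat_Eqv.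
apply: (H x a); first by apply: recat_in (r1 isT isT isT isT).
  by apply: recat_in (r2 isT isT isT isT).
by apply/negP => h; apply: nh; apply/sat_Hi.
Qed.

Hypotheses (wE : all (edge_ok (rn J) (rm J)) E) (ws : rs J < rn J).

Lemma edge_lt x a y : (x, a, y) \in E -> x < rn J /\ y < rn J.
Proof. by move/(allP wE) => /and3P[]. Qed.

(** The variables that [BadPath] uses for addresses of blocks. None of them is bound again inside,
    so their values survive every [updn] below. *)
Definition blockvar (r : nat) : bool := [|| r == 8, r == 9, r == 10 | r == 11].

Lemma sat_Closed v r bs : blockvar r -> blockat (v r) bs ->
  sat D v (Closed r) <-> vclosed J bs.
Proof.
move=> br hb; split=> [/satAll H x y e Sx|H].
  have [lx ly] := edge_lt e; have [p [rp lp lx' la ly']] := in_recat e.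
  have /satAll/(_ x lx')/satAll/(_ 0 la)/satAll/(_ y ly')/satImp := H p lp.
  set v' := updn _ 21 y; have er : v' r = v r by case/or4P: br => /eqP ->.
  rewrite -[vS bs y]/(vS bs (v' 21)) -(@sat_Sf v' r) ?er //; apply.
  apply/satAnd; split; first exact/sat_Rec.
  by apply/satAnd; split; [apply/sat_Zero | rewrite (@sat_Sf _ _ _ bs) ?er].
apply/satAll => p _; apply/satAll => x _; apply/satAll => a _; apply/satAll => y _.
set v' := updn _ 21 y; have er : v' r = v r by case/or4P: br => /eqP ->.
apply/satImp => /satAnd [/sat_Rec r1 /satAnd [/sat_Zero z]].
have /recat_in e := r1 isT isT isT isT; have [lx ly] := edge_lt e.
rewrite !(@sat_Sf _ _ _ bs) ?er //; apply: H.
by move: e; rewrite z.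
Qed.

Lemma sat_Start v r bs : blockvar r -> blockat (v r) bs ->
  sat D v (Start r) <-> vstart J bs.
Proof.
move=> br hb; rewrite satAnd (satAnd _ _ (All 17 _)) (sat_Closed br hb).
have e7 k : updn v 7 k r = v r by case/or4P: br => /eqP ->.
have e17 k : updn v 17 k r = v r by case/or4P: br => /eqP ->.
split=> [[/satAll h1 [/satAll h2 h3]]|[h1 h2 h3]].
  split=> // [i li Ti|].
    have /imp_IsS := h1 i (ltn_D li); apply=> //.
    by apply/satAnd; split; [apply/sat_InN | rewrite (@sat_Tf _ _ _ bs) ?e7].
  have /satImp := h2 _ (ltn_D ws); rewrite (@sat_Sf _ _ _ bs) ?e17 //; apply.
  exact/sat_IsS.
split; last split=> //.
  apply/satAll => i _; apply/satImp => /satAnd [/sat_InN li].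
  have {}li := li isT; rewrite (@sat_Tf _ _ _ bs) ?e7 // => Ti.
  by apply/sat_IsS => //; apply: h1.
apply/satAll => i _; apply/satImp => /sat_IsS ei; have {}ei : i = rs J by exact: ei.
by rewrite (@sat_Sf _ _ _ bs) ?e17 //= ei.
Qed.

Lemma sat_Bad v r bs : blockvar r -> blockat (v r) bs -> sat D v (Bad r) <-> vbad J bs.
Proof.
move=> br hb; have e7 k : updn v 7 k r = v r by case/or4P: br => /eqP ->.
split=> [/satAll H i li|H].
  have hi : sat D (updn v 7 i) (InN 7) by exact/sat_InN.
  have /satImp/(_ hi)/satNot h := H i (ltn_D li).
  move: h => h; by apply/negP => hh; apply: h; rewrite (@sat_Sf _ _ _ bs) ?e7.
apply/satAll => i _; apply/satImp => /sat_InN li; have {}li := li isT.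
by apply/satNot; rewrite (@sat_Sf _ _ _ bs) ?e7 //; apply/negP; apply: H.
Qed.

Lemma sat_Stay v r r' bs bs' : blockvar r -> blockvar r' -> blockat (v r) bs ->
  blockat (v r') bs' -> sat D v (Steady r r') <-> vstay J bs bs'.
Proof.
move=> br br' hb hb'; have e7 k : updn v 7 k r = v r by case/or4P: br => /eqP ->.
have e7' k : updn v 7 k r' = v r' by case/or4P: br' => /eqP ->.
have B i : i < rn J -> sat D (updn v 7 i) (And (Imp (Tf r' 7) (Tf r 7)) (Imp (Sf r 7) (Sf r' 7))) <->
    (vT bs' i -> vT bs i) /\ (vS bs i -> vS bs' i).
  move=> li; rewrite satAnd !satImp (@sat_Tf _ r _ bs) ?e7 // (@sat_Tf _ r' _ bs') ?e7' //.
  by rewrite (@sat_Sf _ r _ bs) ?e7 // (@sat_Sf _ r' _ bs') ?e7'.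
split=> [/satAll H i li|H].
  by apply/B => //; have /satImp := H i (ltn_D li); apply; apply/sat_InN.
apply/satAll => i _; apply/satImp => /sat_InN li; have {}li := li isT.
by apply/B => //; apply: H.
Qed.

Lemma sat_Move v r r' bs bs' : blockvar r -> blockvar r' -> blockat (v r) bs ->
  blockat (v r') bs' -> sat D v (MoveTo r r') <-> vmove J bs bs'.
Proof.
move=> br br' hb hb'.
pose w p x a y := updn (updn (updn (updn v 0 p) 1 x) 2 a) 3 y.
have er p x a y : w p x a y r = v r by case/or4P: br => /eqP ->.
have er' p x a y : w p x a y r' = v r' by case/or4P: br' => /eqP ->.
have e7 p x a y k : updn (w p x a y) 7 k r = v r by case/or4P: br => /eqP ->.
have e7' p x a y k : updn (w p x a y) 7 k r' = v r' by case/or4P: br' => /eqP ->.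
have sil p x a y : sat D (w p x a y) (Or (Zero 2) (Hi 2)) <-> silent J a.
  rewrite satOr sat_Zero sat_Hi // -[w p x a y 2]/a /silent.
  by split=> [[->|->]|/orP[/eqP ->|->]]; rewrite ?orbT; [| |left|right].
have incl p x a y : x < rn J -> y < rn J -> sat D (w p x a y) (All 7 (Imp (InN 7) (Imp (Sf r 7) (Sf r' 7)))) <->
    forall i, i < rn J -> vS bs i -> vS bs' i.
  move=> _ _; split=> [/satAll H i li|H].
    have hi : sat D (updn (w p x a y) 7 i) (InN 7) by exact/sat_InN.
    have /satImp/(_ hi)/satImp := H i (ltn_D li).
    by rewrite (@sat_Sf _ r _ bs) ?e7 // (@sat_Sf _ r' _ bs') ?e7'.
  apply/satAll => i _; apply/satImp => /sat_InN li; have {}li := li isT.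
  by apply/satImp; rewrite (@sat_Sf _ r _ bs) ?e7 // (@sat_Sf _ r' _ bs') ?e7' //; apply: H.
have uniq_ p x a y : sat D (w p x a y) (All 7 (Imp (And (InN 7) (Tf r' 7)) (Eqv 7 3))) <->
    forall i, i < rn J -> vT bs' i -> i = y.
  split=> [/satAll H i li Ti|H].
    have /imp_Eqv := H i (ltn_D li); apply.
    by apply/satAnd; split; [apply/sat_InN | rewrite (@sat_Tf _ r' _ bs') ?e7'].
  apply/satAll => i _; apply/satImp => /satAnd [/sat_InN li]; have {}li := li isT.
  by rewrite (@sat_Tf _ r' _ bs') ?e7' // => Ti; apply/sat_Eqv; apply: H.
have post p x a y : sat D (w p x a y) (All 4 (All 5 (All 6 (Imp (And (Rec 4 5 2 6) (Sf r 5)) (Sf r' 6))))) <->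
    forall x' y', (x', a, y') \in E -> vS bs x' -> vS bs' y'.
  have g p' x' y' : updn (updn (updn (w p x a y) 4 p') 5 x') 6 y' r = v r by case/or4P: br => /eqP ->.
  have g' p' x' y' : updn (updn (updn (w p x a y) 4 p') 5 x') 6 y' r' = v r' by case/or4P: br' => /eqP ->.
  split=> [/satAll H x' y' e Sx|H].
    have [lx ly] := edge_lt e; have [p' [rp lp lx' la ly']] := in_recat e.
    have /satAll/(_ x' lx')/satAll/(_ y' ly')/satImp := H p' lp.
    rewrite (@sat_Sf _ r' _ bs') ?g' //; apply; apply/satAnd; split; first exact/sat_Rec.
    by rewrite (@sat_Sf _ r _ bs) ?g.
  apply/satAll => p' _; apply/satAll => x' _; apply/satAll => y' _.
  apply/satImp => /satAnd [/sat_Rec r1]; have /recat_in e := r1 isT isT isT isT.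
  have [lx ly] := edge_lt e; rewrite (@sat_Sf _ r _ bs) ?g // (@sat_Sf _ r' _ bs') ?g' //.
  exact: H.
have body p x a y : recat p x a y ->
  sat D (w p x a y) (And (Not (Ct 2)) (And (Tf r 1)
  (And (All 7 (Imp (And (InN 7) (Tf r' 7)) (Eqv 7 3)))
  (Or (And (Or (Zero 2) (Hi 2)) (All 7 (Imp (InN 7) (Imp (Sf r 7) (Sf r' 7)))))
      (And (Not (Or (Zero 2) (Hi 2)))
        (And (All 4 (All 5 (All 6 (Imp (And (Rec 4 5 2 6) (Sf r 5)) (Sf r' 6)))))
             (Closed r'))))))) <->
  [/\ ~~ ctrl J a, vT bs x, forall i, i < rn J -> vT bs' i -> i = y
    & if silent J a then forall i, i < rn J -> vS bs i -> vS bs' i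
      else (forall x' y', (x', a, y') \in E -> vS bs x' -> vS bs' y') /\ vclosed J bs'].
  move=> /recat_in/edge_lt [lx ly].
  rewrite (satAnd _ _ (Not (Ct 2))) (satAnd _ _ (Tf r 1)) (satAnd _ _ (All 7 _)).
  rewrite uniq_ satOr (satAnd _ _ (Or (Zero 2) (Hi 2))) (satAnd _ _ (Not (Or _ _))).
  rewrite (satNot _ _ (Or _ _)) sil incl // (satAnd _ _ (All 4 _)) post.
  rewrite (@sat_Closed _ r' bs') ?er' // satNot sat_Ct // (@sat_Tf _ r _ bs) ?er //.
  rewrite -[w p x a y 2]/a -[w p x a y 1]/x.
  split=> [[nc [h1 [h2 h3]]]|[nc h1 h2 h3]].
    by split=> //; [exact/negP | case: h3 => [[-> h]|[/negP/negPf -> h]]].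
  split; first exact/negP.
  by do 2 split=> //; case: (silent J a) h3 => h; [left|right].
split.
  case/satEx => p [_ /satEx [x [_ /satEx [a [_ /satEx [y [_]]]]]]].
  rewrite -/(w p x a y) => /satAnd [/sat_Rec r1 B].
  have {}r1 : recat p x a y by exact: r1.
  by have [h1 h2 h3 h4] := (body p x a y r1).1 B; exists x, a, y; split=> //; apply: recat_in r1.
case=> x [a [y [e h1 h2 h3 h4]]]; have [p [rp lp lx la ly]] := in_recat e.
apply/satEx; exists p; split=> //; apply/satEx; exists x; split=> //.
apply/satEx; exists a; split=> //; apply/satEx; exists y; split=> //.
by apply/satAnd; split; [apply/sat_Rec | apply/(body p x a y rp)].
Qed.

Lemma sat_First P v r A a T : r != 16 -> D = A ++ a :: T ->
  all (fun b => ~~ P (Some b)) A -> P (Some a) ->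
  sat D v (First P r) <-> v r = size A.
Proof.
move=> nr eD aA pa.
have oA z : z < size A -> exists2 b, onth D z = Some b & ~~ P (Some b).
  move=> lz; rewrite eD onth_cat lz; exists (nth a A z).
    by rewrite onthE (nth_map a).
  by apply: (allP aA); apply: mem_nth.
have oa : onth D (size A) = Some a by rewrite eD -[size A]addn0 onth_catr.
rewrite satAnd satAll; split=> [[h1 h2]|e].
  rewrite /= /tval /= addn0 add0n in h1.
  case: (ltngtP (v r) (size A)) => // lt.
    by have [b eb nb] := oA _ lt; rewrite eb (negPf nb) in h1.
  have lA : size A < size D by rewrite eD size_cat -[_.+1]addn1 leq_add2l.
  have /satImp := h2 _ lA; rewrite /= /tval /= /updn /= (negPf nr) !addn0 !add0n oa pa.
  by move/(_ lt).
split; first by rewrite /= /tval /= addn0 add0n e oa.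
move=> z _; apply/satImp; rewrite /= /tval /= /updn /= (negPf nr) !addn0 !add0n e => lz.
by have [b -> nb] := oA _ lz.
Qed.

Lemma getu_size c z : size z = 2 * l -> size (getu c lv z) = 2 * l.
Proof.
move=> sz; move: slv; elim: lv => //= -[c' b] lv' IH H; case: eqP => _.
  exact: (H (c', b) (mem_head _ _)).
by apply: IH => x xl; apply: H; rewrite inE xl orbT.
Qed.

Lemma sat_BadPath v : sat D v BadPath <->
  [/\ vstart J u0, vbad J v0 & vedge J (getu true lv u0) (getu false lv v0)].
Proof.
have [Au [au [Tu [eU aU pU]]]] := @getu_split isU true lv u0
  (blk (fx Bv false) v0) (fx Bu false) (tag_raw J) ltac:(by []) ltac:(by case)
  ltac:(by rewrite /= all_map; apply/allP) isT.
have [Av [av_ [Tv [eV aV pV]]]] := @getu_split isV false lv v0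
  [::] (fx Bv false) (blk (fx Bu false) u0 ++ tag_raw J) ltac:(by []) ltac:(by case)
  isT isT.
have eDU : D = Au ++ au :: map cellb (getu true lv u0) ++ Tu by rewrite -eU /D /leaf /base -catA.
have eDV : D = Av ++ av_ :: map cellb (getu false lv v0) ++ Tv by rewrite -eV /D /leaf /base -catA.
have eBu : D = (flatten (map lvl lv) ++ blk (fx Bv false) v0) ++ fx Bu false :: map cellb u0 ++ tag_raw J.
  by rewrite /D /leaf /base -!catA.
have eBv : D = flatten (map lvl lv) ++ fx Bv false :: map cellb v0 ++ blk (fx Bu false) u0 ++ tag_raw J.
  by rewrite /D /leaf /base -!catA.
have aT t : ~~ has_tag t (Some (fx KN false)) -> avoids t tN -> avoids t (tag_raw J).
  move=> n1 n2; have : avoids t (fx KN false :: tN) by rewrite avoids_cons n1.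
  have : pre ++ tag_raw J = pre ++ fx KN false :: tN by rewrite -leafE /D /leaf /pre -catA.
  by move/eqP; rewrite eqseq_cat // eqxx => /eqP ->.
have pBu h : has_tag Bu (onth D h) <-> h = size (flatten (map lvl lv) ++ blk (fx Bv false) v0).
  rewrite eBu; apply: marker; first av.
  by rewrite avoids_cat avoids_cells // aT //; av.
have pBv h : has_tag Bv (onth D h) <-> h = size (flatten (map lvl lv)).
  rewrite eBv; apply: marker; first av.
  rewrite avoids_cat avoids_cells // (avoids_cat _ (blk _ _)) /blk avoids_cons avoids_cells //.
  by rewrite aT //; av.
pose w a b c d := updn (updn (updn (updn v 8 a) 9 b) 10 c) 11 d.
have key a b c d : sat D (w a b c d) (And (First isU 8) (And (First isV 9)
    (And (Sym (has_tag Bu) (0, [:: 10])) (And (Sym (has_tag Bv) (0, [:: 11]))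
    (And (Start 10) (And (Bad 11) (Or (Steady 8 9) (MoveTo 8 9)))))))) <->
  [/\ a = size Au, b = size Av, c = size (flatten (map lvl lv) ++ blk (fx Bv false) v0),
      d = size (flatten (map lvl lv)) &
  [/\ vstart J u0, vbad J v0 & vedge J (getu true lv u0) (getu false lv v0)]].
  rewrite (satAnd _ _ (First isU 8)) (satAnd _ _ (First isV 9)) (satAnd _ _ (Sym (has_tag Bu) _)).
  rewrite (satAnd _ _ (Sym (has_tag Bv) _)) (sat_First _ _ eDU) // (sat_First _ _ eDV) //.
  have -> : sat D (w a b c d) (Sym (has_tag Bu) (0, [:: 10])) <-> c = size (flatten (map lvl lv) ++ blk (fx Bv false) v0).
    by rewrite -pBu /= /tval /= addn0 add0n.
  have -> : sat D (w a b c d) (Sym (has_tag Bv) (0, [:: 11])) <-> d = size (flatten (map lvl lv)).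
    by rewrite -pBv /= /tval /= addn0 add0n.
  have tl : a = size Au -> b = size Av -> c = size (flatten (map lvl lv) ++ blk (fx Bv false) v0) ->
      d = size (flatten (map lvl lv)) ->
      sat D (w a b c d) (And (Start 10) (And (Bad 11) (Or (Steady 8 9) (MoveTo 8 9)))) <->
      [/\ vstart J u0, vbad J v0 & vedge J (getu true lv u0) (getu false lv v0)].
    move=> ea eb ec ed.
    have b8 : blockat (w a b c d 8) (getu true lv u0).
      by split; [apply: getu_size | exists Au, au, Tu].
    have b9 : blockat (w a b c d 9) (getu false lv v0).
      by split; [apply: getu_size | exists Av, av_, Tv].
    have b10 : blockat (w a b c d 10) u0 by split=> //; do 3 eexists; split; first exact: eBu.
    have b11 : blockat (w a b c d 11) v0 by split=> //; do 3 eexists; split; first exact: eBv.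
    rewrite (satAnd _ _ (Start 10)) (satAnd _ _ (Bad 11)) (sat_Start _ b10) // (sat_Bad _ b11) //.
    rewrite satOr (sat_Stay _ _ b8 b9) // (sat_Move _ _ b8 b9) //.
    by rewrite /vedge; split=> [[? []]|[]].
  split=> [[ea [eb [ec [ed h]]]]|[ea eb ec ed h]].
    by split=> //; apply/tl.
  by do 4 split=> //; apply/tl.
split.
  by case/satEx => a [_ /satEx [b [_ /satEx [c [_ /satEx [d [_ /key []]]]]]]].
move=> h; apply/satEx; exists (size Au); split.
  by rewrite eDU size_cat -[_.+1]addn1 leq_add2l.
apply/satEx; exists (size Av); split.
  by rewrite eDV size_cat -[_.+1]addn1 leq_add2l.
apply/satEx; exists (size (flatten (map lvl lv) ++ blk (fx Bv false) v0)); split.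
  by rewrite eBu (size_cat (_ ++ _)) -[_.+1]addn1 leq_add2l.
apply/satEx; exists (size (flatten (map lvl lv))); split.
  by rewrite eBv (size_cat (flatten _)) -[_.+1]addn1 leq_add2l.
by apply/key.
Qed.

End Leaf.

Definition static (J : raw) : Prop :=
  [/\ rs J < rn J, all (edge_ok (rn J) (rm J)) (rE J) & lowdet J].

Lemma sat_Kern J lv u0 v0 l : sized J -> rn J <= l ->
  (forall x, x \in lv -> size x.2 = 2 * l) -> size u0 = 2 * l -> size v0 = 2 * l ->
  sat (leaf J lv u0 v0) (fun=> 0) Kern <-> static J /\
  ~ [/\ vstart J u0, vbad J v0 & vedge J (getu true lv u0) (getu false lv v0)].
Proof.
move=> sJ nl slv su sv.
have ne : sat (leaf J lv u0 v0) (fun=> 0) NoErr.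
  apply/satNot => /satEx [k [_]]; rewrite /= avoids_onth // leafE.
  by rewrite /base /blk ?(avoids_cat, avoids_cons) ?avoids_tnum ?avoids_map ?avoids_edges ?avoids_cells ?avoids_lvls.
split.
  move=> /satAnd [_ /satAnd [/sat_StartOk h1 /satAnd [/sat_EdgesOk h2 /satAnd [/sat_Det h3 /satNot h4]]]].
  have {}h1 := h1 l sJ nl su sv; have {}h2 := h2 l sJ nl su sv.
  have {}h3 := h3 l sJ nl su sv.
  by split=> // h; apply: h4; apply/(sat_BadPath sJ nl slv).
move=> [[h1 h2 h3] h4]; apply/satAnd; split=> //; apply/satAnd; split; first exact/(@sat_StartOk J lv u0 v0 l sJ nl su sv).
apply/satAnd; split; first exact/(@sat_EdgesOk J lv u0 v0 l sJ nl su sv).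
apply/satAnd; split; first exact/(@sat_Det J lv u0 v0 l sJ nl su sv).
by apply/satNot => /(sat_BadPath sJ nl slv su sv h2 h1).
Qed.

(** * Savitch recursion and membership in PSPACE *)

(** Reachability and the edges of the graph are propositions; excluded middle turns them into the
    Booleans that bit strings and [connect] require. *)
Definition asb (P : Prop) : bool := if excluded_middle_informative P then true else false.
Lemma asbP P : asb P <-> P.
Proof. by rewrite /asb; case: excluded_middle_informative. Qed.

Section Savitch.
Variables (J : raw) (l : nat).

Fixpoint sreach (k : nat) (u v : seq bool) : Prop :=
  if k is k'.+1 then exists m, [/\ size m = 2 * l, sreach k' u m & sreach k' m v]
  else vedge J u v.

Lemma sreach_path k (u : (2 * l).-tuple bool) p :
  path (fun a b : (2 * l).-tuple bool => asb (vedge J a b)) u p ->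
  size p <= 2 ^ k -> sreach k u (last u p).
Proof.
elim: k u p => [|k IH] u p.
  case: p => [|x [|y p]] //=; first by left.
  by rewrite andbT => /asbP.
move=> pp sp; have := pp; rewrite -{1}(cat_take_drop (2 ^ k) p) cat_path => /andP[p1 p2].
exists (last u (take (2 ^ k) p)); split; first exact: size_tuple.
  by apply: IH => //; rewrite size_take; case: ltnP => //; rewrite expnS in sp; lia.
rewrite -{2}(cat_take_drop (2 ^ k) p) last_cat; apply: IH => //.
by rewrite size_drop expnS in sp *; lia.
Qed.

(** A path without repetition visits at most [2 ^ (2 * l)] vertices, so [2 * l] halvings are
    enough. *)
Lemma sreach_connect (u v : (2 * l).-tuple bool) :
  connect (fun a b : (2 * l).-tuple bool => asb (vedge J a b)) u v ->
  sreach (2 * l) u v.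
Proof.
case/connectP => p pp ->; case/shortenP: pp => p' pp' up' _.
apply: sreach_path => //.
have := max_card (mem (u :: p')); rewrite (card_uniqP up') card_tuple card_bool /=.
exact: ltnW.
Qed.

Hypotheses (ws : rs J < rn J) (wE : all (edge_ok (rn J) (rm J)) (rE J)) (nl : rn J <= l).

Lemma lreach_lt w q : lreach J w q -> q < rn J.
Proof.
by case=> // w' q' a q'' _ e _ _; have /and3P[] := allP wE _ e.
Qed.

(** The first set may shrink and the second may grow, so along a path they only bound the states
    reached on [w] from below and from above. That [w] is read at all is recorded separately, since
    the first set may have become empty. At a bad vertex no low state is left for [w]. *)
Definition vinv (u : seq bool) : Prop := exists w,
  [/\ exists q, hreach J w q, forall q, q < rn J -> vT u q -> hreach J w q
    & forall q, lreach J w q -> vS u q].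

Lemma vinv_start u : vstart J u -> vinv u.
Proof.
case=> h1 h2 h3; exists [::]; split.
- by exists (rs J); constructor.
- by move=> q lq /(h1 _ lq) ->; constructor.
- have H w q : lreach J w q -> w = [::] -> vS u q.
    elim=> // {}w {}q a q' _ IH e _ _; case: eqP => [ea|_]; last by case: w IH.
    by move/IH; apply: h3; rewrite -ea.
  by move=> q /H; apply.
Qed.

Lemma vinv_edge u v : vinv u -> vedge J u v -> vinv v.
Proof.
move=> [w [[q0 hq0] hT hS]] [st|[x [a [y [e nc Tx Ty cond]]]]].
  exists w; split; first by exists q0.
    by move=> q lq Tq; apply: hT => //; apply: (st q lq).1.
  by move=> q lr; apply: (st q (lreach_lt lr)).2; apply: hS.
have /and3P[lx _ ly] := allP wE _ e.
have hy := hreachS (hT x lx Tx) e nc.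
exists (if silent J a then w else rcons w a); split; first by exists y.
  by move=> q lq /(Ty _ lq) ->.
case: (silent J a) cond => [cond q lr|[c1 c2]].
  by apply: cond; [apply: lreach_lt lr | apply: hS].
have H w' q : lreach J w' q -> w' = rcons w a -> vS v q.
  elim=> [|{}w' {}q b q' lr IH e' _ _]; first by case: (w).
  case: eqP => [eb /IH|_ /rcons_inj [ew ea]].
    by apply: c2; rewrite -eb.
  by subst; apply: (c1 q) => //; apply: hS.
by move=> q /H; apply.
Qed.

Lemma vinv_sreach k u v : vinv u -> sreach k u v -> vinv v.
Proof.
elim: k u v => [|k IH] u v; first exact: vinv_edge.
by move=> iu [m [_ /(IH _ _ iu) im /(IH _ _ im)]].
Qed.

Definition mkbits (P R : nat -> bool) : seq bool :=
  flatten [seq [:: P i; R i] | i <- iota 0 l].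

Lemma size_mkbits P R : size (mkbits P R) = 2 * l.
Proof.
rewrite /mkbits.
suff H n k : size (flatten [seq [:: P i; R i] | i <- iota n k]) = 2 * k by [].
elim: k n => // k IH n.
by rewrite -[size _]/(size (flatten [seq [:: P i; R i] | i <- iota n.+1 k])).+2 IH; lia.
Qed.

Lemma nth_mkbits P R i : i < l -> vT (mkbits P R) i = P i /\ vS (mkbits P R) i = R i.
Proof.
rewrite /vT /vS /mkbits.
suff H n k : i < k -> nth false (flatten [seq [:: P i; R i] | i <- iota n k]) (2 * i) = P (n + i)
   /\ nth false (flatten [seq [:: P i; R i] | i <- iota n k]) (2 * i).+1 = R (n + i).
  by move/H => /(_ 0).
elim: k n i => [|k IH] n [|i] // li; first by rewrite addn0.
by rewrite mulnS /= addnS -addSn; apply: IH.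
Qed.

(** For completeness exact vertices suffice: the one state that the run has reached, and precisely
    the low states reached on [w]. *)
Definition vtx w q : seq bool :=
  mkbits (fun i => i == q) (fun i => asb (lreach J w i)).

Lemma vtxT w q i : i < rn J -> vT (vtx w q) i = (i == q).
Proof. by move=> li; have [->] := nth_mkbits (fun i => i == q) (fun i => asb (lreach J w i)) (leq_trans li nl). Qed.

Lemma vtxS w q i : i < rn J -> vS (vtx w q) i <-> lreach J w i.
Proof.
move=> li; have [_ e] := nth_mkbits (fun i => i == q) (fun i => asb (lreach J w i)) (leq_trans li nl).
by rewrite /vtx e asbP.
Qed.

Lemma vtx_closed w q : vclosed J (vtx w q).
Proof.
move=> x y e; have /and3P[/= lx _ ly] := allP wE _ e; move/(vtxS _ _ lx) => lr.
apply/(vtxS _ _ ly); exact: (lreachS lr e).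
Qed.

Definition vtup w q : (2 * l).-tuple bool := tcast (size_mkbits _ _) (in_tuple (vtx w q)).

Lemma vtupE w q : vtup w q = vtx w q :> seq bool.
Proof. by rewrite /vtup val_tcast. Qed.

Lemma hreach_connect w q : hreach J w q ->
  connect (fun a b : (2 * l).-tuple bool => asb (vedge J a b)) (vtup [::] (rs J)) (vtup w q).
Proof.
elim=> [|{}w {}q a q' hr IH e nc]; first exact: connect0.
apply: connect_trans IH (connect1 _); apply/asbP; rewrite !vtupE.
have /and3P[/= lx _ ly] := allP wE _ e.
right; exists q, a, q'; split=> //.
- by rewrite vtxT.
- by move=> i li; rewrite vtxT // => /eqP.
case sa : (silent J a).
  by move=> i li /(vtxS _ _ li) h; apply/(vtxS _ _ li).
split; last exact: vtx_closed.
move=> x' y' e'; have /and3P[/= lx' _ ly'] := allP wE _ e'.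
move/(vtxS _ _ lx') => h; apply/(vtxS _ _ ly'); have /norP[n0 nh] := negbT sa.
by have := lreachS h e' nc nh; rewrite (negPf n0).
Qed.

Lemma incl_sreach : incl J <-> forall u v, size u = 2 * l -> size v = 2 * l ->
  ~ [/\ vstart J u, vbad J v & sreach (2 * l) u v].
Proof.
split=> [H u v su sv [st bd sr]|H w q hr].
  have [w [[q hq] _ hS]] := vinv_sreach (vinv_start st) sr.
  have [q' lr] := H _ _ hq; have := bd q' (lreach_lt lr).
  by rewrite hS.
apply: NNPP => nl'.
apply: (H (vtx [::] (rs J)) (vtx w q)); rewrite ?size_mkbits //; split.
- split; last exact: vtx_closed.
    by move=> i li; rewrite vtxT // => /eqP.
  by apply/vtxS => //; constructor.
- by move=> i li; apply/negP => /(vtxS _ _ li) lr; apply: nl'; exists i.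
- by rewrite -!vtupE; apply: sreach_connect; apply: hreach_connect.
Qed.

End Savitch.

(** * The quantifier prefix as a recursion on midpoints *)

Section Game.
Variables (J : raw) (l : nat).
Hypotheses (sJ : sized J) (nl : rn J <= l).

(** The formula denies the existence of a path. Hence the bits of a midpoint are universal and the
    bit of its level, which names a half of the path, is existential: whatever the midpoint, one of
    the halves is missing. *)
Lemma qval_levels k lv u0 v0 :
  (forall x, x \in lv -> size x.2 = 2 * l) -> size u0 = 2 * l -> size v0 = 2 * l ->
  qval Kern (flatten (nseq k (block0 (2 * l) level0))) (leaf J lv u0 v0) <->
  static J /\ ~ [/\ vstart J u0, vbad J v0 &
    sreach J l k (getu true lv u0) (getu false lv v0)].
Proof.
elim: k lv => [|k IH] lv slv su sv; first exact: sat_Kern nl slv su sv.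
rewrite -[flatten _]/(block0 (2 * l) level0 ++ flatten (nseq k (block0 (2 * l) level0))).
rewrite /block0 -catA -/(block0 _ _) qval_all -[[:: level0] ++ _]/(level0 :: _).
have IH' c bs : size bs = 2 * l ->
    qval Kern (flatten (nseq k (block0 (2 * l) level0)))
      (inr (Some true, Cl, c) :: map cellb bs ++ leaf J lv u0 v0) <->
    static J /\ ~ [/\ vstart J u0, vbad J v0 &
    sreach J l k (getu true ((c, bs) :: lv) u0) (getu false ((c, bs) :: lv) v0)].
  move=> sb; rewrite -(IH ((c, bs) :: lv)) //.
    rewrite /leaf -[flatten (map lvl (_ :: _))]/(lvl (c, bs) ++ flatten (map lvl lv)).
    by rewrite -(catA (lvl _)).
  by move=> x; rewrite inE => /orP[/eqP -> //|/slv].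
split=> [H|[st H] bs sb].
  (* The static conditions are part of the kernel under every assignment, so any midpoint gives
     them, here the one with all bits [false]. *)
  have st : static J.
    have := H (nseq (2 * l) false); rewrite size_nseq qval_ex => /(_ erefl).
    by case/orP => /IH' []; rewrite ?size_nseq.
  split=> // -[h1 h2 [m [sm r1 r2]]].
  have := H m sm; rewrite qval_ex => /orP[|] /(IH' _ _ sm) /= [_ h]; by apply: h.
rewrite qval_ex; apply/orP.
(* The bit names a half that is missing: the second half ([right], bit [true]) if the first one
   exists, the first half otherwise. *)
case: (classic (sreach J l k (getu true lv u0) bs)) => r1.
  right; apply/(IH' _ _ sb); split=> // -[h1 h2 r2]; apply: H; split=> //.
  by exists bs.
by left; apply/(IH' _ _ sb); split=> // -[h1 h2 r2].
Qed.

End Game.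

Lemma size_enc_raw J : rn J <= size (enc_raw J).
Proof. by rewrite /enc_raw size_cat size_rcons size_nseq; lia. Qed.

Lemma qval_prefix J : sized J ->
  qval Kern (prefix (enc_raw J)) [::] <-> [/\ wf_raw J, lowdet J & incl J].
Proof.
move=> sJ; set w := enc_raw J; set l := size w.
have nl : rn J <= l by exact: size_enc_raw.
have fixd : all (fun a : sym => ~~ branch true (Some a) && ~~ branch false (Some a)) (rev (tag_word w)).
  by rewrite all_rev; apply: sub_all (fixed_tag_word w) => -[|[[[q|] t] b]].
rewrite /prefix -/l qval_fixed // catrevE revK cats0 (tag_word_enc sJ).
set lev := flatten _.
have E : qval Kern (block0 (2 * l) (fx Bu false) ++ block0 (2 * l) (fx Bv false) ++ lev) (tag_raw J) <->
    forall u0 v0, size u0 = 2 * l -> size v0 = 2 * l -> qval Kern lev (leaf J [::] u0 v0).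
  rewrite {1}/block0 -catA qval_all; split=> H u0.
    move=> v0 su sv; have := H u0 su.
    rewrite -[[:: _] ++ _]/([:: fx Bu false] ++ (block0 (2 * l) (fx Bv false) ++ lev)) qval_fixed //.
    rewrite /block0 -catA => /qval_all /(_ v0 sv).
    by rewrite (qval_fixed _ (fs := [:: fx Bv false])) // /leaf /base /blk /= -catA.
  move=> su; rewrite (qval_fixed _ (fs := [:: fx Bu false])) //.
  rewrite /block0 -catA; apply/qval_all => v0 sv.
  rewrite (qval_fixed _ (fs := [:: fx Bv false])) //.
  by have := H u0 v0 su sv; rewrite /leaf /base /blk /= -catA.
rewrite E.
have L u0 v0 : size u0 = 2 * l -> size v0 = 2 * l -> qval Kern lev (leaf J [::] u0 v0) <->
    static J /\ ~ [/\ vstart J u0, vbad J v0 & sreach J l (2 * l) u0 v0].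
  by move=> su sv; rewrite (qval_levels sJ nl).
split=> [H|[/and3P[_ ws wE] ld iJ] u0 v0 su sv].
  have s0 := size_nseq (2 * l) false.
  have [[h1 h2 h3] _] := (L _ _ s0 s0).1 (H _ _ s0 s0).
  split=> //; first by rewrite /wf_raw sJ h1 h2.
  by apply/(incl_sreach h1 h2 nl) => u v su sv; have [] := (L _ _ su sv).1 (H _ _ su sv).
apply/L => //; split; first by split.
by move: iJ => /(incl_sreach ws wE nl); apply.
Qed.

Lemma cnt_avoids t s : avoids t s -> cnt t s = 0.
Proof. by elim: s => //= a s IH /andP[na /IH]; rewrite /cnt /= => ->; case: a na => [|[[q u] b]] //= /negPf ->. Qed.

Lemma cnt_cat t s1 s2 : cnt t (s1 ++ s2) = cnt t s1 + cnt t s2.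
Proof. exact: count_cat. Qed.

Lemma cnt_tnum t n : cnt t (tnum t n) = n.
Proof. by rewrite /cnt /tnum -cats1 count_cat count_nseq /= eqtag_refl /= !addn0 mul1n. Qed.

Lemma cnt_prefix J : sized J -> cnt N_ (prefix (enc_raw J)) = rn J /\
  cnt M_ (prefix (enc_raw J)) = rm J.
Proof.
move=> sJ; rewrite /prefix (tag_word_enc sJ); set L := 2 * _.
have ab t a : ~~ eqtag t Ce -> ~~ has_tag t (Some a) -> avoids t (block0 L a).
  by move=> n1 n2; rewrite avoids_cat avoids_cons n2 /avoids all_nseq /= n1 orbT.
have al t k : ~~ eqtag t Ce -> ~~ eqtag t Cl -> avoids t (flatten (nseq k (block0 L level0))).
  by move=> n1 n2; elim: k => // k IH; rewrite avoids_cat IH ab.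
have red t : ~~ eqtag t Ce -> ~~ eqtag t Cl -> ~~ eqtag t Bu -> ~~ eqtag t Bv ->
   cnt t (rev (tag_raw J) ++ block0 L (fx Bu false) ++ block0 L (fx Bv false) ++
     flatten (nseq L (block0 L level0))) = cnt t (tag_raw J).
  move=> n1 n2 n3 n4; rewrite 3!cnt_cat (cnt_avoids (ab _ _ _ _)) // (cnt_avoids (ab _ _ _ _)) //.
  by rewrite (cnt_avoids (al _ _ _ _)) // !addn0 /cnt count_rev.
rewrite !red // /tag_raw tag_headE.
pose rest := tnum I_ (rs J) ++ fx KH false ::
  map (fx H_) (rH J) ++ map (fx C_) (rC J) ++ flatten (map tag_edge (rE J)) ++ [:: fx End_ false].
have -> : (fx KN false :: tnum N_ (rn J) ++ fx KM false :: tnum M_ (rm J) ++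
  fx KI false :: tnum I_ (rs J) ++ fx KH false ::
  map (fx H_) (rH J) ++ map (fx C_) (rC J) ++ flatten (map tag_edge (rE J))) ++ [:: fx End_ false] =
  [:: fx KN false] ++ tnum N_ (rn J) ++ [:: fx KM false] ++ tnum M_ (rm J) ++ [:: fx KI false] ++ rest.
  by rewrite /rest /= -!catA /= -!catA /= -!catA /= -!catA.
have aN : avoids N_ rest.
  by rewrite /rest ?(avoids_cat, avoids_cons) ?avoids_tnum ?avoids_map ?avoids_edges.
have aM : avoids M_ rest.
  by rewrite /rest ?(avoids_cat, avoids_cons) ?avoids_tnum ?avoids_map ?avoids_edges.
have c1 t a : ~~ has_tag t (Some a) -> cnt t [:: a] = 0.
  by move=> h; apply: cnt_avoids; rewrite avoids_cons h.
by split; rewrite (cnt_cat _ [:: _]) (cnt_cat _ (tnum _ _)) (cnt_cat _ [:: _])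
  (cnt_cat _ (tnum _ _)) (cnt_cat _ [:: _]) !c1 // cnt_tnum
  (cnt_avoids (avoids_tnum _ _)) // (cnt_avoids aN, cnt_avoids aM) ?addn0.
Qed.

Lemma controllable_qval w : SNNI_controllable w <-> qval Kern (prefix w) [::].
Proof.
rewrite controllable_raw; split=> [[J [wf -> ld iJ]]|H].
  by apply/qval_prefix; [case/and3P: wf | split].
have fixd : all (fun a : sym => ~~ branch true (Some a) && ~~ branch false (Some a)) (rev (tag_word w)).
  by rewrite all_rev; apply: sub_all (fixed_tag_word w) => -[|[[[q|] t] b]].
have [J [sJ ew _]] : exists J, [/\ sized J, w = enc_raw J & tag_word w = tag_raw J].
  apply: tag_word_sound; apply/negP => /hasP [a aw ea].
  move: H; rewrite /prefix qval_fixed // catrevE revK cats0 qval_false // => x.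
  apply/negP => /satAnd [/satNot h _]; apply: h; apply/satEx.
  have : a \in x ++ tag_word w by rewrite mem_cat aw orbT.
  move/onthP => [i ei]; exists i; split; first by rewrite -onthTE ei.
  by rewrite /= /tval /= addn0 ei.
by subst w; have [wf ld iJ] := (qval_prefix sJ).1 H; exists J.
Qed.

Lemma SNNI_pspace :
  in_PSPACE SNNI_controllable /\ PSPACE_search SNNI_controllable SNNI_synthesis.
Proof.
(* The largest variable of the kernel is 21, which lives on stacks 50 and 51, so 60 is a safe
   bound. *)
apply: (@qbf_pspace Kern 60) => //.
- exact: controllable_qval.
move=> w /controllable_raw [J [wf -> ld iJ]].
have sJ : sized J by case/and3P: wf.
have [-> ->] := cnt_prefix sJ; exact: synthesis_raw.
Qed.

(** * Encoding of polynomial-space computations *)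

Section TapeContents.
Variable G : finType.

(* The cell at position [D], the head being at position [C]. *)
Definition cont (C : nat) (tp : tape G) (D : nat) : cell G :=
  if C <= D then nth None tp.2 (D - C) else nth None tp.1 (C - D).-1.

Lemma cont_head C tp : cont C tp C = tape_read tp.
Proof. by rewrite /cont leqnn subnn /tape_read nth0. Qed.

Lemma cont_write C a tp D :
  cont C (tape_write a tp) D = if D == C then a else cont C tp D.
Proof.
rewrite /cont /tape_write /=; case: (ltngtP C D) => [lt|lt|->] //.
  have -> : D - C = (D - C).-1.+1 by lia.
  by rewrite /= nth_behead.
by rewrite subnn.
Qed.

(** The change of the distance from the head, plus one to avoid negative numbers: a cell drifts to
    the right when the head moves left. *)
Definition shift (d : move) : nat :=
  match d with MoveL => 2 | Stay => 1 | MoveR => 0 end.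

Lemma cont_move C d tp D : 0 < D ->
  cont C (tape_move d tp) (D.-1 + shift d) = cont C tp D.
Proof.
case: D => // D _; rewrite [D.+1.-1]/=; case: d; rewrite /cont /=.
- have -> : D + 2 = D.+2 by lia.
  case: (ltngtP C D.+2) => h.
  + rewrite ifT; last lia.
    have -> : D.+2 - C = (D.+1 - C).+1 by lia.
    by [].
  + rewrite ifF; last lia.
    have -> : C - D.+1 = (C - D.+2).+1 by lia.
    by rewrite nth_behead; congr nth; lia.
  + by subst C; rewrite subnn /= ltnn subSnn /= nth0.
- by rewrite addn1.
- rewrite addn0; case: (ltngtP C D.+1) => h.
  + rewrite ifT; last lia.
    rewrite nth_behead; congr nth; lia.
  + rewrite ifF; last lia.
    have -> : (C - D).-1 = (C - D.+1).-1.+1 by lia.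
    by [].
  + by subst C; rewrite ltnn subSnn /= subnn nth0.
Qed.
End TapeContents.

(** * The instance built from a machine *)

Section Automaton.
Variable M : TM.
Local Notation k := (ntapes M).
Local Notation Gam := (cell (aux M)).

Definition letter : finType := (state M * {ffun 'I_k.+1 -> Gam})%type.
(** The labels: [LE] silent, [LS] the start of a history, [LD] its end, [LH] the only high action,
    [LT t] the observation [t]. The numbering by [encL] gives 0 to the silent label, as instances
    demand, and 3 to the high action. *)
Definition lb : finType := option (option (option (option letter))).
Definition LE : lb := None.
Definition LS : lb := Some None.
Definition LD : lb := Some (Some None).
Definition LH : lb := Some (Some (Some None)).
Definition LT (t : letter) : lb := Some (Some (Some (Some t))).

Definition encL (l : lb) : nat :=
  match l with
  | None => 0 | Some None => 1 | Some (Some None) => 2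
  | Some (Some (Some None)) => 3
  | Some (Some (Some (Some t))) => 4 + enum_rank t
  end.

Lemma encL_inj : injective encL.
Proof.
by move=> [[[[t|]|]|]|] [[[[t'|]|]|]|] //= [] /val_inj/enum_rank_inj ->.
Qed.

Definition nlab : nat := 3 + #|letter|.

Lemma encL_le l : encL l <= nlab.
Proof.
by case: l => [[[[t|]|]|]|] //=; rewrite /nlab !addSn !ltnS ltn_ord.
Qed.

Definition sp : finType := option (option (state M)).
Definition encSp (s : sp) : nat :=
  match s with
  | None => 0 | Some None => 1 | Some (Some q) => 2 + enum_rank q end.
Definition nsp : nat := 2 + #|state M|.

Lemma encSp_inj : injective encSp.
Proof. by move=> [[q|]|] [[q'|]|] //= [] /val_inj/enum_rank_inj ->. Qed.

Lemma encSp_lt s : encSp s < nsp.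
Proof. by case: s => [[q|]|] //=; rewrite /nsp !addSn !ltnS ltn_ord. Qed.

(** The states of a block, for one distance from the head. [(i, None)] is a place of the silent
    chain, where a cell of tape [i] may be guessed; [(i, Some g)] follows such a cell, with current
    content [g]. *)
Definition X : finType := ('I_k.+1 * option Gam)%type.
Definition nX : nat := #|X|.
Definition rk (x : X) : nat := enum_rank x.
Lemma rk_lt x : rk x < nX. Proof. exact: ltn_ord. Qed.
Lemma rk_inj : injective rk. Proof. by move=> x y /val_inj/enum_rank_inj. Qed.
Definition encB (D : nat) (x : X) : nat := nsp + D * nX + rk x.

Lemma encB_inj D x D' x' : encB D x = encB D' x' -> D = D' /\ x = x'.
Proof.
rewrite /encB => e; have lx := rk_lt x; have lx' := rk_lt x'.
have e1 : D * nX + rk x = D' * nX + rk x' by lia.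
have eD : D = D'.
  have := congr1 (fun z => z %/ nX) e1.
  by rewrite !divnMDl ?(leq_ltn_trans _ lx) // !divn_small // !addn0.
by split=> //; apply: rk_inj; subst D'; lia.
Qed.

Lemma encB_ge D x : nsp <= encB D x. Proof. by rewrite /encB -addnA leq_addr. Qed.

(* The state [None] starts the chain of silent steps that guesses a cell of a
   tape, [Some None] accepts everything, [Some (Some q)] follows the control
   state of the machine. *)
Definition trSp (s : sp) (l : lb) : option nat :=
  match s, l with
  | None, None => Some (encB 1 (ord0, None))
  | None, Some None => Some (encSp (Some (Some (start M))))
  | None, _ => Some 1
  | Some None, (None | Some (Some (Some None))) => None
  | Some None, _ => Some 1
  | Some (Some q), Some None => Some 1
  | Some (Some q), Some (Some None) =>
      if halt q && ~~ accept q then None else Some 1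
  | Some (Some q), Some (Some (Some (Some t))) =>
      Some (if halt q || (t.1 != q) then 1 else encSp (Some (Some (delta t.1 t.2).1)))
  | Some (Some q), _ => None
  end.

(* Transitions of the component that follows one cell of tape [i]: [hd] tells
   whether the head scans the cell, [ct] is the input bit of the cell. *)
Definition trX (hd : bool) (ct : option bool) (x : X) (l : lb) :
    option (unit + nat * X) :=
  match x, l with
  | (i, None), None => Some (inr (if i == k :> nat then (2, (ord0, None))
                                  else (1, (inord i.+1, None))))
  | (i, None), Some None =>
      Some (inr (1, (i, Some (if i == ord0 then omap inl ct else None))))
  | (i, Some g), Some (Some (Some (Some t))) =>
      let a := (delta t.1 t.2).2 i in
      Some (if hd && (t.2 i != g) then inl tt
            else inr (shift a.2, (i, Some (if hd then a.1 else g))))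
  | _, _ => None
  end.

Definition toref (t : unit + nat * X) : nat + nat :=
  match t with inl _ => inl 1 | inr (h, x) => inr (h * nX + rk x) end.

(** The edges leaving one block, addressed from the start of the block before it, since a cell moves
    by at most one block and offsets then are never negative. There are only six templates for a
    given machine, so the reduction can contain them as constants. *)
Definition template (hd : bool) (ct : option bool) : seq (nat * nat * (nat + nat)) :=
  pmap (fun p : X * lb => omap (fun t => (nX + rk p.1, encL p.2, toref t))
                               (trX hd ct p.1 p.2)) (enum {: X * lb}).

Definition special : seq (nat * nat * nat) :=
  pmap (fun p : sp * lb => omap (fun t => (encSp p.1, encL p.2, t)) (trSp p.1 p.2))
       (enum {: sp * lb}).

Definition inst (z : nat) (e : nat * nat * (nat + nat)) : nat * nat * nat :=
  (z + e.1.1, e.1.2, match e.2 with inl j => j | inr o => z + o end).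

Definition block_edges (bl : seq (bool * option bool)) : seq (nat * nat * nat) :=
  flatten [seq map (inst (nsp + D * nX)) (template (nth (false, None) bl D).1 (nth (false, None) bl D).2)
          | D <- iota 0 (size bl)].

Definition target (D : nat) (t : unit + nat * X) : nat :=
  match t with inl _ => 1 | inr (h, x) => encB (D.-1 + h) x end.

Lemma mem_special x a y : (x, a, y) \in special <->
  exists s l, [/\ x = encSp s, a = encL l & trSp s l = Some y].
Proof.
rewrite /special mem_pmap; split=> [/mapP[[s l] _ /=]|[s [l [-> -> e]]]].
  by case e : (trSp s l) => [t|] //= [-> -> ->]; exists s, l.
by apply/mapP; exists (s, l); rewrite ?mem_enum //= e.
Qed.

Lemma mem_block bl x a y : (x, a, y) \in block_edges bl <->
  exists D x0 l t, [/\ 0 < D <= size bl, x = encB D x0, a = encL l,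
    trX (nth (false, None) bl D.-1).1 (nth (false, None) bl D.-1).2 x0 l = Some t & y = target D t].
Proof.
have E D t : 0 < D -> match toref t with inl j => j | inr o => nsp + D.-1 * nX + o end = target D t.
  by case: D => // D _; case: t => [|[h x']] //=; rewrite /encB mulnDl; lia.
split.
  case/flattenP => s /mapP[D]; rewrite mem_iota add0n => /andP[_ lD] ->.
  case/mapP => -[[x1 a1] r]; rewrite /template mem_pmap => /mapP[[x0 l] _ /=].
  case e : (trX _ _ x0 l) => [t|] //= [-> -> ->] [-> -> ->].
  exists D.+1, x0, l, t; split=> //; first by rewrite /encB mulSn; lia.
  exact: (E D.+1).
case=> -[|D] [x0 [l [t [// /andP[_ lD] -> -> e ->]]]].
apply/flattenP; eexists; first by apply/mapP; exists D; rewrite ?mem_iota.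
apply/mapP; exists (nX + rk x0, encL l, toref t).
  by rewrite /template mem_pmap; apply/mapP; exists (x0, l); rewrite ?mem_enum //= e.
by rewrite /inst -(E D.+1) //=; congr (_, _, _); rewrite /encB mulSn; lia.
Qed.

Section Instance.
Variables (J : raw) (w : seq bool) (A : nat).

(** The input as seen from the initial head, which scans block [A.+1], with a margin of [A] blank
    cells on each side. Blocks are numbered from 1: the numbers 0 and [(size blocks).+1] occur only
    as targets. *)
Definition blocks : seq (bool * option bool) :=
  nseq A (false, None) ++ (true, ohead w) :: [seq (false, Some b) | b <- behead w] ++
  nseq A (false, None).

Hypotheses (Js : rs J = 0) (JE : rE J =i special ++ block_edges blocks)
  (Jh : forall a, high J a = (a == 3)) (Jc : forall a, ctrl J a = false).

Local Notation C := A.+1.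
Local Notation conf := (config_at M w).

Lemma nth_blocks D : 0 < D -> nth (false, None) blocks D.-1 =
  (D == C, if C <= D then onth w (D - C) else None).
Proof.
case: D => // D _; rewrite [D.+1.-1]/= /blocks nth_cat size_nseq eqSS ltnS subSS.
case: (ltngtP D A) => h.
- by rewrite nth_nseq h.
- case e : (D - A) => [|m]; first lia.
  case: (w) => [|b v] /=; first by rewrite nth_nseq; case: ifP.
  rewrite nth_cat size_map; case: ltnP => lm.
    by rewrite (nth_map false) // onthE (nth_map false).
  by rewrite nth_nseq onthE nth_default ?size_map //; case: ifP.
- by rewrite h subnn; case: (w).
Qed.

Lemma size_blocks : A + A < size blocks.
Proof. by rewrite /blocks size_cat /= size_cat size_map !size_nseq; lia. Qed.

Lemma edgeP x a y : (x, a, y) \in rE J <->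
  (exists s l, [/\ x = encSp s, a = encL l & trSp s l = Some y]) \/
  (exists D x0 l t, [/\ 0 < D <= size blocks, x = encB D x0, a = encL l,
    trX (D == C) (if C <= D then onth w (D - C) else None) x0 l = Some t & y = target D t]).
Proof.
rewrite JE mem_cat; split=> [/orP[/mem_special|/mem_block]|[/mem_special ->//|]].
- by left.
- case=> D [x0 [l [t [h -> -> e ->]]]]; right; exists D, x0, l, t; split=> //.
  by move: e; rewrite nth_blocks //; case/andP: h.
- case=> D [x0 [l [t [h -> -> e ->]]]]; apply/orP; right; apply/mem_block.
  by exists D, x0, l, t; split=> //; rewrite nth_blocks //; case/andP: h.
Qed.

Lemma lowdet_instance : lowdet J.
Proof.
move=> x a y y' /edgeP [[s [l [-> -> e]]]|[D [x0 [l [t [_ -> -> e ->]]]]]] /edgeP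
  [[s' [l' [ex /encL_inj el e']]]|[D' [x0' [l' [t' [_ ex /encL_inj el e' ->]]]]]] _; subst l'.
- by move/encSp_inj: ex => ex; subst s'; move: e'; rewrite e => -[].
- by have := encSp_lt s; rewrite ex ltnNge encB_ge.
- by have := encSp_lt s'; rewrite -ex ltnNge encB_ge.
- by have [eD ex0] := encB_inj ex; subst D' x0'; move: e'; rewrite e => -[->].
Qed.

Lemma lstep v q l q' : lreach J v q -> l != LH -> (q, encL l, q') \in rE J ->
  lreach J (if l == LE then v else rcons v (encL l)) q'.
Proof.
move=> lr nl e; have := lreachS lr e; rewrite Jc Jh => /(_ isT).
have -> : (encL l == 3) = (l == LH) by rewrite -(inj_eq encL_inj).
have -> : (encL l == 0) = (l == LE) by rewrite -(inj_eq encL_inj).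
by move/(_ nl).
Qed.

Lemma lreach_init : lreach J [::] (encSp None).
Proof. by have := lreach0 J; rewrite Js. Qed.

Lemma spstep v s l y : lreach J v (encSp s) -> l != LH -> l != LE ->
  trSp s l = Some y -> lreach J (rcons v (encL l)) y.
Proof.
move=> lr n1 n2 e; have := @lstep v (encSp s) l y lr n1; rewrite (negPf n2); apply.
by apply/edgeP; left; exists s, l.
Qed.

Lemma bstep v D x0 l t : lreach J v (encB D x0) -> l != LH -> 0 < D <= size blocks ->
  trX (D == C) (if C <= D then onth w (D - C) else None) x0 l = Some t ->
  lreach J (if l == LE then v else rcons v (encL l)) (target D t).
Proof.
move=> lr n1 lD e; apply: lstep lr n1 _.
by apply/edgeP; right; exists D, x0, l, t.
Qed.

Definition low (l : lb) : bool := (l != LH) && (l != LE).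

Lemma lreach_univ v ls : lreach J v 1 -> all low ls -> lreach J (v ++ map encL ls) 1.
Proof.
elim: ls v => [|l ls IH] v lr /=; first by rewrite cats0.
case/andP => /andP[n1 n2] al; rewrite -cat_rcons; apply: IH => //.
apply: (@spstep v (Some None)) => //.
by case: l n1 n2 => [[[[t|]|]|]|].
Qed.

Lemma hreach_univ v ls : hreach J v 1 -> all low ls -> hreach J (v ++ map encL ls) 1.
Proof.
elim: ls v => [|l ls IH] v lr /=; first by rewrite cats0.
case/andP => /andP[n1 n2] al; rewrite -cat_rcons; apply: IH => //.
have e : (1, encL l, 1) \in rE J.
  apply/edgeP; left; exists (Some None), l; split=> //.
  by case: l n1 n2 => [[[[t|]|]|]|].
have := hreachS lr e; rewrite Jc /silent Jh => /(_ isT).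
have -> : (encL l == 3) = false by rewrite -[3]/(encL LH) (inj_eq encL_inj); exact: negPf.
by have -> : (encL l == 0) = false by rewrite -[0]/(encL LE) (inj_eq encL_inj); exact: negPf.
Qed.

Lemma hreach_low v q : hreach J v q -> exists2 ls, all low ls & v = map encL ls.
Proof.
elim=> [|{}v {}q a q' _ [ls al ->] e _]; first by exists [::].
have [l ea] : exists l, a = encL l by case/edgeP: e => [[s [l [_ -> _]]]|[D [x0 [l [t [_ _ -> _ _]]]]]]; exists l.
rewrite /silent Jh; case: ifP => [_|n]; first by exists ls.
exists (rcons ls l); last by rewrite map_rcons ea.
rewrite all_rcons al andbT /low; subst a.
by rewrite -!(inj_eq encL_inj) -negb_or orbC n.
Qed.

Definition obs (j : nat) : letter :=
  ((conf j).1, [ffun i => tape_read ((conf j).2 i)]).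
(** The word of the true computation before time [j]; the leading 1 is the code of [LS]. *)
Definition hist (j : nat) : seq nat := 1 :: [seq encL (LT (obs i)) | i <- iota 0 j].

Lemma histS j : hist j.+1 = rcons (hist j) (encL (LT (obs j))).
Proof. by rewrite /hist -[j.+1]addn1 iotaD map_cat cats1 rcons_cons. Qed.

Lemma confS j : ~~ halt (conf j).1 -> conf j.+1 =
  ((delta (obs j).1 (obs j).2).1,
   [ffun i => tape_move ((delta (obs j).1 (obs j).2).2 i).2
      (tape_write ((delta (obs j).1 (obs j).2).2 i).1 ((conf j).2 i))]).
Proof.
move=> nh; rewrite /config_at iterS -/(conf j) /step (negPf nh).
by rewrite -/(obs j).1 -/(obs j).2; case: (delta _ _).
Qed.

Lemma init_cont i D : cont C ((conf 0).2 i) D =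
  if i == ord0 then omap inl (if C <= D then onth w (D - C) else None) else None.
Proof.
rewrite /config_at /= ffunE /cont /=; case: (i == ord0); case: leqP => _; rewrite ?nth_nil //.
rewrite onthE; elim: w (D - C) => [|b v IH] [|m] //=; exact: IH.
Qed.

(** No letter has been read on the chain: it visits the tapes at one distance and then passes to the
    next distance, so each guess is still open after the empty word. *)
Lemma chain D i : 0 < D <= size blocks -> lreach J [::] (encB D (i, None)).
Proof.
have first_ : lreach J [::] (encB 1 (ord0, None)).
  have := @lstep [::] (encSp None) LE (encB 1 (ord0, None)); apply=> //.
    exact: lreach_init.
  by apply/edgeP; left; exists None, LE.
have row D' : 0 < D' <= size blocks -> lreach J [::] (encB D' (ord0, None)) ->
    forall m (i' : 'I_k.+1), i' = m :> nat -> lreach J [::] (encB D' (i', None)).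
  move=> lD l0; elim=> [|m IH] i' ei; first by have -> : i' = ord0 by apply: val_inj.
  have lm : m < k.+1 by rewrite -ei ltnW // ltn_ord.
  have := @bstep [::] D' (Ordinal lm, None) LE (inr (1, (i', None))) (IH (Ordinal lm) erefl).
  rewrite /= addn1 prednK; last by case/andP: lD.
  apply=> //; rewrite ifF; last first.
    by apply/negP => /eqP em; have := ltn_ord i'; rewrite ei em ltnn.
  congr (Some (inr (_, (_, _)))); apply: val_inj; rewrite /= -ei inordK //.
case: D => // D /= lD; suff l0 : lreach J [::] (encB D.+1 (ord0, None)) by exact: (row D.+1 lD l0 i i erefl).
elim: D lD => // D IH lD; have lD' : D < size blocks by apply: ltnW.
have := @bstep [::] D.+1 (ord_max, None) LE (inr (2, (ord0, None))) (row D.+1 lD' (IH lD') k ord_max erefl).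
by rewrite /= eqxx addn2; apply.
Qed.

Section Bound.
Variable S : nat.
Hypotheses (sS : forall t, space (conf t) <= S) (SA : S + S < A).

(* Number of cells visited to the left of the initial position. *)
Fixpoint lefts (i : 'I_k.+1) (j : nat) : nat :=
  if j is j'.+1 then lefts i j' +
    ((size ((conf j').2 i).1 == 0) &&
     (if ((delta (obs j').1 (obs j').2).2 i).2 is MoveL then true else false))
  else 0.

(** The part of the tape left of the head, less the cells that were added at the left end, is the
    displacement of the head from its initial cell. Adding [S] keeps it nonnegative, and it stays
    within [S + S]. *)
Definition pos i j := S + size ((conf j).2 i).1 - lefts i j.

Lemma tape_space i j : size ((conf j).2 i).1 + size ((conf j).2 i).2 <= S.
Proof.
apply: leq_trans (sS j); rewrite /space (bigD1 i) //=; exact: leq_addr.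
Qed.

Lemma lefts_le i j : (forall j', j' < j -> ~~ halt (conf j').1) ->
  lefts i j <= size ((conf j).2 i).1 + size ((conf j).2 i).2.
Proof.
elim: j => // j IH nh; have {}IH := IH (fun j' h => nh j' (ltnW h)).
rewrite confS; last exact: nh.
rewrite [lefts _ _]/= [snd _]/= ffunE; move: IH.
case: ((conf j).2 i) => a b /=; case: ((delta _ _).2 i) => s [] /=; rewrite ?andbF ?andbT ?addn0.
- by rewrite size_behead; case: a => [|? a] /=; rewrite size_behead; lia.
- by rewrite size_behead; lia.
- by rewrite size_behead; lia.
Qed.

Lemma pos_le i j : (forall j', j' < j -> ~~ halt (conf j').1) -> pos i j <= S + S.
Proof. by rewrite /pos; have := tape_space i j; lia. Qed.

Lemma posS i j : (forall j', j' < j.+1 -> ~~ halt (conf j').1) ->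
  (pos i j.+1).+1 = pos i j + 2 - shift ((delta (obs j).1 (obs j).2).2 i).2.
Proof.
move=> nh; have h1 := lefts_le i nh; have h2 := tape_space i j.+1.
have h3 := lefts_le i (fun j' (h : j' < j) => nh j' (ltnW h)); have h4 := tape_space i j.
move: h1 h2 h3 h4; rewrite /pos confS; last exact: nh.
rewrite [lefts _ _.+1]/= ffunE; case: ((conf j).2 i) => a b /=.
case: ((delta _ _).2 i) => s [] /=; rewrite ?andbF ?andbT ?addn0.
- by case: a => [|? a] /=; rewrite ?size_behead; lia.
- by lia.
- by lia.
Qed.

(* The component that guessed the right cell follows it up to time [j]. *)
Lemma track i j : (forall j', j' < j -> ~~ halt (conf j').1) ->
  lreach J (hist j) (encB C (i, Some (tape_read ((conf j).2 i)))).
Proof.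
(* The block in which, at time [m], the cell scanned at time [j] is found; it is [C] for [m = j].
   Positions differ by at most [S + S], which is below the margin, so the block always exists. *)
move=> nh; pose Dj m := C + pos i j - pos i m.
have sb := size_blocks.
have lD m : m <= j -> 0 < Dj m <= size blocks.
  move=> lm; have h1 := pos_le i (fun j' (h : j' < m) => nh j' (leq_trans h lm)).
  by have h2 := pos_le i nh; rewrite /Dj; lia.
suff H m : m <= j -> lreach J (hist m) (encB (Dj m) (i, Some (cont C ((conf m).2 i) (Dj m)))).
  have e : Dj j = C by rewrite /Dj addnK.
  by have := H j (leqnn _); rewrite e cont_head.
elim: m => [|m IH] lm.
  have := @bstep [::] (Dj 0) (i, None) LS _ (chain i (lD 0 lm)) isT (lD 0 lm) erefl.
  rewrite /= addn1 prednK; last by have /andP[] := lD 0 lm.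
  by rewrite init_cont; case: (i == ord0).
have {}IH := IH (ltnW lm); have ld := lD m (ltnW lm); have /andP[d0 _] := ld.
set g := cont _ _ _ in IH.
have hd : (Dj m == C) -> g = tape_read ((conf m).2 i).
  by rewrite /g => /eqP ->; rewrite cont_head.
have := @bstep (hist m) (Dj m) (i, Some g) (LT (obs m)) _ IH isT ld erefl.
rewrite -histS /= ffunE; set a := (delta _ _).2 i.
have -> : (Dj m == C) && (tape_read ((conf m).2 i) != g) = false.
  by apply/andP => -[/hd ->]; rewrite eqxx.
rewrite [target _ _]/=.
have eD : (Dj m).-1 + shift a.2 = Dj m.+1.
  have p1 := posS i (fun j' (h : j' < m.+1) => nh j' (leq_trans h lm)).
  have h1 := pos_le i (fun j' (h : j' < m) => nh j' (leq_trans h (ltnW lm))).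
  have h2 := pos_le i (fun j' (h : j' < m.+1) => nh j' (leq_trans h lm)).
  rewrite -/a in p1; move: d0 p1; rewrite /Dj; have : shift a.2 <= 2 by case: (a.2).
  lia.
rewrite eD => lr; move: lr; congr (lreach _ _ (encB _ (_, Some _))).
rewrite -[step (conf m)]/(conf m.+1) confS; last exact: nh.
by rewrite /snd ffunE -/a -eD cont_move // cont_write /g.
Qed.

Lemma control j : (forall j', j' < j -> ~~ halt (conf j').1) ->
  lreach J (hist j) (encSp (Some (Some (conf j).1))).
Proof.
elim: j => [|j IH] nh.
  by apply: (@spstep [::] None LS) => //; exact: lreach_init.
have {}IH := IH (fun j' h => nh j' (ltnW h)); rewrite histS.
apply: (spstep IH) => //=; rewrite (negPf (nh j _)) // eqxx /=.
by rewrite -[step (conf j)]/(conf j.+1) confS //; apply: nh.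
Qed.

(** Consider the first letter at which a word departs from the history. A wrong control state, a
    misplaced [LS] or [LD], or a letter after halting in acceptance is caught by the component of
    the control state; a wrong scanned symbol is caught by the component that tracks the cell
    scanned at that moment. The state 1 then reads everything. A word that never departs is read by
    the control component itself. *)
Lemma incl_accept t : halt (conf t).1 -> accept (conf t).1 -> incl J.
Proof.
move=> ht at_ v q /hreach_low [ls al ->].
have U v1 ls1 : lreach J v1 1 -> all low ls1 -> exists q', lreach J (v1 ++ map encL ls1) q'.
  by move=> h1 h2; exists 1; apply: lreach_univ.
case: ls al => [|l ls] /=; first by exists (rs J); constructor.
case/andP => ll al; have l0 := lreach_init.
have [n1 n2] := andP ll.
case: (l =P LS) => [->|nS]; last first.
  apply: (U [:: encL l]) => //; apply: (spstep l0 n1 n2) => //.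
  by case: l nS n1 n2 {ll} => [[[[t'|]|]|]|].
suff H m j : size ls = m -> (forall j', j' < j -> ~~ halt (conf j').1) ->
    exists q', lreach J (hist j ++ map encL ls) q' by apply: (H (size ls) 0).
elim: ls al m j => [|l1 ls IH] /= al m j em nh.
  by rewrite cats0; exists (encSp (Some (Some (conf j).1))); apply: control.
case/andP: al => l1l al; have [m1 m2] := andP l1l; have cj := control nh.
have W : trSp (Some (Some (conf j).1)) l1 = Some 1 ->
    exists q', lreach J (hist j ++ encL l1 :: map encL ls) q'.
  by move=> e; rewrite -cat_rcons; apply: U => //; apply: (spstep cj m1 m2).
case: l1 l1l m1 m2 W {em} => [[[[tau|]|]|]|] // l1l m1 m2 W; last by apply: W.
  case: (boolP (halt (conf j).1 || (tau.1 != (conf j).1))) => h.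
    by apply: W; rewrite /= h.
  case/norP: h => nhj /negPn/eqP es.
  have nh' j' : j' < j.+1 -> ~~ halt (conf j').1.
    by rewrite ltnS leq_eqVlt => /orP[/eqP ->|/nh].
  case: (tau.2 =P (obs j).2) => [er|/eqP ner].
    have et : tau = obs j by case: (tau) es er => ? ? /= -> ->.
    have [q' h] := IH al (size ls) j.+1 erefl nh'.
    by exists q'; move: h; rewrite histS cat_rcons et.
  have [i ni] : exists i, tau.2 i != (obs j).2 i.
    apply/existsP; apply: contraNT ner; rewrite negb_exists => /forallP h.
    by apply/eqP/ffunP => i; apply/eqP; have := h i; rewrite negbK.
  have sb := size_blocks; have lC : 0 < C <= size blocks by lia.
  have := @bstep _ C _ (LT tau) (inl tt) (track i nh) isT lC.
  rewrite /= eqxx /=; have -> : tau.2 i != tape_read ((conf j).2 i).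
    by move: ni; rewrite /= ffunE.
  move/(_ erefl) => lr; have [q' h] := U _ ls lr al.
  by exists q'; move: h; rewrite cat_cons cat_rcons.
apply: W => /=; case: ifP => // /andP[hj].
by rewrite (halted_unique hj ht) at_.
Qed.

End Bound.

Definition Rinit (q : nat) : Prop :=
  q = 0 \/ exists D i, [/\ 0 < D & q = encB D (i, None)].
Definition Rat (j : nat) (q : nat) : Prop :=
  q = encSp (Some (Some (conf j).1)) \/
  exists D i, q = encB D (i, Some (cont C ((conf j).2 i) D)).

(** On the true history no component finds a fault, so the universal state is out of reach: before
    halting, every low state holds either the true control state or the true content of a cell. *)
Lemma lreach_sound t : (forall j, j < t -> ~~ halt (conf j).1) ->
  forall v q, lreach J v q -> (v = [::] -> Rinit q) /\
    (forall j, j <= t -> v = hist j -> Rat j q).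
Proof.
move=> nh v q; elim=> [|{}v {}q a q' lr [IH0 IH] e _ nhi].
  by split=> // _; left.
have nl l : a = encL l -> l != LH by move=> ea; apply: contraNneq nhi => el; rewrite Jh ea el.
case: eqP => [a0|na].
  split=> [/IH0 R|j lj /(IH j lj) R].
    case: R => [q0|[D [i [D0 eq]]]]; subst q.
      case/edgeP: e => [[s [l [es el e]]]|[D [x0 [l [t0 [_ ex _ _ _]]]]]]; last first.
        by have := encB_ge D x0; rewrite -ex.
      have ? : s = None by apply: encSp_inj. subst s.
      have ? : l = LE by apply: encL_inj; rewrite -el a0. subst l.
      by move: e => -[<-]; right; exists 1, ord0.
    case/edgeP: e => [[s [l [es el e]]]|[D' [x0 [l [t0 [_ ex el e ->]]]]]].
      by have := encSp_lt s; rewrite -es ltnNge encB_ge.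
    have [? ?] := encB_inj ex; subst D' x0.
    have ? : l = LE by apply: encL_inj; rewrite -el a0. subst l.
    move: e => -[<-]; right; rewrite /=; case: ifP => _ /=.
      by exists (D.-1 + 2), ord0; split=> //; lia.
    by exists (D.-1 + 1), (inord i.+1); split=> //; lia.
  case: R => [eq|[D [i eq]]]; subst q.
    case/edgeP: e => [[s [l [es el e]]]|[D [x0 [l [t0 [_ ex _ _ _]]]]]].
      have es' := encSp_inj es; subst s.
      have ? : l = LE by apply: encL_inj; rewrite -el a0. subst l.
      by [].
    by have := encSp_lt (Some (Some (conf j).1)); rewrite ex ltnNge encB_ge.
  case/edgeP: e => [[s [l [es el e]]]|[D' [x0 [l [t0 [_ ex el e ->]]]]]].
    by have := encSp_lt s; rewrite -es ltnNge encB_ge.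
  have [? ?] := encB_inj ex; subst D' x0.
  have ? : l = LE by apply: encL_inj; rewrite -el a0. subst l.
  by [].
split=> [/(congr1 size)|j lj]; first by rewrite size_rcons.
case: j lj => [|j] lj.
  rewrite -[hist 0]/(rcons [::] 1) => /rcons_inj [/IH0 R ea]; subst a.
  case: R => [q0|[D [i [D0 eq]]]]; subst q.
    case/edgeP: e => [[s [l [es el e]]]|[D [x0 [l [t0 [_ ex _ _ _]]]]]]; last first.
      by have := encB_ge D x0; rewrite -ex.
    have ? : s = None by apply: encSp_inj. subst s.
    have ? : l = LS by apply: encL_inj. subst l.
    by move: e => -[<-]; left.
  case/edgeP: e => [[s [l [es el e]]]|[D' [x0 [l [t0 [_ ex el e ->]]]]]].
    by have := encSp_lt s; rewrite -es ltnNge encB_ge.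
  have [? ?] := encB_inj ex; subst D' x0.
  have ? : l = LS by apply: encL_inj. subst l.
  move: e => -[<-]; right; exists D, i.
  by rewrite /= addn1 prednK // init_cont; case: (i == ord0).
rewrite histS => /rcons_inj [/(IH j (ltnW lj)) R ea]; subst a.
have nhj := nh j lj.
case: R => [eq|[D [i eq]]]; subst q.
  case/edgeP: e => [[s [l [es el e]]]|[D [x0 [l [t0 [_ ex _ _ _]]]]]].
    have es' := encSp_inj es; subst s.
    have ? : l = LT (obs j) by apply: encL_inj. subst l.
    move: e; rewrite /= (negPf nhj) eqxx => -[<-]; left.
    by rewrite confS.
  by have := encSp_lt (Some (Some (conf j).1)); rewrite ex ltnNge encB_ge.
case/edgeP: e => [[s [l [es el e]]]|[D' [x0 [l [t0 [lD ex el e ->]]]]]].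
  by have := encSp_lt s; rewrite -es ltnNge encB_ge.
have [? ?] := encB_inj ex; subst D' x0.
have ? : l = LT (obs j) by apply: encL_inj. subst l.
move: e; rewrite /= ffunE; set a := (delta _ _).2 i.
have -> : (D == C) && (tape_read ((conf j).2 i) != cont C ((conf j).2 i) D) = false.
  by apply/andP => -[/eqP ->]; rewrite cont_head eqxx.
move=> -[<-]; right; exists (D.-1 + shift a.2), i; rewrite [target _ _]/=.
congr (encB _ (_, Some _)); rewrite confS // /snd ffunE -/a.
by rewrite cont_move; [rewrite cont_write | case/andP: lD].
Qed.

(** The separating word is the full history followed by [LD]. The high action leads to the universal
    state, which reads it; a low run is stopped at [LD], because the component of the control state
    has no such edge at a rejecting state and the cells have none at all. *)
Lemma reject_incl t : (forall j, j < t -> ~~ halt (conf j).1) ->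
  halt (conf t).1 -> ~~ accept (conf t).1 -> ~ incl J.
Proof.
move=> nh ht nacc H.
have hU : hreach J [::] 1.
  have e : (0, encL LH, 1) \in rE J by apply/edgeP; left; exists None, LH.
  have := hreachS (hreach0 J); rewrite Js => /(_ _ _ e); rewrite Jc /silent Jh /=.
  by apply.
have F v q : lreach J v q -> v = rcons (hist t) (encL LD) -> False.
  elim=> [|{}v q0 a q' lr IH ed _ _]; first by move/(congr1 size); rewrite size_rcons.
  case: eqP => // _ /rcons_inj [ev ea].
  subst a v; have [_ /(_ t (leqnn _) erefl) R] := lreach_sound nh lr.
  case: R => [eq|[D [i eq]]]; subst q0.
    case/edgeP: ed => [[s [l [es el e]]]|[D [x0 [l [t0 [_ ex _ _ _]]]]]].
      have es' := encSp_inj es; subst s.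
      have ? : l = LD by apply: encL_inj. subst l.
      by move: e; rewrite /= ht nacc.
    by have := encSp_lt (Some (Some (conf t).1)); rewrite ex ltnNge encB_ge.
  case/edgeP: ed => [[s [l [es el e]]]|[D' [x0 [l [t0 [_ ex el e _]]]]]].
    by have := encSp_lt s; rewrite -es ltnNge encB_ge.
  have [? ?] := encB_inj ex; subst D' x0.
  have ? : l = LD by apply: encL_inj. subst l.
  by [].
have [|q /F] := H (rcons (hist t) (encL LD)) 1; last by apply.
have := @hreach_univ [::] (LS :: rcons [seq LT (obs i) | i <- iota 0 t] LD) hU.
rewrite /= map_rcons -map_comp; apply.
by rewrite all_rcons /= all_map; apply/allP.
Qed.

End Instance.
End Automaton.

(** * The reduction in polynomial time *)

Section ReductionProgram.
Local Notation sym := (bool + unit)%type.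
Local Notation one := (one unit).
Local Notation ne := (@nonempty unit).
Local Notation prg := (prog unit).

Definition exT (p : prg) s s' T := exists2 t, exec predT p s s' t & t <= T.

Lemma exT_le p s s' T T' : exT p s s' T -> T <= T' -> exT p s s' T'.
Proof. by move=> [t E le] le'; exists t => //; apply: leq_trans le'. Qed.

Lemma exT_eq p s s1 s2 T : exT p s s1 T -> s1 = s2 -> exT p s s2 T.
Proof. by move=> E <-. Qed.

Lemma exT_seq p q s1 s2 s3 T1 T2 : exT p s1 s2 T1 -> exT q s2 s3 T2 ->
  exT (Seq p q) s1 s3 (T1 + T2).
Proof. by move=> [t1 E1 h1] [t2 E2 h2]; exists (t1 + t2); [apply: ESeq E1 E2 | lia]. Qed.

Lemma exT_skip s : exT Skip s s 1. Proof. by exists 1; [constructor|]. Qed.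

Lemma exT_seqs p ps s1 s2 s3 T1 T2 : exT p s1 s2 T1 -> exT (seqs ps) s2 s3 T2 ->
  exT (seqs (p :: ps)) s1 s3 (T1 + T2).
Proof. exact: exT_seq. Qed.

Lemma exT_if x (P : pred _) p q s s' T : exT (if P (ohead (s x)) then p else q) s s' T ->
  exT (If x P p q) s s' T.+1.
Proof.
by case: ifP => Px [t E h]; exists t.+1 => //; [apply: EIfT | apply: EIfF; rewrite ?Px].
Qed.

Lemma exT_pushc y a s : exT (pushc y a) s (upd s y (a :: s y)) 2.
Proof. by exists 2 => //; apply: exec_pushc. Qed.

Lemma exT_pop x s : exT (Pop x) s (upd s x (behead (s x))) 1.
Proof. by exists 1 => //; constructor. Qed.

Lemma exT_mv x y f s a l : x != y -> s x = a :: l ->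
  exT (mv x y f) s (upd (upd s x l) y (f a :: s y)) 3.
Proof. by move=> h e; exists 3 => //; apply: exec_mv. Qed.

Lemma exT_mvall x y f (s : store unit) : x != y ->
  exT (mvall x y f) s (upd (upd s x [::]) y (catrev (map f (s x)) (s y))) (4 * size (s x)).+1.
Proof. by move=> h; eexists; [apply: exec_mvall | ]. Qed.

Lemma exT_loop x body T (inv : nat -> store unit) m :
  (forall i, i < m -> ne (ohead (inv i x)) /\ exT body (inv i) (inv i.+1) T) ->
  ~~ ne (ohead (inv m x)) -> exT (While x ne body) (inv 0) (inv m) (m * T.+1 + 1).
Proof.
elim: m inv => [|m IH] inv H0 Hm; first by exists 1 => //; apply: EWhileF.
have [h1 [t1 E1 l1]] := H0 0 isT.
have [t2 E2 l2] := IH (fun i => inv i.+1) (fun i h => H0 i.+1 h) Hm.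
by exists (t1 + t2).+1; [apply: EWhileT E1 E2 | rewrite mulSn; lia].
Qed.

Lemma nseq_cons_cat (b : sym) i r : nseq i b ++ b :: r = nseq i.+1 b ++ r.
Proof. by rewrite -cat_rcons -cats1 -[[:: b]]/(nseq 1 b) -nseqD addn1. Qed.

Definition pushn x n (a : sym) : prg := seqs (nseq n (pushc x a)).

Lemma exT_pushn x n a s : exT (pushn x n a) s (upd s x (nseq n a ++ s x)) (2 * n + 1).
Proof.
elim: n s => [|n IH] s; first by rewrite upd_id; apply: exT_skip.
apply: exT_le; first apply: exT_eq.
- by apply: exT_seqs; [apply: exT_pushc | apply: IH].
- by rewrite upd_upd updE eqxx nseq_cons_cat.
- lia.
Qed.

Definition pushl (l : seq bool) : prg := seqs [seq pushc 0 (inl b) | b <- rev l].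

Lemma exT_pushl l s : exT (pushl l) s (upd s 0 (map inl l ++ s 0)) (2 * size l + 1).
Proof.
rewrite /pushl -(size_rev l) -{2}(revK l); elim: (rev l) s => [|b r IH] s.
  by rewrite upd_id; apply: exT_skip.
apply: exT_le; first apply: exT_eq.
- by apply: exT_seqs; [apply: exT_pushc | apply: IH].
- by rewrite upd_upd updE eqxx rev_cons map_rcons cat_rcons.
- by rewrite /=; lia.
Qed.

Definition rept x y c (a : sym) : prg :=
  Seq (While x ne (seqs [:: pushc y a; pushc c one; Pop x])) (mvall c x id).

Lemma exT_rept x y c a k s : x != y -> x != c -> y != c -> s x = nseq k one -> s c = [::] ->
  exT (rept x y c a) s (upd s y (nseq k a ++ s y)) (11 * k + 2).
Proof.
move=> nxy nxc nyc ex ec.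
pose inv i := upd (upd (upd s x (nseq (k - i) one)) c (nseq i one)) y (nseq i a ++ s y).
apply: exT_le; first apply: exT_eq.
- apply: (@exT_seq _ _ _ (inv k)).
    have -> : s = inv 0.
      by rewrite /inv subn0 [upd s x _]upd_eq // [upd s c _]upd_eq // upd_eq.
    apply: (@exT_loop x _ 6 inv k); last by rewrite /inv !updE (negPf nxy) (negPf nxc) eqxx subnn.
    move=> i li; have ek : k - i = (k - i.+1).+1 by lia.
    split; first by rewrite /inv !updE (negPf nxy) (negPf nxc) eqxx ek.
    apply: exT_le; first apply: exT_eq.
    + do 2 (apply: exT_seqs; first exact: exT_pushc).
      by apply: exT_seqs; [apply: exT_pop | apply: exT_skip].
    + rewrite /inv; apply: functional_extensionality => z; rewrite !updE !eqxx.
      rewrite (negPf nxy) (negPf nxc) (eq_sym c y) (negPf nyc) ek.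
      case: (z =P x) => [->|_]; first by rewrite (negPf nxy) (negPf nxc).
      by case: (z =P c) => [->|_]; rewrite 1?(eq_sym c y) ?(negPf nyc) //; case: (z =P y).
    + by [].
  by apply: exT_mvall; rewrite eq_sym.
- rewrite /inv; apply: functional_extensionality => z; rewrite !updE !eqxx subnn.
  rewrite (negPf nxy) (negPf nxc) (eq_sym c y) (negPf nyc) map_id -[[::]]/(nseq 0 one) catrev_nseq addn0.
  case: (z =P x) => [->|_]; first by rewrite (negPf nxy).
  by case: (z =P c) => [->|_]; rewrite 1?(eq_sym c y) ?(negPf nyc) //; case: (z =P y).
- rewrite /inv !updE eqxx (eq_sym c y) (negPf nyc) size_nseq; lia.
Qed.

(** Stack 3 holds the address of the current block in unary. An absolute number is a constant of the
    program; a relative one is a constant added to that address. *)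
Definition pushref (r : nat + nat) : prg :=
  match r with
  | inl j => pushn 0 j (inl true)
  | inr o => Seq (pushn 0 o (inl true)) (rept 3 0 4 (inl true))
  end.
Definition rval (z : nat) (r : nat + nat) : nat :=
  match r with inl j => j | inr o => z + o end.
Definition rsz (r : nat + nat) : nat := match r with inl j => j | inr o => o end.
Local Notation redge := ((nat + nat) * nat * (nat + nat))%type.
(** The output grows on the top of stack 0, so everything is produced backwards: the fields of an
    edge here, the edges of the list (hence the [rev] in [raw_inst]), and the header after all
    edges. *)
Definition emit_edge (e : redge) : prg :=
  seqs [:: pushc 0 (inl false); pushref e.2; pushc 0 (inl false);
           pushn 0 e.1.2 (inl true); pushc 0 (inl false); pushref e.1.1;
           pushc 0 (inl true)].
Definition rinst (z : nat) (e : redge) : nat * nat * nat :=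
  (rval z e.1.1, e.1.2, rval z e.2).
Definition ecost (e : redge) : nat := 40 + 2 * (rsz e.1.1 + e.1.2 + rsz e.2).

Lemma exT_pushref z r s : s 3 = nseq z one -> s 4 = [::] ->
  exT (pushref r) s (upd s 0 (nseq (rval z r) (inl true) ++ s 0)) (2 * rsz r + 11 * z + 4).
Proof.
move=> e3 e4; case: r => [j|o] /=.
  by apply: exT_le; [apply: exT_pushn | lia].
apply: exT_le; first apply: exT_eq.
- apply: exT_seq; first exact: exT_pushn.
  by apply: (@exT_rept 3 0 4 _ z) => //; rewrite updE.
- by rewrite upd_upd updE eqxx nseqD -catA.
- lia.
Qed.

Lemma exT_emit z e s : s 3 = nseq z one -> s 4 = [::] ->
  exT (emit_edge e) s (upd s 0 (map inl (enc_redge (rinst z e)) ++ s 0)) (ecost e * z.+1).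
Proof.
move=> e3 e4; case: e => [[x a] y].
have mn n : map inl (nseq n true) = nseq n (inl true) :> seq sym by rewrite map_nseq.
apply: exT_le; first apply: exT_eq.
- apply: exT_seqs; first exact: exT_pushc.
  apply: exT_seqs; first by apply: (@exT_pushref z); rewrite updE.
  apply: exT_seqs; first exact: exT_pushc.
  apply: exT_seqs; first exact: exT_pushn.
  apply: exT_seqs; first exact: exT_pushc.
  apply: exT_seqs; first by apply: (@exT_pushref z); rewrite !updE.
  by apply: exT_seqs; [apply: exT_pushc | apply: exT_skip].
- rewrite !upd_upd !updE !eqxx /enc_redge /rinst /enc_nat /= -!cats1 !map_cat /= !mn.
  by rewrite -?catA /= -?catA /= -?catA.
- by rewrite /ecost /=; nia.
Qed.

Definition ecosts (es : seq redge) : nat := sumn (map ecost es).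

Lemma exT_emits z es s : s 3 = nseq z one -> s 4 = [::] ->
  exT (seqs (map emit_edge es)) s
    (upd s 0 (map inl (flatten (map enc_redge (rev (map (rinst z) es)))) ++ s 0))
    (ecosts es * z.+1 + 1).
Proof.
elim: es s => [|e es IH] s e3 e4; first by rewrite /= upd_id; apply: exT_skip.
apply: exT_le; first apply: exT_eq.
- apply: exT_seqs; first exact: (@exT_emit z).
  by apply: IH; rewrite updE.
- rewrite upd_upd updE eqxx [map (rinst z) _]/= rev_cons map_rcons flatten_rcons map_cat.
  by rewrite -catA.
- by rewrite /ecosts /= mulnDl; lia.
Qed.

Lemma block_edges_rcons M bl b : block_edges M (rcons bl b) =
  block_edges M bl ++ map (inst (nsp M + size bl * nX M)) (template M b.1 b.2).
Proof.
rewrite /block_edges size_rcons -addn1 iotaD map_cat flatten_cat /= cats0 add0n.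
rewrite nth_rcons ltnn eqxx; congr cat; congr flatten; apply/eq_in_map => D.
by rewrite mem_iota add0n => /andP[_ lD]; rewrite nth_rcons lD.
Qed.

Lemma poly_S f : poly f -> poly (fun n => (f n).+1).
Proof. by move=> h; apply: poly_leq (poly_add h (poly_const 1)) => n; rewrite addn1. Qed.

Ltac polyt := repeat first [apply poly_const | apply poly_id | apply poly_S
  | apply poly_add | apply poly_mul | apply poly_exp].

Lemma vok_seqs k (ps : seq prg) : vok k (seqs ps) = all (vok k) ps.
Proof. by elim: ps => //= p ps ->. Qed.

(** * The instance and the program that writes it *)

Section Reduction.
Variables (M : TM) (c d : nat).
Local Notation nX := (nX M).
Local Notation nsp := (nsp M).
Local Notation nlab := (nlab M).

(** The margin must exceed twice the space bound [c * n ^ d + c]. This bound is at most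
    [2 * c * n.+1 ^ d], so [4 * c] would reach the double, and the additional 1 makes the inequality
    strict. *)
Definition Aof (n : nat) : nat := (4 * c + 1) * n.+1 ^ d.
Definition highs : seq bool := [:: false; false; true] ++ nseq #|letter M| false.
Definition bls (w : seq bool) := blocks w (Aof (size w)).
(** The term [2 * nX] makes room for the two outer blocks, which a cell may enter but not leave. *)
Definition raw_inst (w : seq bool) : raw :=
  Raw (nsp + size (bls w) * nX + 2 * nX) nlab 0 highs (nseq nlab false)
      (rev (block_edges M (bls w) ++ special M)).

Definition srcrel (e : nat * nat * (nat + nat)) : redge := (inr e.1.1, e.1.2, e.2).
Definition absrel (e : nat * nat * nat) : redge := (inl e.1.1, e.1.2, inl e.2).

Definition blockp hd ct : prg :=
  Seq (seqs (map emit_edge (map srcrel (template M hd ct)))) (pushn 3 nX one).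
Definition mul : prg :=
  Seq (While 5 ne (Seq (Pop 5) (rept 6 7 4 one))) (mvall 7 5 id).
Definition topbit b (o : option sym) : bool := o == Some (inl b).

Definition header : seq bool := enc_nat nlab ++ enc_nat 0 ++ highs ++ nseq nlab false.

(** Stack 2 keeps the input, stack 6 its length plus one, stacks 5 and 8 the two margins, stack 3
    the current address. When the edges are written, the address is that of the end of the regular
    blocks, from which the number of states is obtained by adding the constant [2 * nX]. *)
Definition reduce : prg :=
  seqs [:: mvall 0 1 id; While 1 ne (Seq (mv 1 2 id) (pushc 6 one)); pushc 6 one;
    pushn 5 (4 * c + 1) one; seqs (nseq d mul); rept 5 8 7 one;
    pushn 3 nsp one; pushc 0 (inl false);
    While 5 ne (Seq (Pop 5) (blockp false None));
    If 2 (topbit true) (blockp true (Some true))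
      (If 2 (topbit false) (blockp true (Some false)) (blockp true None));
    Pop 2;
    While 2 ne (Seq (If 2 (topbit true) (blockp false (Some true)) (blockp false (Some false)))
                    (Pop 2));
    While 8 ne (Seq (Pop 8) (blockp false None));
    seqs (map emit_edge (map absrel (special M)));
    pushl header; pushc 0 (inl false); pushref (inr (2 * nX))].

Lemma reduce_vok : vok 8 reduce.
Proof.
have vp x n a : x <= 8 -> vok 8 (pushn x n a).
  by move=> lx; rewrite vok_seqs all_nseq /= lx orbT.
have vr r : vok 8 (pushref r) by case: r => [j|o] /=; rewrite vp.
have ve es : vok 8 (seqs (map emit_edge es)).
  rewrite vok_seqs all_map; apply/allP => e _.
  by rewrite [preim _ _ _]/= !vr vp.
have vb hd ct : vok 8 (blockp hd ct) by rewrite /= ve vp.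
have vl l : vok 8 (pushl l) by rewrite vok_seqs all_map; apply/allP.
have vm : vok 8 (seqs (nseq d mul)) by rewrite vok_seqs all_nseq orbT.
rewrite vok_seqs.
by repeat first [exact: vb | exact: ve | exact: vl | exact: vr | exact: vm
  | (apply: vp; done) | done | (apply/andP; split)].
Qed.

Definition Sx (o v z r5 r6 r8 : seq sym) : store unit := fun x =>
  match x with
  | 0 => o | 2 => v | 3 => z | 5 => r5 | 6 => r6 | 8 => r8 | _ => [::] end.

Definition SB bl v r5 r6 r8 : store unit :=
  Sx (map inl (flatten (map enc_redge (rev (block_edges M bl))) ++ [:: false])) v
     (nseq (nsp + size bl * nX) one) r5 r6 r8.

Ltac stq9 := apply: functional_extensionality;
  do 9 (case=> [|]; first by []); move=> ?; by [].

Definition bcost (b : bool * option bool) : nat :=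
  ecosts (map srcrel (template M b.1 b.2)) + 2 * nX + 2.
(** The sum over the six templates, as a common bound for all of them. *)
Definition BC : nat := bcost (false, None) + bcost (false, Some true) + bcost (false, Some false)
  + (bcost (true, None) + bcost (true, Some true) + bcost (true, Some false)).

Lemma bcost_le b : bcost b <= BC.
Proof. by case: b => [[] [[]|]]; rewrite /BC; lia. Qed.

Lemma exT_block mm bl hd ct v r5 r6 r8 : size bl <= mm ->
  exT (blockp hd ct) (SB bl v r5 r6 r8) (SB (rcons bl (hd, ct)) v r5 r6 r8)
    (BC * (nsp + mm * nX).+1).
Proof.
move=> lb; set z := nsp + size bl * nX.
apply: exT_le; first apply: exT_eq.
- by apply: exT_seq; [apply: (@exT_emits z) | apply: exT_pushn].
- rewrite /SB block_edges_rcons rev_cat (map_cat enc_redge) flatten_cat size_rcons -/z.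
  have -> : map (rinst z) (map srcrel (template M hd ct)) = map (inst z) (template M hd ct).
    by rewrite -map_comp; apply: eq_map => -[[x a] y].
  have -> : nsp + (size bl).+1 * nX = nX + z by rewrite /z mulSn; lia.
  have E (F1 F2 : seq bool) : map inl ((F1 ++ F2) ++ [:: false]) =
      map inl F1 ++ map inl (F2 ++ [:: false]) :> seq sym by rewrite -catA map_cat.
  by rewrite nseqD E; stq9.
- have lz : z <= nsp + mm * nX by rewrite /z leq_add2l leq_mul2r lb orbT.
  have := bcost_le (hd, ct); rewrite /bcost /=; move: (ecosts _) => ec.
  by move: lz; move: (nsp + mm * nX) => zz; nia.
Qed.

Lemma exT_mul v a b : exT mul (Sx [::] v [::] (nseq a one) (nseq b one) [::])
  (Sx [::] v [::] (nseq (a * b) one) (nseq b one) [::]) (a * (15 * b + 4) + 2).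
Proof.
pose inv i := upd (Sx [::] v [::] (nseq (a - i) one) (nseq b one) [::]) 7 (nseq (i * b) one).
apply: exT_le; first apply: exT_eq.
- apply: (@exT_seq _ _ _ (inv a)).
    have -> : Sx [::] v [::] (nseq a one) (nseq b one) [::] = inv 0.
      by rewrite /inv subn0 mul0n; stq9.
    apply: (@exT_loop 5 _ (1 + (11 * b + 2)) inv a); last by rewrite /inv /= subnn.
    move=> i li; have ea : a - i = (a - i.+1).+1 by lia.
    split; first by rewrite /inv /= ea.
    apply: exT_eq.
      apply: exT_seq; first exact: exT_pop.
      by apply: (@exT_rept 6 7 4 _ b).
    by rewrite /inv !updE /= ea /= -nseqD -mulSn; stq9.
  exact: exT_mvall.
- by rewrite /inv !updE /= subnn map_id -[[::]]/(nseq 0 one) catrev_nseq addn0; stq9.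
- by rewrite /inv updE /= size_nseq; nia.
Qed.

Lemma exT_muls v a b e m : a * b ^ e <= m -> 0 < b ->
  exT (seqs (nseq e mul)) (Sx [::] v [::] (nseq a one) (nseq b one) [::])
  (Sx [::] v [::] (nseq (a * b ^ e) one) (nseq b one) [::]) (e * (m * (15 * b + 4) + 2) + 1).
Proof.
move=> h b0; elim: e a h => [|e IH] a h; first by rewrite muln1; apply: exT_skip.
apply: exT_le; first apply: exT_eq.
- by apply: exT_seqs; [apply: exT_mul | apply: IH; rewrite -mulnA -expnS].
- by rewrite -mulnA -expnS.
- have : a <= m by apply: leq_trans h; rewrite leq_pmulr // expn_gt0 b0.
  rewrite mulSn; move: (15 * b + 4) => x lm.
  have : a * x <= m * x by rewrite leq_mul2r lm orbT.
  lia.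
Qed.

Definition mmax n := Aof n + (n + 1) + Aof n.
Definition bmax n := BC * (nsp + mmax n * nX).+1.
(** One summand for each instruction of [reduce], nested in the same way, so that the bound arises
    from the rule for sequences without rearrangement. *)
Definition tmax n := (4 * n + 1) + ((n * 6 + 1) + (2 + ((2 * (4 * c + 1) + 1) +
  ((d * (Aof n * (15 * n.+1 + 4) + 2) + 1) + ((11 * Aof n + 2) + ((2 * nsp + 1) + (2 +
  ((Aof n * (1 + bmax n).+1 + 1) + ((bmax n).+2 + (1 + ((n * ((bmax n).+1 + 1).+1 + 1) +
  ((Aof n * (1 + bmax n).+1 + 1) + ((ecosts (map absrel (special M)) * (nsp + mmax n * nX).+1 + 1) +
  ((2 * size header + 1) + (2 + ((2 * (2 * nX) + 11 * (nsp + mmax n * nX) + 4) + 1)))))))))))))))).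

Lemma poly_tmax : poly tmax.
Proof. by rewrite /tmax /bmax /mmax /Aof; polyt. Qed.

Lemma exT_reduce w : exists2 s', s' 0 = map inl (enc_raw (raw_inst w))
  & exT reduce (input_store w) s' (tmax (size w)).
Proof.
set n := size w; set A := Aof n; set W := map inl w : seq sym.
have sW : size W = n by rewrite size_map.
have lmm bl : size bl <= size (bls w) -> size bl <= mmax n.
  move/leq_trans; apply; rewrite /bls /blocks /mmax -/n size_cat /= size_cat size_map !size_nseq size_behead.
  by rewrite -/n -/A; lia.
pose N1 := nseq A one; pose N6 := nseq n.+1 one.
eexists; last first.
- apply: exT_seqs.
    by apply: exT_le; [apply: exT_mvall | rewrite /= -/W sW addn1].
  apply: (@exT_seqs _ _ _ (Sx [::] W [::] [::] (nseq n one) [::])).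
    pose inv i := upd (Sx [::] (drop (n - i) W) [::] [::] (nseq i one) [::]) 1 (rev (take (n - i) W)).
    have -> : upd (upd (input_store w) 0 [::]) 1 (catrev (map id (input_store w 0)) (input_store w 1)) = inv 0.
      by rewrite /inv /= subn0 -sW take_size drop_size map_id catrevE cats0; stq9.
    have -> : Sx [::] W [::] [::] (nseq n one) [::] = inv n.
      by rewrite /inv subnn take0 drop0; stq9.
    apply: (@exT_loop 1 _ 5 inv n); last by rewrite /inv /= subnn take0.
    move=> i li; have e1 : n - i = (n - i.+1).+1 by lia.
    have lt1 : n - i.+1 < size W by lia.
    have et : rev (take (n - i) W) = nth one W (n - i.+1) :: rev (take (n - i.+1) W).
      by rewrite e1 (take_nth one) // rev_rcons.
    split; first by rewrite /inv /= et.
    apply: exT_le; first apply: exT_eq.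
    + apply: exT_seq; last exact: exT_pushc.
      by apply: (@exT_mv 1 2 id _ (nth one W (n - i.+1)) (rev (take (n - i.+1) W))); rewrite // /inv updE /= et.
    + by rewrite /inv !updE /= [drop (n - i.+1) W](drop_nth one) // -e1; stq9.
    + by [].
  apply: (@exT_seqs _ _ _ (Sx [::] W [::] [::] N6 [::])).
    by apply: exT_eq; [apply: exT_pushc | stq9].
  apply: (@exT_seqs _ _ _ (Sx [::] W [::] (nseq (4 * c + 1) one) N6 [::])).
    by apply: exT_eq; [apply: exT_pushn | rewrite /= cats0; stq9].
  apply: (@exT_seqs _ _ _ (Sx [::] W [::] N1 N6 [::])).
    by apply: (@exT_muls W (4 * c + 1) n.+1 d A).
  apply: (@exT_seqs _ _ _ (Sx [::] W [::] N1 N6 N1)).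
    apply: exT_eq; first by apply: (@exT_rept 5 8 7 _ A).
    by rewrite /= cats0; stq9.
  apply: (@exT_seqs _ _ _ (Sx [::] W (nseq nsp one) N1 N6 N1)).
    by apply: exT_eq; [apply: exT_pushn | rewrite /= cats0; stq9].
  apply: (@exT_seqs _ _ _ (SB [::] W N1 N6 N1)).
    by apply: exT_eq; [apply: exT_pushc | rewrite /SB /= mul0n addn0; stq9].
  pose b1 := nseq A (false, @None bool).
  apply: (@exT_seqs _ _ _ (SB b1 W [::] N6 N1)).
    pose inv i := SB (nseq i (false, None)) W (nseq (A - i) one) N6 N1.
    have -> : SB [::] W N1 N6 N1 = inv 0 by rewrite /inv subn0.
    have -> : SB b1 W [::] N6 N1 = inv A by rewrite /inv subnn.
    apply: (@exT_loop 5 _ (1 + bmax n) inv A); last by rewrite /inv /= subnn.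
    move=> i li; have ea : A - i = (A - i.+1).+1 by lia.
    split; first by rewrite /inv /= ea.
    apply: (@exT_seq _ _ _ (SB (nseq i (false, None)) W (nseq (A - i.+1) one) N6 N1)).
      by apply: exT_eq; [apply: exT_pop | rewrite /inv /= ea; stq9].
    rewrite /inv; have -> : nseq i.+1 (false, @None bool) = rcons (nseq i (false, None)) (false, None).
      by rewrite -cats1 -[[:: _]]/(nseq 1 (false, @None bool)) -nseqD addn1.
    by apply: exT_block; rewrite size_nseq /mmax -/A; lia.
  pose b2 := rcons b1 (true, ohead w).
  have lb1 : size b1 <= mmax n by rewrite size_nseq /mmax -/A; lia.
  apply: (@exT_seqs _ _ _ (SB b2 W [::] N6 N1)).
    have h V ct : exT (blockp true ct) (SB b1 V [::] N6 N1) (SB (rcons b1 (true, ct)) V [::] N6 N1) (bmax n).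
      exact: exT_block.
    rewrite /b2 /W; case: (w) h => [|[] v] h /=.
    + by apply: exT_if; apply: exT_if; apply: h.
    + by apply: exT_le; [apply: exT_if; apply: h | lia].
    + by apply: exT_if; apply: exT_if; apply: h.
  apply: (@exT_seqs _ _ _ (SB b2 (behead W) [::] N6 N1)).
    by apply: exT_eq; [apply: exT_pop | stq9].
  pose b3 := b2 ++ [seq (false, Some b) | b <- behead w].
  apply: (@exT_seqs _ _ _ (SB b3 [::] [::] N6 N1)).
    have eW : behead W = map inl (behead w) by rewrite /W; case: (w).
    pose u := behead w; have su : size u <= n by rewrite size_behead -/n; lia.
    pose inv i := SB (b2 ++ [seq (false, Some b) | b <- take i u]) (map inl (drop i u)) [::] N6 N1.
    have -> : SB b2 (behead W) [::] N6 N1 = inv 0 by rewrite /inv take0 drop0 cats0 eW.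
    have -> : SB b3 [::] [::] N6 N1 = inv (size u) by rewrite /inv take_size drop_size.
    apply: exT_le; first apply: (@exT_loop 2 _ ((bmax n).+1 + 1) inv (size u)).
    + move=> i li; have ed := drop_nth false li.
      split; first by rewrite /inv /= ed.
      have lb : size (b2 ++ [seq (false, Some b) | b <- take i u]) <= mmax n.
        rewrite size_cat size_rcons size_map size_take li size_nseq /mmax -/A; lia.
      apply: (@exT_seq _ _ _ (SB (b2 ++ [seq (false, Some b) | b <- take i.+1 u]) (map inl (drop i u)) [::] N6 N1)).
        rewrite (take_nth false) // map_rcons -rcons_cat.
        apply: exT_if; rewrite /inv -[ohead _]/(ohead (map inl (drop i u))) ed /=.
        by case: (nth false u i); apply: exT_block.
      by apply: exT_eq; [apply: exT_pop | rewrite /inv /= ed; stq9].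
    + by rewrite /inv /= drop_size.
    + by rewrite leq_add2r leq_mul2r su orbT.
  pose b4 := b3 ++ nseq A (false, None).
  have eb4 : b4 = bls w by rewrite /b4 /b3 /b2 /b1 /bls /blocks -/n -/A -cats1 -!catA.
  apply: (@exT_seqs _ _ _ (SB b4 [::] [::] N6 [::])).
    pose inv i := SB (b3 ++ nseq i (false, None)) [::] [::] N6 (nseq (A - i) one).
    have -> : SB b3 [::] [::] N6 N1 = inv 0 by rewrite /inv subn0 cats0.
    have -> : SB b4 [::] [::] N6 [::] = inv A by rewrite /inv subnn.
    apply: (@exT_loop 8 _ (1 + bmax n) inv A); last by rewrite /inv /= subnn.
    move=> i li; have ea : A - i = (A - i.+1).+1 by lia.
    split; first by rewrite /inv /= ea.
    apply: (@exT_seq _ _ _ (SB (b3 ++ nseq i (false, None)) [::] [::] N6 (nseq (A - i.+1) one))).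
      by apply: exT_eq; [apply: exT_pop | rewrite /inv /= ea; stq9].
    rewrite /inv; have -> : nseq i.+1 (false, @None bool) = rcons (nseq i (false, None)) (false, None).
      by rewrite -cats1 -[[:: _]]/(nseq 1 (false, @None bool)) -nseqD addn1.
    rewrite -rcons_cat; apply: exT_block; apply: lmm; rewrite -eb4 /b4 !size_cat !size_nseq; lia.
  rewrite eb4; set z := nsp + size (bls w) * nX.
  have lz : z <= nsp + mmax n * nX by rewrite /z leq_add2l leq_mul2r lmm ?orbT.
  apply: exT_seqs.
    apply: exT_le; first by apply: (@exT_emits z).
    by rewrite leq_add2r leq_mul2l ltnS lz orbT.
  apply: exT_seqs; first exact: exT_pushl.
  apply: exT_seqs; first exact: exT_pushc.
  apply: exT_seqs; last exact: exT_skip.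
  apply: exT_le; first by apply: (@exT_pushref z).
  by rewrite /=; lia.
- rewrite !updE !eqxx; set z := nsp + size (bls w) * nX.
  have -> : map (rinst z) (map absrel (special M)) = special M.
    by rewrite -map_comp -[RHS]map_id; apply: eq_map => -[[x a] y].
  set Fs := flatten (map enc_redge (rev (special M))).
  set Fb := flatten (map enc_redge (rev (block_edges M (bls w)))).
  have R : enc_raw (raw_inst w) =
      nseq (z + 2 * nX) true ++ false :: header ++ (Fs ++ (Fb ++ [:: false])).
    rewrite /enc_raw /header -[rn _]/(z + 2 * nX) -[rm _]/nlab -[rs _]/0 -[rH _]/highs.
    rewrite -[rC _]/(nseq nlab false) -[rE _]/(rev (block_edges M (bls w) ++ special M)).
    by rewrite rev_cat (map_cat enc_redge) flatten_cat -/Fs -/Fb /enc_nat -!cats1 -!catA.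
  rewrite R map_cat map_nseq map_cons (map_cat _ header) (map_cat _ Fs).
  by rewrite -[rval z _]/(z + 2 * nX).
Qed.

Lemma wf_raw_inst w : wf_raw (raw_inst w).
Proof.
apply/and3P; split; rewrite /= ?size_nseq ?eqxx //.
- by rewrite /sized /= !size_nseq !eqxx.
have sn : nsp <= nsp + size (bls w) * nX + 2 * nX by lia.
have eB D (x : X M) : D <= (size (bls w)).+1 -> encB D x < nsp + size (bls w) * nX + 2 * nX.
  move=> lD; have lx := rk_lt x; rewrite /encB.
  have : D * nX <= (size (bls w)).+1 * nX by rewrite leq_mul2r lD orbT.
  by rewrite mulSn; lia.
have n1 : 1 < nsp by rewrite /nsp; lia.
rewrite all_rev all_cat; apply/andP; split; apply/allP => -[[x a] y].
- case/mem_block => D [x0 [l [t [/andP[D0 lD] -> -> e ->]]]]; apply/and3P; split.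
  + by apply: eB; apply: leqW.
  + exact: encL_le.
  case: t e => [u _|[h x'] e] /=; first exact: leq_trans n1 sn.
  apply: eB; have : h <= 2; last lia.
  move: e; case: x0 => i [g|]; case: l => [[[[t|]|]|]|] //=.
  + by case: ifP => // _ [<- _]; case: (_.2).
  + by case=> <-.
  + by case: ifP => _ [<-].
- case/mem_special => s [l [-> -> e]]; apply/and3P; split.
  + exact: leq_trans (encSp_lt s) sn.
  + exact: encL_le.
  have eS (s' : sp M) : encSp s' < nsp + size (bls w) * nX + 2 * nX by apply: leq_trans (encSp_lt s') sn.
  have e1 : 1 < nsp + size (bls w) * nX + 2 * nX by apply: leq_trans n1 sn.
  move: e; case: s => [[q|]|]; case: l => [[[[t|]|]|]|] //=; try by case=> <-.
  + by case: ifP => _ [<-] //; apply: (eS (Some (Some _))).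
  + by case: ifP => // _ [<-].
  + by case=> <-; apply: (eS (Some (Some _))).
  + by case=> <-; apply: eB.
Qed.

End Reduction.

Lemma SNNI_hard : PSPACE_hard SNNI_controllable.
Proof.
move=> L [M [c [d HM]]]; exists (fun w => enc_raw (raw_inst M c d w)).
  apply: (@polytime_machine unit 8 (reduce M c d) _ (tmax M c d)).
  - exact: poly_tmax.
  - exact: reduce_vok.
  move=> w; have [s' e0 [t E lt]] := exT_reduce M c d w.
  by exists s', t.
move=> w; have [sp [t0 h0 Lw]] := HM w.
(* The histories describe the machine only as long as it has not halted, so the first halting time
   is needed. *)
have [t ht tmin] := ex_minnP (ex_intro (fun t => halt (config_at M w t).1) t0 h0).
have nh j : j < t -> ~~ halt (config_at M w j).1.
  by move=> lj; apply/negP => /tmin; rewrite leqNgt lj.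
rewrite controllable_enc; last exact: wf_raw_inst.
set J := raw_inst M c d w; set A := Aof c d (size w).
have JE : rE J =i special M ++ block_edges M (blocks w A).
  by move=> e; rewrite /= mem_rev !mem_cat orbC.
have Jh a : high J a = (a == 3).
  by case: a => [|[|[|[|a]]]] //; rewrite /high /= nth_nseq; case: ifP.
have Jc a : ctrl J a = false by case: a => [|a] //; rewrite /ctrl -[nth _ _ _]/(nth false (nseq (nlab M) false) a) nth_nseq; case: ifP.
have SA : (c * size w ^ d + c) + (c * size w ^ d + c) < A.
  rewrite /A /Aof.
  have h1 : size w ^ d <= (size w).+1 ^ d by case: (d) => // d'; rewrite leq_exp2r.
  have h2 : 0 < (size w).+1 ^ d by rewrite expn_gt0.
  by move: h1 h2; move: (size w ^ d) ((size w).+1 ^ d) => x y; nia.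
have ld : lowdet J by apply: lowdet_instance JE.
rewrite Lw -(halted_unique ht h0); split=> [acc|[_ iJ]].
  split; first exact: ld.
  exact: (@incl_accept M J w A erefl JE Jh Jc _ sp SA t ht acc).
apply/negPn/negP => nacc.
exact: (@reject_incl M J w A erefl JE Jh Jc t nh ht nacc iJ).
Qed.

End ReductionProgram.

Theorem theorem7 :
  PSPACE_complete SNNI_controllable /\
  PSPACE_search SNNI_controllable SNNI_synthesis.
Proof.
have [mem search] := SNNI_pspace.
by split=> //; split=> //; apply: SNNI_hard.
Qed.
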